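(* Let $\varsigma\in M^1(\mathbb{Z}^n\times\mathbb{T}^n)$ and $g\in M^1(\mathbb{Z}^n)$. Then the localization operator $\mathfrak{L}^{g,g}_\varsigma:\ell^2(\mathbb{Z}^n)\to\ell^2(\mathbb{Z}^n)$ is in $S_1$ and $$\|\mathfrak{L}^{g,g}_\varsigma\|_{S_1}\le 4\,\|\varsigma\|_{M^1(\mathbb{Z}^n\times\mathbb{T}^n)}\,\|g\|^2_{M^1(\mathbb{Z}^n)}.$$
   Context: $\mathbb{T}^n$ is the torus with normalized Haar measure $dw$; $\mathbb{Z}^n\times\mathbb{T}^n$ carries the product of counting measure and $dw$. $T_mf(k)=f(k-m)$, $M_wf(k)=e^{2\pi i w\cdot k}f(k)$, and the short-time Fourier transform is $V_gf(m,w)=\langle f,M_wT_mg\rangle=\sum_{k\in\mathbb{Z}^n}f(k)\overline{g(k-m)}e^{-2\pi i w\cdot k}$. $\mathcal{S}(\mathbb{Z}^n)$ is the space of rapidly decreasing functions on $\mathbb{Z}^n$, $\mathcal{S}'(\mathbb{Z}^n)$ its dual (tempered distributions); $\mathcal{S}(\mathbb{Z}^n\times\mathbb{T}^n)$ and $\mathcal{S}'(\mathbb{Z}^n\times\mathbb{T}^n)$ are the Schwartz functions and tempered distributions on the group $\mathbb{Z}^n\times\mathbb{T}^n$. Modulation spaces: fix a non-zero window $\phi\in\mathcal{S}(\mathbb{Z}^n)$; for $1\le p\le\infty$, $M^p(\mathbb{Z}^n)=\{f\in\mathcal{S}'(\mathbb{Z}^n): V_\phi f\in L^p(\mathbb{Z}^n\times\mathbb{T}^n)\}$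 with $\|f\|_{M^p(\mathbb{Z}^n)}=\|V_\phi f\|_{L^p}$. Similarly, fix a non-zero $\Phi\in\mathcal{S}(\mathbb{Z}^n\times\mathbb{T}^n)$ and set $$V_\Phi F(m,\omega,\xi,k)=\sum_{j\in\mathbb{Z}^n}\int_{\mathbb{T}^n}e^{-2\pi i j\xi}e^{-2\pi i\eta k}F(j,\eta)\overline{\Phi(j-m,\eta-\omega)}\,d\eta,\quad m,k\in\mathbb{Z}^n,\ \omega,\xi\in\mathbb{T}^n;$$ $M^p(\mathbb{Z}^n\times\mathbb{T}^n)$ is the space of $F\in\mathcal{S}'(\mathbb{Z}^n\times\mathbb{T}^n)$ with $\|F\|_{M^p(\mathbb{Z}^n\times\mathbb{T}^n)}=\|V_\Phi F\|_{L^p((\mathbb{Z}^n\times\mathbb{T}^n)\times(\mathbb{T}^n\times\mathbb{Z}^n))}<\infty$. Different windows give equivalent norms. Localization operator: for windows $g_1,g_2$ and symbol $\varsigma$, $\mathfrak{L}^{g_1,g_2}_\varsigma$ is defined in the weak sense by $$\langle\mathfrak{L}^{g_1,g_2}_\varsigma f,h\rangle_{\ell^2(\mathbb{Z}^n)}=\sum_{m\in\mathbb{Z}^n}\int_{\mathbb{T}^n}\varsigma(m,w)\,V_{g_1}f(m,w)\,\overline{V_{g_2}h(m,w)}\,dw,\qquad f,h\in\ell^2(\mathbb{Z}^n).$$ $S_1$ is the trace class on $\ell^2(\mathbb{Z}^n)$: compact operators whose singular values $s_n$ (eigenvalues of $|\mathcal{A}|=\sqrt{\mathcal{A}^*\mathcal{A}}$)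 are summable, with $\|\mathcal{A}\|_{S_1}=\sum_n s_n(\mathcal{A})$.
   Formalization: The norm inequality with constant 4 is stated for windows with ‖φ‖_2 ≥ 1 and sup|Φ| ≥ 1, since for arbitrary non-zero windows it fails (replace Φ by εΦ); membership in S_1 is proved for all non-zero windows. *)

(* Defs.v *)
From HB Require Import structures.
From mathcomp Require Import all_boot all_order all_algebra.
From mathcomp Require Import all_classical all_reals all_analysis.
From mathcomp Require Import complex.

Set Implicit Arguments.
Unset Strict Implicit.
Unset Printing Implicit Defensive.

Import Order.TTheory GRing.Theory Num.Theory.
Import numFieldNormedType.Exports.

Local Open Scope classical_set_scope.
Local Open Scope complex_scope.
Local Open Scope ring_scope.

Definition Zn (n : nat) : Type := 'rV[int]_n.

HB.instance Definition _ n := GRing.Zmodule.on (Zn n).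
HB.instance Definition _ n := Countable.on (Zn n).
HB.instance Definition _ n := isPointed.Build (Zn n) (0 : 'rV[int]_n).
HB.instance Definition _ n := @isMeasurable.Build default_measure_display
  (Zn n) discrete_measurable discrete_measurable0
  discrete_measurableC discrete_measurableU.

(* The library attaches the sigma-finite structure of [counting] to [nat];
   a separate constant is needed to attach one on Z^n. *)
Definition countZ (R : realType) (n : nat) : set (Zn n) -> \bar R := counting.

HB.instance Definition _ (R : realType) n :=
  Measure.copy (@countZ R n) (@counting (Zn n) R).

Lemma sigma_finite_countZ (R : realType) n :
  sigma_finite [set: Zn n] (@countZ R n).
Proof.
exists (fun m => [set k : Zn n | pickle k = m]).
  by apply/seteqP; split => // k _; exists (pickle k).
move=> m; split => //; rewrite /countZ /counting asboolT ?ltry//.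
have [[k km]|nk] := pselect (exists k : Zn n, pickle k = m); last first.
  rewrite (_ : [set _ | _] = set0)//.
  by apply/seteqP; split=> // k km; apply: nk; exists k.
apply: (@sub_finite_set _ _ [set k]) => // l /=; rewrite -km.
exact: (pcan_inj pickleK).
Qed.

HB.instance Definition _ (R : realType) n :=
  @Measure_isSigmaFinite.Build _ _ _ (@countZ R n) (sigma_finite_countZ R n).

(* Functions on the torus T^n = R^n / Z^n are functions of a representative
   in R^n that are 1-periodic in each coordinate (see [periodic]). *)
Definition Tn (R : realType) (n : nat) : Type := n.-tuple (measurableTypeR R).
HB.instance Definition _ R n := Measurable.on (Tn R n).

Section torus.
Context (R : realType).

Definition cons_Tn n (x : measurableTypeR R * Tn R n) : Tn R n.+1 :=
  cons_tuple x.1 x.2.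

Lemma measurable_cons_Tn n : measurable_fun setT (@cons_Tn n).
Proof. exact: measurable_cons. Qed.

HB.instance Definition _ n :=
  isMeasurableFun.Build _ _ _ _ (@cons_Tn n) (@measurable_cons_Tn n).

(* n-fold product of the uniform probability on [0, 1] *)
Fixpoint haar n : probability (Tn R n) R :=
  match n with
  | 0 => \d_([tuple] : Tn R 0)
  | m.+1 => distribution (uniform_prob (@ltr01 R) \x haar m)%E (@cons_Tn m)
  end.
End torus.

Section complex_integration.
Context d (T : measurableType d) (R : realType).
Variable mu : {measure set T -> \bar R}.
Implicit Type F : T -> R[i].

Definition cmeasurable F : Prop :=
  measurable_fun setT (fun x => complex.Re (F x)) /\
  measurable_fun setT (fun x => complex.Im (F x)).

Definition cintegrable F : Prop :=
  mu.-integrable setT (fun x => (complex.Re (F x))%:E) /\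
  mu.-integrable setT (fun x => (complex.Im (F x))%:E).

Definition cint F : R[i] :=
  (\int[mu]_x complex.Re (F x)) +i* (\int[mu]_x complex.Im (F x)).

Definition cLnorm (p : \bar R) F : \bar R := 
  Lnorm mu p (fun x => (Normc.normc (F x))%:E).

Definition cLp (p : \bar R) F : Prop :=
  cmeasurable F /\ (cLnorm p F < +oo)%E.

End complex_integration.

Section test_functions.
Context (R : realType) (n : nat).
Local Notation C := R[i].
Local Notation ZT := (Zn n * Tn R n)%type.

Definition weight (k : Zn n) : R := 1 + (\sum_(i < n) `|k ord0 i|)%:~R.

Definition dot (w : Tn R n) (k : Zn n) : R :=
  \sum_(i < n) tnth w i * (k ord0 i)%:~R.

(* e^{2 pi i w.k} *)
Definition echar (w : Tn R n) (k : Zn n) : C :=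
  cos (2 * pi * dot w k) +i* sin (2 * pi * dot w k).

Definition subT (x y : Tn R n) : Tn R n := [tuple tnth x i - tnth y i | i < n].

Definition shift (x : Tn R n) (i : 'I_n) (t : R) : Tn R n :=
  [tuple tnth x j + (if j == i then t else 0) | j < n].

Definition periodic (F : Tn R n -> C) : Prop :=
  forall x i, F (shift x i 1) = F x.

Definition partial (i : 'I_n) (F : Tn R n -> C) : Tn R n -> C := fun x =>
  derive1 (fun t => complex.Re (F (shift x i t))) 0 +i*
  derive1 (fun t => complex.Im (F (shift x i t))) 0.

Definition has_partial (i : 'I_n) (F : Tn R n -> C) : Prop := forall x,
  derivable (fun t => complex.Re (F (shift x i t))) (0 : R) 1 /\
  derivable (fun t => complex.Im (F (shift x i t))) (0 : R) 1.

Definition partials (s : seq 'I_n) (F : Tn R n -> C) : Tn R n -> C :=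
  foldr partial F s.

Definition seminormZ (N : nat) (f : Zn n -> C) : \bar R :=
  ereal_sup [set (weight k ^+ N * Normc.normc (f k))%:E | k in [set: Zn n]].

Definition schwartzZ (f : Zn n -> C) : Prop :=
  forall N, (seminormZ N f < +oo)%E.

Definition seminormZT (N : nat) (F : ZT -> C) : \bar R :=
  ereal_sup [set y | exists k x (s : seq 'I_n), (size s <= N)%N /\
    y = (weight k ^+ N * Normc.normc (partials s (fun x' => F (k, x')) x))%:E].

(* Since all iterated partial derivatives are bounded, they are all
   continuous, so that each [F (k, _)] is smooth on the torus. *)
Definition schwartzZT (F : ZT -> C) : Prop :=
  [/\ forall k, periodic (fun x => F (k, x)),
      forall k (s : seq 'I_n) i, has_partial i (partials s (fun x => F (k, x)))
    & forall N, (seminormZT N F < +oo)%E].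

(* Tempered distributions are bilinear pairings with test functions; their
   values outside the Schwartz space are irrelevant. *)
Definition temperedZ (u : (Zn n -> C) -> C) : Prop :=
  (forall (a : C) f h, schwartzZ f -> schwartzZ h ->
     u (fun k => a * f k + h k) = a * u f + u h) /\
  exists (N : nat) (c : R), forall f, schwartzZ f ->
    ((Normc.normc (u f))%:E <= c%:E * seminormZ N f)%E.

Definition temperedZT (u : (ZT -> C) -> C) : Prop :=
  (forall (a : C) F H, schwartzZT F -> schwartzZT H ->
     u (fun x => a * F x + H x) = a * u F + u H) /\
  exists (N : nat) (c : R), forall F, schwartzZT F ->
    ((Normc.normc (u F))%:E <= c%:E * seminormZT N F)%E.

(* Every tempered distribution on Z^n is the function whose value at [k] is
   its pairing with the indicator of {k}. *)
Definition funZ (u : (Zn n -> C) -> C) : Zn n -> C :=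
  fun k => u (fun j => (j == k)%:R).

End test_functions.

Section product_measures.
Context (R : realType) (n : nat).

Lemma product_measure1_sigma_finite d1 d2 (T1 : measurableType d1)
    (T2 : measurableType d2) (m1 : {sigma_finite_measure set T1 -> \bar R})
    (m2 : {sigma_finite_measure set T2 -> \bar R}) :
  sigma_finite [set: T1 * T2] (m1 \x m2)%E.
Proof.
have /sigma_finiteP[F [TF ndF Foo]] := sigma_finiteT m1.
have /sigma_finiteP[G [TG ndG Goo]] := sigma_finiteT m2.
exists (fun n => F n `*` G n).
  rewrite -setXTT TF TG predeqE => -[x y]; split.
    move=> [/= [m _ Fmx] [k _ Gky]]; exists (maxn m k) => //; split.
    - by move: x Fmx; exact/subsetPset/ndF/leq_maxl.
    - by move: y Gky; exact/subsetPset/ndG/leq_maxr.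
  by move=> [m _ []/= ? ?]; split; exists m.
move=> k; have [? ?] := Foo k; have [? ?] := Goo k.
split; first exact: measurableX.
by rewrite product_measure1E// lte_mul_pinfty// ge0_fin_numE.
Qed.

(* The library's canonical sigma-finite structure on [m1 \x m2] is only found
   for subprobabilities, hence the named constants. *)
Definition muZT : set (Zn n * Tn R n) -> \bar R := (@countZ R n \x haar R n)%E.
HB.instance Definition _ := Measure.copy muZT (@countZ R n \x haar R n)%E.
HB.instance Definition _ := @Measure_isSigmaFinite.Build _ _ _ muZT
  (product_measure1_sigma_finite (@countZ R n) (haar R n)).

Definition muTZ : set (Tn R n * Zn n) -> \bar R := (haar R n \x @countZ R n)%E.
HB.instance Definition _ := Measure.copy muTZ (haar R n \x @countZ R n)%E.
HB.instance Definition _ := @Measure_isSigmaFinite.Build _ _ _ muTZ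
  (product_measure1_sigma_finite (haar R n) (@countZ R n)).

Definition muZTTZ : set ((Zn n * Tn R n) * (Tn R n * Zn n)) -> \bar R :=
  (muZT \x muTZ)%E.
HB.instance Definition _ := Measure.copy muZTTZ (muZT \x muTZ)%E.
HB.instance Definition _ := @Measure_isSigmaFinite.Build _ _ _ muZTTZ
  (product_measure1_sigma_finite muZT muTZ).

End product_measures.

Section modulation_spaces.
Context (R : realType) (n : nat).
Local Notation C := R[i].
Local Notation ZT := (Zn n * Tn R n)%type.
Local Notation TZ := (Tn R n * Zn n)%type.
Local Notation cnt := (@countZ R n).
Local Notation muZT := (@muZT R n).
Local Notation muZTTZ := (@muZTTZ R n).

(* the distribution [u] is (integration against) the function [F] *)
Definition represents (u : (ZT -> C) -> C) (F : ZT -> C) : Prop :=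
  [/\ cmeasurable F, forall k, periodic (fun x => F (k, x)) &
      forall H, schwartzZT H ->
        cintegrable muZT (fun x => F x * H x) /\
        u H = cint muZT (fun x => F x * H x)].

Definition stft (g f : Zn n -> C) : ZT -> C := fun '(m, w) =>
  cint cnt (fun k => f k * conjc (g (k - m)) * conjc (echar w k)).

(* <u, M_w T_m phi>, the scalar product being conjugate linear on the right *)
Definition stft_distrZ (phi : Zn n -> C) (u : (Zn n -> C) -> C) : ZT -> C :=
  fun '(m, w) => u (fun k => conjc (echar w k * phi (k - m))).

Definition stft_distrZT (Phi : ZT -> C) (u : (ZT -> C) -> C) : ZT * TZ -> C :=
  fun '((m, w), (xi, k)) =>
    u (fun '(j, eta) =>
      conjc (echar xi j * echar eta k * Phi (j - m, subT eta w))).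

Definition modnormZ (phi : Zn n -> C) (p : \bar R) u : \bar R :=
  cLnorm muZT p (stft_distrZ phi u).

Definition modZ (phi : Zn n -> C) (p : \bar R) u : Prop :=
  temperedZ u /\ cLp muZT p (stft_distrZ phi u).

Definition modnormZT (Phi : ZT -> C) (p : \bar R) u : \bar R :=
  cLnorm muZTTZ p (stft_distrZT Phi u).

Definition modZT (Phi : ZT -> C) (p : \bar R) u : Prop :=
  temperedZT u /\ cLp muZTTZ p (stft_distrZT Phi u).

End modulation_spaces.

Section operators.
Context (R : realType) (n : nat).
Local Notation C := R[i].
Local Notation ZT := (Zn n * Tn R n)%type.
Local Notation cnt := (@countZ R n).
Implicit Types (f h : Zn n -> C) (A B P : (Zn n -> C) -> Zn n -> C).

Definition l2norm f : \bar R := cLnorm cnt 2%:E f.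

Definition l2 f : Prop := cLp cnt 2%:E f.

Definition inner f h : C := cint cnt (fun k => f k * conjc (h k)).

(* Operators on l^2(Z^n): their values outside l^2 are irrelevant. *)
Definition bounded_op A : Prop :=
  [/\ forall f, l2 f -> l2 (A f),
      forall (a : C) f h, l2 f -> l2 h ->
        A (fun k => a * f k + h k) = (fun k => a * A f k + A h k)
    & exists c : R, forall f, l2 f -> (l2norm (A f) <= c%:E * l2norm f)%E].

Definition compact_op A : Prop :=
  bounded_op A /\
  forall f_ : nat -> Zn n -> C,
    (forall m, l2 (f_ m)) -> (exists c : R, forall m, (l2norm (f_ m) <= c%:E)%E) ->
    exists e : nat -> nat, {homo e : i j / (i < j)%N} /\
    exists2 h, l2 h &
      (fun m => l2norm (fun k => A (f_ (e m)) k - h k)) @ \oo --> (0 : \bar R).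

Definition adjoint_op A B : Prop :=
  bounded_op B /\ forall f h, l2 f -> l2 h -> inner (A f) h = inner f (B h).

Definition positive_op P : Prop :=
  bounded_op P /\ forall f, l2 f -> 0 <= inner (P f) f.

(* P = |A|, the positive square root of A^* A *)
Definition is_abs_op A P : Prop :=
  positive_op P /\
  exists2 B, adjoint_op A B & forall f, l2 f -> P (P f) = B (A f).

Definition abs_op A := xget (fun f => f) [set P | is_abs_op A P].

(* dimension (possibly +oo) of the eigenspace of P for the eigenvalue lambda *)
Definition eigenmult P (lambda : R) : \bar R :=
  ereal_sup [set m%:R%:E | m in [set m | exists v : 'I_m -> Zn n -> C,
    (forall i, l2 (v i) /\ P (v i) = (fun k => lambda%:C * v i k)) /\
    (forall c : 'I_m -> C,
       (forall k, \sum_(i < m) c i * v i k = 0) -> forall i, c i = 0)]].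

(* sum of the eigenvalues of |A|, counted with multiplicity *)
Definition S1norm A : \bar R :=
  \esum_(lambda in [set lambda : R | 0 < lambda])
    (lambda%:E * eigenmult (abs_op A) lambda)%E.

Definition in_S1 A : Prop :=
  [/\ compact_op A, exists P, is_abs_op A P & (S1norm A < +oo)%E].

Definition localization_op (g1 g2 : Zn n -> C) (symb : ZT -> C) A : Prop :=
  bounded_op A /\
  forall f h, l2 f -> l2 h ->
    let F x := symb x * stft g1 f x * conjc (stft g2 h x) in
    cintegrable (@muZT R n) F /\ inner (A f) h = cint (@muZT R n) F.

End operators.

(* Main.v *)
(* The distribution sigma has Fourier coefficients d(j, l), and pairing V_Phi
   sigma with characters in both torus variables isolates d(j, l) times one
   Fourier coefficient of the window.  Hence the d(j, l) are summable, sigma is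
   a function [symb] continuous in the torus variable, and
   |symb conj Phi(. - m, . - w)| is at most the sum over k of its Fourier
   coefficients, which are integrals of V_Phi sigma in xi; summing over m and
   integrating over w gives ||symb||_1 |Phi(z)| <= ||sigma||_(M^1) for all z.
   In the same way |G(k) phi(k - m)| <= int |V_phi g(m, w)| dw for G = [funZ g],
   so G is summable, and the orthogonality relations together with
   |V_phi g| <= ||G||_2 ||phi||_2 yield ||G||_2 ||phi||_2 <= ||g||_(M^1).
   As G is summable, the operator L f(k) = int symb V_G f (M_w T_m G)(k)
   satisfies |L f(k)| <= C ||f||_2 a(k) with a summable, whence its compactness.
   If u_i are orthonormal eigenvectors of |L| with eigenvalues lambda_i > 0, then
   w_i = L u_i / lambda_i is orthonormal and, by Bessel's inequality,
   sum lambda_i = sum <L u_i, w_i> = int symb sum V_G u_i conj (V_G w_i)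
   <= ||symb||_1 ||G||_2^2. *)

Require Import Defs.
From HB Require Import structures.
From mathcomp Require Import all_boot all_order all_algebra.
From mathcomp Require Import all_classical all_reals all_analysis.
From mathcomp Require Import complex ring lra.
From mathcomp Require Import measurable_realfun.
From mathcomp Require finmap.
Set Implicit Arguments.
Unset Strict Implicit.
Unset Printing Implicit Defensive.
Import Order.TTheory GRing.Theory Num.Theory.
Import numFieldNormedType.Exports.
Local Open Scope classical_set_scope.
Local Open Scope complex_scope.
Local Open Scope ring_scope.

(** * Integration of complex-valued functions *)

(** A tempered distribution is here a linear functional bounded by one seminorm, so it cannot be
    interchanged with an integral directly. Every computation with it goes through finite
    combinations of characters: [dens M H] approximates a Schwartz function [H] in each seminorm
    with an error of order 1 / (M + 1), and for the test functions defining V the error is uniform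
    in [w] and [xi]. Identities that are finite sums for the approximants then pass to the limit.
    The same Fejer means give the translation invariance of [haar] and the bound of a sup norm by a
    sum of Fourier coefficients.

    The trace norm is a sum over the eigenvalues of [abs_op], a choice among the operators
    satisfying [is_abs_op]. Existence comes from an iteration for the square root, and the spectral
    estimates are made on finite orthonormal families.

    The bound comes out with constant 1. Rescaling a window rescales the norms, hence the
    normalizations in the last conjunct: the one on [Phi] frees ||symb||_1 from the factor |Phi(z)|,
    the one on [phi] frees ||G||_2 from the factor ||phi||_2. *)

Notation normc := Normc.normc.
Notation Re := complex.Re.
Notation Im := complex.Im.

Section normc.
Context (R : realType).
Implicit Types x y z : R[i].

Lemma normc_ge0 z : 0 <= normc z.
Proof. by case: z => a b; exact: sqrtr_ge0. Qed.

Lemma normcD_le x y : normc (x + y) <= normc x + normc y.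
Proof. exact: le_normcD. Qed.

Lemma normcN z : normc (- z) = normc z.
Proof. exact: complex.normcN. Qed.

Lemma normcBC x y : normc (x - y) = normc (y - x).
Proof. by rewrite -normcN opprB. Qed.

Lemma normcB_le x y : normc (x - y) <= normc x + normc y.
Proof. by rewrite -[normc y]normcN; exact: normcD_le. Qed.

Lemma normc_dist x y : `|normc x - normc y| <= normc (x - y).
Proof.
rewrite ler_norml; apply/andP; split.
  rewrite lerNl opprB lerBlDr normcBC; apply: le_trans (normcD_le _ _).
  by rewrite subrK.
by rewrite lerBlDr; apply: le_trans (normcD_le _ _); rewrite subrK.
Qed.

Lemma normc_conj z : normc (conjc z) = normc z.
Proof. by case: z => a b /=; rewrite sqrrN. Qed.

Lemma normc_real (r : R) : normc r%:C = `|r|.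
Proof. by rewrite /= expr0n addr0 sqrtr_sqr. Qed.

Lemma ge0_normc_real (r : R) : 0 <= r -> normc r%:C = r.
Proof. by move=> r0; rewrite normc_real ger0_norm. Qed.

Lemma normRe_le z : `|Re z| <= normc z.
Proof.
case: z => a b /=; rewrite -sqrtr_sqr ler_wsqrtr// lerDl; exact: sqr_ge0.
Qed.

Lemma normIm_le z : `|Im z| <= normc z.
Proof.
case: z => a b /=; rewrite -sqrtr_sqr ler_wsqrtr// lerDr; exact: sqr_ge0.
Qed.

Lemma normc_le z : normc z <= `|Re z| + `|Im z|.
Proof.
case: z => a b /=; rewrite -[leRHS]ger0_norm ?addr_ge0// -sqrtr_sqr.
rewrite ler_wsqrtr// sqrrD !real_normK ?num_real// addrAC lerDl.
by rewrite mulrn_wge0// mulr_ge0.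
Qed.

Lemma mulcJ z : z * conjc z = (normc z ^+ 2)%:C.
Proof.
case: z => a b; rewrite /= sqr_sqrtr ?addr_ge0 ?sqr_ge0//.
by apply/eqP; rewrite eq_complex /=; apply/andP; split; apply/eqP; ring.
Qed.

Lemma normc_eq0 z : (normc z == 0) = (z == 0).
Proof.
by apply/eqP/eqP => [/Normc.eq0_normc//|->]; rewrite Normc.normc0.
Qed.

Lemma normc_gt0 z : (0 < normc z) = (z != 0).
Proof. by rewrite lt_neqAle normc_ge0 andbT eq_sym normc_eq0. Qed.

Lemma normc_sum I (r : seq I) (P : pred I) (F : I -> R[i]) :
  normc (\sum_(i <- r | P i) F i) <= \sum_(i <- r | P i) normc (F i).
Proof.
elim/big_rec2: _ => [|i y1 y2 _ h]; first by rewrite Normc.normc0.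
by apply: le_trans (normcD_le _ _) _; rewrite lerD2l.
Qed.

Lemma ReD x y : Re (x + y) = Re x + Re y. Proof. by case: x; case: y. Qed.
Lemma ImD x y : Im (x + y) = Im x + Im y. Proof. by case: x; case: y. Qed.
Lemma ReN x : Re (- x) = - Re x. Proof. by case: x. Qed.
Lemma ImN x : Im (- x) = - Im x. Proof. by case: x. Qed.
Lemma ReM x y : Re (x * y) = Re x * Re y - Im x * Im y.
Proof. by case: x; case: y. Qed.
Lemma ImM x y : Im (x * y) = Re x * Im y + Im x * Re y.
Proof. by case: x; case: y. Qed.
Lemma Re_conj x : Re (conjc x) = Re x. Proof. by case: x. Qed.
Lemma Im_conj x : Im (conjc x) = - Im x. Proof. by case: x. Qed.

Lemma complexP x y : Re x = Re y -> Im x = Im y -> x = y.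
Proof. by case: x; case: y => a b c d /= -> ->. Qed.

Lemma conjcD x y : conjc (x + y) = conjc x + conjc y.
Proof. exact: rmorphD. Qed.
Lemma conjcM x y : conjc (x * y) = conjc x * conjc y.
Proof. exact: rmorphM. Qed.
Lemma conjcB x y : conjc (x - y) = conjc x - conjc y.
Proof. exact: rmorphB. Qed.

End normc.

Section cint_theory.
Context d (T : measurableType d) (R : realType).
Implicit Types F G : T -> R[i].

Lemma eq_cmeasurable F G : F =1 G -> cmeasurable F -> cmeasurable G.
Proof. by move=> /funext ->. Qed.

Lemma cmeasurable_cst (c : R[i]) : cmeasurable (fun _ : T => c).
Proof. by split; exact: measurable_cst. Qed.

Lemma cmeasurableD F G :
  cmeasurable F -> cmeasurable G -> cmeasurable (fun x => F x + G x).
Proof.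
move=> [F1 F2] [G1 G2]; split.
  by under eq_fun do rewrite ReD; exact: measurable_funD.
by under eq_fun do rewrite ImD; exact: measurable_funD.
Qed.

Lemma cmeasurableN F : cmeasurable F -> cmeasurable (fun x => - F x).
Proof.
move=> [F1 F2]; split.
  by under eq_fun do rewrite ReN; exact: measurableT_comp.
by under eq_fun do rewrite ImN; exact: measurableT_comp.
Qed.

Lemma cmeasurableB F G :
  cmeasurable F -> cmeasurable G -> cmeasurable (fun x => F x - G x).
Proof. by move=> mF mG; exact: cmeasurableD mF (cmeasurableN mG). Qed.

Lemma cmeasurableM F G :
  cmeasurable F -> cmeasurable G -> cmeasurable (fun x => F x * G x).
Proof.
move=> [F1 F2] [G1 G2]; split.
  under eq_fun do rewrite ReM.
  by apply: measurable_funB; exact: measurable_funM.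
under eq_fun do rewrite ImM.
by apply: measurable_funD; exact: measurable_funM.
Qed.

Lemma cmeasurableJ F : cmeasurable F -> cmeasurable (fun x => conjc (F x)).
Proof.
move=> [F1 F2]; split; first by under eq_fun do rewrite Re_conj.
by under eq_fun do rewrite Im_conj; exact: measurableT_comp.
Qed.

Lemma measurable_normc F :
  cmeasurable F -> measurable_fun setT (fun x => normc (F x)).
Proof.
move=> [F1 F2].
rewrite (_ : (fun x => _) = @Num.sqrt R \o (fun x => Re (F x) ^+ 2 + Im (F x) ^+ 2)).
  apply: measurableT_comp.
    by apply: continuous_measurable_fun; exact: sqrt_continuous.
  by apply: measurable_funD; exact: measurable_funX.
by apply/funext => x /=; case: (F x).
Qed.

Lemma measurable_enormc F :
  cmeasurable F -> measurable_fun setT (fun x => (normc (F x))%:E).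
Proof. by move=> mF; apply/measurable_EFinP; exact: measurable_normc. Qed.

Lemma cmeasurable_sum I (r : seq I) (P : pred I) (F : I -> T -> R[i]) :
  (forall i, P i -> cmeasurable (F i)) ->
  cmeasurable (fun x => \sum_(i <- r | P i) F i x).
Proof.
move=> mF; elim: r => [|i r ih].
  by under eq_fun do rewrite big_nil; exact: cmeasurable_cst.
have [Pi|/negbTE nPi] := boolP (P i); last by under eq_fun do rewrite big_cons nPi.
under eq_fun do rewrite big_cons Pi.
by apply: cmeasurableD => //; exact: mF.
Qed.

Lemma cmeasurable_cvg (F_ : nat -> T -> R[i]) F :
  (forall m, cmeasurable (F_ m)) ->
  (forall x, (fun m => normc (F_ m x - F x)) @ \oo --> (0 : R)) ->
  cmeasurable F.
Proof.
move=> mF cF.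
have cv (f : R[i] -> R) x : (forall z, `|f z| <= normc z) ->
    (forall y z, f (y - z) = f y - f z) ->
    (fun m => f (F_ m x)) @ \oo --> f (F x).
  move=> fle fB; apply/cvgrPdist_le => e e0.
  have /cvgrPdist_le/(_ e e0) := cF x; apply: filterS => m.
  rewrite sub0r normrN (ger0_norm (normc_ge0 _)) => /(le_trans _); apply.
  by rewrite distrC -fB.
split.
  apply: (@measurable_fun_cvg _ T R setT (fun m x => Re (F_ m x))) => //.
    by move=> m; exact: (mF m).1.
  move=> x _; apply: cv => [z|y z]; first exact: normRe_le.
  by rewrite ReD ReN.
apply: (@measurable_fun_cvg _ T R setT (fun m x => Im (F_ m x))) => //.
  by move=> m; exact: (mF m).2.
move=> x _; apply: cv => [z|y z]; first exact: normIm_le.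
by rewrite ImD ImN.
Qed.

Variable mu : {measure set T -> \bar R}.

(** The L^1 norm, kept in the extended reals so that bounds can be proved before integrability is
    known. *)
Definition nint F : \bar R := (\int[mu]_x (normc (F x))%:E)%E.

Lemma nint_ge0 F : (0 <= nint F)%E.
Proof. by apply: integral_ge0 => x _; rewrite lee_fin normc_ge0. Qed.

Lemma le_nint F (g : T -> \bar R) : cmeasurable F -> measurable_fun setT g ->
  (forall x, (normc (F x))%:E <= g x)%E -> (nint F <= \int[mu]_x g x)%E.
Proof.
move=> mF mg Fg; apply: ge0_le_integral => //.
- by move=> x _; rewrite lee_fin normc_ge0.
- exact: measurable_enormc.
Qed.

Lemma cintegrableP F : cintegrable mu F <-> cmeasurable F /\ (nint F < +oo)%E.
Proof.
split=> [[/integrableP[F1 F1oo] /integrableP[F2 F2oo]]|[mF Foo]].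
  have mF : cmeasurable F by split; exact/measurable_EFinP.
  split => //; apply: (@le_lt_trans _ _
    (\int[mu]_x (`|(Re (F x))%:E| + `|(Im (F x))%:E|))%E).
    apply: le_nint => //; first by apply: emeasurable_funD; exact: measurableT_comp.
    by move=> x; rewrite /= -EFinD lee_fin normc_le.
  rewrite ge0_integralD//; try exact: measurableT_comp.
  by rewrite lte_add_pinfty.
split; apply/integrableP; split.
- by apply/measurable_EFinP; exact: mF.1.
- apply: le_lt_trans Foo; apply: ge0_le_integral => //.
  + by apply: measurableT_comp => //; apply/measurable_EFinP; exact: mF.1.
  + exact: measurable_enormc.
  + by move=> x _; rewrite /= lee_fin normRe_le.
- by apply/measurable_EFinP; exact: mF.2.
- apply: le_lt_trans Foo; apply: ge0_le_integral => //.
  + by apply: measurableT_comp => //; apply/measurable_EFinP; exact: mF.2.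
  + exact: measurable_enormc.
  + by move=> x _; rewrite /= lee_fin normIm_le.
Qed.

Lemma cintegrable_meas F : cintegrable mu F -> cmeasurable F.
Proof. by move/cintegrableP => []. Qed.

Lemma cintegrable_nint F : cintegrable mu F -> (nint F < +oo)%E.
Proof. by move/cintegrableP => []. Qed.

Lemma cintegrable_norm F : cintegrable mu F ->
  mu.-integrable setT (fun x => (normc (F x))%:E).
Proof.
move/cintegrableP => [mF Foo]; apply/integrableP; split.
  exact: measurable_enormc.
by under eq_integral do rewrite gee0_abs ?lee_fin ?normc_ge0//.
Qed.

Lemma le_cintegrable F (g : T -> \bar R) : cmeasurable F ->
  measurable_fun setT g -> (\int[mu]_x g x < +oo)%E ->
  (forall x, (normc (F x))%:E <= g x)%E -> cintegrable mu F.
Proof.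
move=> mF mg goo Fg; apply/cintegrableP; split => //.
by apply: le_lt_trans goo; exact: le_nint.
Qed.

Lemma cintegrable_dom F G : cmeasurable F -> cintegrable mu G ->
  (forall x, normc (F x) <= normc (G x)) -> cintegrable mu F.
Proof.
move=> mF /cintegrableP[mG Goo] FG; apply: le_cintegrable Goo _ => //.
exact: measurable_enormc.
Qed.

Lemma cintegrable0 : cintegrable mu (fun _ => 0).
Proof. by split; exact: integrable0. Qed.

Lemma cintegrableD F G : cintegrable mu F -> cintegrable mu G ->
  cintegrable mu (fun x => F x + G x).
Proof.
move=> [F1 F2] [G1 G2]; split.
  by under eq_fun do rewrite ReD EFinD; exact: integrableD.
by under eq_fun do rewrite ImD EFinD; exact: integrableD.
Qed.

Lemma cintegrableZ (c : R[i]) F : cintegrable mu F ->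
  cintegrable mu (fun x => c * F x).
Proof.
move=> iF; have [mF Foo] := (cintegrableP _).1 iF.
apply/cintegrableP; split.
  by apply: cmeasurableM => //; exact: cmeasurable_cst.
rewrite /nint; under eq_integral do rewrite Normc.normcM EFinM.
rewrite ge0_integralZl_EFin ?normc_ge0//.
- by rewrite lte_mul_pinfty ?lee_fin ?normc_ge0.
- by move=> x _; rewrite lee_fin normc_ge0.
- exact: measurable_enormc.
Qed.

Lemma cintegrableN F : cintegrable mu F -> cintegrable mu (fun x => - F x).
Proof.
by move=> iF; under eq_fun do rewrite -mulN1r; exact: cintegrableZ.
Qed.

Lemma cintegrableB F G : cintegrable mu F -> cintegrable mu G ->
  cintegrable mu (fun x => F x - G x).
Proof. by move=> iF iG; exact: cintegrableD iF (cintegrableN iG). Qed.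

Lemma cintegrableJ F : cintegrable mu F ->
  cintegrable mu (fun x => conjc (F x)).
Proof.
move=> [F1 F2]; split; first by under eq_fun do rewrite Re_conj.
by under eq_fun do rewrite Im_conj EFinN; exact: integrableN.
Qed.

Lemma cintegrable_sum I (r : seq I) (P : pred I) (F : I -> T -> R[i]) :
  (forall i, P i -> cintegrable mu (F i)) ->
  cintegrable mu (fun x => \sum_(i <- r | P i) F i x).
Proof.
move=> iF; elim: r => [|i r ih].
  by under eq_fun do rewrite big_nil; exact: cintegrable0.
have [Pi|/negbTE nPi] := boolP (P i); last by under eq_fun do rewrite big_cons nPi.
under eq_fun do rewrite big_cons Pi.
by apply: cintegrableD => //; exact: iF.
Qed.

Lemma eq_cint F G : F =1 G -> cint mu F = cint mu G.
Proof. by move=> /funext ->. Qed.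

Lemma cint0 : cint mu (fun _ => 0) = 0.
Proof. by rewrite /cint /= Rintegral_cst// mul0r. Qed.

Lemma cintD F G : cintegrable mu F -> cintegrable mu G ->
  cint mu (fun x => F x + G x) = cint mu F + cint mu G.
Proof.
move=> [F1 F2] [G1 G2]; apply: complexP; rewrite ?ReD ?ImD /=.
  by under eq_Rintegral do rewrite ReD; rewrite RintegralD.
by under eq_Rintegral do rewrite ImD; rewrite RintegralD.
Qed.

Lemma cintZ (c : R[i]) F : cintegrable mu F ->
  cint mu (fun x => c * F x) = c * cint mu F.
Proof.
move=> [F1 F2].
have iZ (r : R) (f : T -> R) : mu.-integrable setT (fun x => (f x)%:E) ->
    mu.-integrable setT (EFin \o (fun x => r * f x)).
  by move=> fi; rewrite /comp; under eq_fun do rewrite EFinM; exact: integrableZl.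
apply: complexP; rewrite ?ReM ?ImM /=.
  under eq_Rintegral do rewrite ReM.
  by rewrite RintegralB ?RintegralZl//; exact: iZ.
under eq_Rintegral do rewrite ImM.
by rewrite RintegralD ?RintegralZl//; exact: iZ.
Qed.

Lemma cintZr (c : R[i]) F : cintegrable mu F ->
  cint mu (fun x => F x * c) = cint mu F * c.
Proof.
by move=> iF; under eq_cint do rewrite mulrC; rewrite cintZ// mulrC.
Qed.

Lemma cintN F : cintegrable mu F -> cint mu (fun x => - F x) = - cint mu F.
Proof.
by move=> iF; under eq_cint do rewrite -mulN1r; rewrite cintZ// mulN1r.
Qed.

Lemma cintB F G : cintegrable mu F -> cintegrable mu G ->
  cint mu (fun x => F x - G x) = cint mu F - cint mu G.
Proof. by move=> iF iG; rewrite cintD ?cintN//; exact: cintegrableN. Qed.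

Lemma cintJ F : cintegrable mu F ->
  cint mu (fun x => conjc (F x)) = conjc (cint mu F).
Proof.
move=> [F1 F2]; apply: complexP; rewrite ?Re_conj ?Im_conj /=.
  by under eq_Rintegral do rewrite Re_conj.
under eq_Rintegral do rewrite Im_conj -mulN1r.
by rewrite RintegralZl// mulN1r.
Qed.

Lemma cint_sum I (r : seq I) (P : pred I) (F : I -> T -> R[i]) :
  (forall i, P i -> cintegrable mu (F i)) ->
  cint mu (fun x => \sum_(i <- r | P i) F i x) =
  \sum_(i <- r | P i) cint mu (F i).
Proof.
move=> iF; elim: r => [|i r ih].
  by under eq_cint do rewrite big_nil; rewrite big_nil cint0.
rewrite big_cons; have [Pi|/negbTE nPi] := boolP (P i); last first.
  by under eq_cint do rewrite big_cons nPi.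
under eq_cint do rewrite big_cons Pi.
by rewrite cintD ?ih//; [exact: iF|exact: cintegrable_sum].
Qed.

Lemma cint_real (f : T -> R) : cint mu (fun x => (f x)%:C) =
  (\int[mu]_x f x)%:C.
Proof. by apply: complexP => //=; rewrite Rintegral_cst// mul0r. Qed.

(** A unimodular factor makes the integral equal to its modulus; it is then the integral of a real
    part, which is at most the norm pointwise. *)
Lemma normc_cint F : cintegrable mu F -> ((normc (cint mu F))%:E <= nint F)%E.
Proof.
move=> iF; have [->|c0] := eqVneq (cint mu F) 0.
  by rewrite Normc.normc0; exact: nint_ge0.
have n0 : normc (cint mu F) != 0 by rewrite normc_eq0.
pose u := conjc (cint mu F) * (normc (cint mu F))^-1%:C.
have nu : normc u = 1.
  rewrite Normc.normcM normc_conj normc_real ger0_norm ?invr_ge0 ?normc_ge0//.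
  by rewrite mulfV.
have := cintZ u iF; rewrite [u * _](_ : _ = (normc (cint mu F))%:C); last first.
  by rewrite /u mulrAC [_^*%C * _]mulrC mulcJ -rmorphM /= expr2 mulfK.
move=> /(congr1 (@Re R)) /= <-.
rewrite /Rintegral fineK; last first.
  by apply: integrable_fin_num => //; exact: (cintegrableZ u iF).1.
apply: le_integral => //.
- exact: (cintegrableZ u iF).1.
- exact: cintegrable_norm.
- move=> x _; rewrite lee_fin; apply: le_trans (ler_norm _) _.
  by apply: le_trans (normRe_le _) _; rewrite Normc.normcM nu mul1r.
Qed.

End cint_theory.

Lemma cmeasurable_comp d d' (T : measurableType d) (U : measurableType d')
    (R : realType) (h : T -> U) (F : U -> R[i]) : measurable_fun setT h ->
  cmeasurable F -> cmeasurable (fun x => F (h x)).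
Proof.
by move=> mh [mr mi]; split; [exact: (measurableT_comp mr mh)|
  exact: (measurableT_comp mi mh)].
Qed.

(** * Fubini for complex-valued functions *)

Section fubini_complex.
Context d1 d2 (T1 : measurableType d1) (T2 : measurableType d2) (R : realType).
Variables (m1 : {sigma_finite_measure set T1 -> \bar R})
  (m2 : {sigma_finite_measure set T2 -> \bar R}).

(** The inner integrals in Fubini take extended values while [cint] integrates real ones; [fine]
    changes an integrable function only on the null set where it is infinite. *)
Lemma integrable_fine d (T : measurableType d) (mu : {measure set T -> \bar R})
    (f : T -> \bar R) : mu.-integrable setT f ->
  mu.-integrable setT (fun x => (fine (f x))%:E) /\
  \int[mu]_x fine (f x) = fine (\int[mu]_x f x)%E.
Proof.
move=> fi; have mf := measurable_int _ fi.
have mff : measurable_fun setT (fun x => (fine (f x))%:E).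
  by apply/measurable_EFinP; apply: measurableT_comp => //; exact: fine_measurable.
split.
  apply: le_integrable fi => // x _; case: (f x) => //=.
  by rewrite normr0 leey.
by rewrite normr0 leey.
rewrite /Rintegral; congr fine; apply: ae_eq_integral => //.
have := integrable_ae measurableT fi; apply: filterS => x /= /(_ I) + _.
by move/fineK.
Qed.

Implicit Type F : T1 * T2 -> R[i].

Lemma cmeasurable_sec1 F x : cmeasurable F -> cmeasurable (fun y => F (x, y)).
Proof.
by move=> [mr mi]; split; [exact: (measurable_fun_pair2 _ mr)|
  exact: (measurable_fun_pair2 _ mi)].
Qed.

Lemma measurable_nint1 F : cmeasurable F ->
  measurable_fun setT (fun x => nint m2 (fun y => F (x, y))).
Proof.
move=> mF; apply: (@measurable_fun_fubini_tonelli_F _ _ _ _ _ _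
  (fun z => (normc (F z))%:E)); first exact: measurable_enormc.
by move=> z; rewrite lee_fin normc_ge0.
Qed.

Lemma nint_prod1 F : cmeasurable F ->
  nint (m1 \x m2)%E F = (\int[m1]_x nint m2 (fun y => F (x, y)))%E.
Proof.
move=> mF; rewrite /nint (fubini_tonelli1 (fun z => (normc (F z))%:E))//.
  exact: measurable_enormc.
by move=> z; rewrite lee_fin normc_ge0.
Qed.

Lemma nint_prod2 F : cmeasurable F ->
  nint (m1 \x m2)%E F = (\int[m2]_y nint m1 (fun x => F (x, y)))%E.
Proof.
move=> mF; rewrite /nint (fubini_tonelli2 (fun z => (normc (F z))%:E))//.
  exact: measurable_enormc.
by move=> z; rewrite lee_fin normc_ge0.
Qed.

Lemma cintegrable_prod F : cmeasurable F ->
  (\int[m1]_x nint m2 (fun y => F (x, y)) < +oo)%E ->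
  cintegrable (m1 \x m2)%E F.
Proof. by move=> mF Foo; apply/cintegrableP; rewrite nint_prod1. Qed.

(** Sections may fail to be integrable, so the inner integral is written as the difference of those
    of the positive and negative parts, both measurable by Tonelli. *)
Lemma measurable_Rintegral1 (f : T1 * T2 -> R) : measurable_fun setT f ->
  measurable_fun setT (fun x => \int[m2]_y f (x, y)).
Proof.
move=> mf; apply: measurableT_comp; first exact: fine_measurable.
rewrite [X in measurable_fun _ X](_ : _ = (fun x =>
  \int[m2]_y (fun z => (f z)%:E)^\+ (x, y) -
  \int[m2]_y (fun z => (f z)%:E)^\- (x, y))%E); last first.
  by apply/funext => x; rewrite [LHS]integralE !unlock.
apply: emeasurable_funB.
  apply: (@measurable_fun_fubini_tonelli_F _ _ _ _ _ m2 ((fun z => (f z)%:E)^\+)%E).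
    by apply: measurable_funepos; exact/measurable_EFinP.
  by [].
apply: (@measurable_fun_fubini_tonelli_F _ _ _ _ _ m2 ((fun z => (f z)%:E)^\-)%E).
  by apply: measurable_funeneg; exact/measurable_EFinP.
by [].
Qed.

Lemma cmeasurable_cint1 F : cmeasurable F ->
  cmeasurable (fun x => cint m2 (fun y => F (x, y))).
Proof.
move=> [mr mi]; split; first exact: (measurable_Rintegral1 mr).
exact: (measurable_Rintegral1 mi).
Qed.

Lemma cfubini1 F : cintegrable (m1 \x m2)%E F ->
  cintegrable m1 (fun x => cint m2 (fun y => F (x, y))) /\
  cint m1 (fun x => cint m2 (fun y => F (x, y))) = cint (m1 \x m2)%E F.
Proof.
move=> [Fr Fi].
have [r1 r2] := integrable_fine (integrable_fubini_F Fr).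
have [i1 i2] := integrable_fine (integrable_fubini_F Fi).
split => //; apply: complexP => /=.
  by rewrite [LHS]r2 integral12_prod_meas1.
by rewrite [LHS]i2 integral12_prod_meas1.
Qed.

Lemma integrable_fubini_G' (f : T1 * T2 -> \bar R) :
  (m1 \x m2)%E.-integrable setT f -> m2.-integrable setT (fubini_G m1 f).
Proof.
move=> fi; have mf := measurable_int _ fi.
have mG := measurable_fubini_G fi.
apply/integrableP; split => //.
apply: le_lt_trans ((integrable21ltyP m1 m2 mf).1 fi).
apply: ge0_le_integral => //; first exact: measurableT_comp.
  apply: (@measurable_fun_fubini_tonelli_G _ _ _ _ _ m1 (abse \o f)).
    exact: measurableT_comp.
  by move=> z; exact: abse_ge0.
move=> y _; apply: le_abse_integral => //.
exact: (measurable_fun_pair1 _ mf).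
Qed.

Lemma cfubini2 F : cintegrable (m1 \x m2)%E F ->
  cintegrable m2 (fun y => cint m1 (fun x => F (x, y))) /\
  cint m2 (fun y => cint m1 (fun x => F (x, y))) = cint (m1 \x m2)%E F.
Proof.
move=> [Fr Fi].
have [r1 r2] := integrable_fine (integrable_fubini_G' Fr).
have [i1 i2] := integrable_fine (integrable_fubini_G' Fi).
split => //; apply: complexP => /=.
  by rewrite [LHS]r2 integral21_prod_meas1.
by rewrite [LHS]i2 integral21_prod_meas1.
Qed.

Lemma cfubini F : cintegrable (m1 \x m2)%E F ->
  cint m1 (fun x => cint m2 (fun y => F (x, y))) =
  cint m2 (fun y => cint m1 (fun x => F (x, y))).
Proof. by move=> iF; rewrite (cfubini1 iF).2 (cfubini2 iF).2. Qed.

End fubini_complex.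

(** * Sums over Z^n as integrals for the counting measure *)

Section counting_Zn.
Context (R : realType) (n : nat).
Local Notation Z := (Zn n).
Local Notation cnt := (@countZ R n).

Lemma measurable_fun_Zn d (T : measurableType d) (f : Z -> T) :
  measurable_fun setT f.
Proof. by []. Qed.

Lemma cmeasurable_Zn (f : Z -> R[i]) : cmeasurable f.
Proof. by split. Qed.

(** The preimage of a set is a countable union of products of a singleton with a measurable
    slice. *)
Lemma measurable_fun_ZnX d d' (T : measurableType d) (U : measurableType d')
    (f : Z * T -> U) : (forall k, measurable_fun setT (fun x => f (k, x))) ->
  measurable_fun setT f.
Proof.
move=> mf _ Y mY; rewrite setTI.
rewrite (_ : f @^-1` Y =
    \bigcup_k ([set k] `*` ((fun x => f (k, x)) @^-1` Y))); last first.
  apply/seteqP; split => [[k x] /= fY|[k x] /= [j _ /= [-> //]]].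
  by exists k.
apply: countable_bigcupT_measurable => // k.
apply: measurableX => //.
by rewrite -[X in measurable X]setTI; exact: mf.
Qed.

Lemma cmeasurable_ZnX d (T : measurableType d) (F : Z * T -> R[i]) :
  (forall k, cmeasurable (fun x => F (k, x))) -> cmeasurable F.
Proof.
move=> mF; split.
  by apply: (@measurable_fun_ZnX _ _ _ _ (fun z => Re (F z))) => k; exact: (mF k).1.
by apply: (@measurable_fun_ZnX _ _ _ _ (fun z => Im (F z))) => k; exact: (mF k).2.
Qed.

Lemma cmeasurable_XZn d (T : measurableType d) (F : T * Z -> R[i]) :
  (forall k, cmeasurable (fun x => F (x, k))) -> cmeasurable F.
Proof.
move=> mF; have mG : cmeasurable (fun z : Z * T => F (z.2, z.1)).
  by apply: cmeasurable_ZnX => k; exact: mF.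
apply: eq_cmeasurable (cmeasurable_comp (h := fun z => (z.2, z.1)) _ mG).
  by case.
apply: measurable_fun_pair; [exact: measurable_snd|exact: measurable_fst].
Qed.

Lemma integral_Zn_supp1 (f : Z -> \bar R) k0 :
  (forall k, k != k0 -> f k = 0%E) -> (\int[cnt]_k f k = f k0)%E.
Proof.
move=> f0; rewrite (_ : f = f \_ [set k0]); last first.
  apply/funext => k; rewrite patchE; case: ifPn => //.
  by rewrite notin_setE /= => /eqP kk0; rewrite f0.
rewrite -integral_mkcond (eq_integral (cst (f k0))); last first.
  by move=> k; rewrite inE /= => ->.
rewrite patchE mem_set//.
rewrite integral_cst// [X in (_ * X)%E](_ : _ = 1%E) ?mule1//.
by rewrite -[LHS]/(counting [set k0]) /counting asboolT// fset_set1 finmap.cardfs1.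
Qed.

Lemma cint_Zn_supp1 (F : Z -> R[i]) k0 :
  (forall k, k != k0 -> F k = 0) -> cint cnt F = F k0.
Proof.
move=> F0; apply: complexP; rewrite /= /Rintegral (@integral_Zn_supp1 _ k0)//=.
  by move=> k /F0 ->.
by move=> k /F0 ->.
Qed.

Lemma integral_Zn_ge (f : Z -> \bar R) k0 : (forall k, 0 <= f k)%E ->
  (f k0 <= \int[cnt]_k f k)%E.
Proof.
move=> f0; rewrite -[leLHS](_ : (\int[cnt]_k (if k == k0 then f k else 0))%E = _).
  apply: ge0_le_integral => // k _; first by case: ifP.
  by case: ifP.
rewrite (@integral_Zn_supp1 _ k0) ?eqxx// => k /negbTE -> //.
Qed.

Lemma pushforward_countZ (b : Z -> Z) : bijective b ->
  forall A, pushforward cnt b A = cnt A.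
Proof.
move=> [c bK cK] A; rewrite /pushforward.
rewrite -[LHS]/(counting (b @^-1` A)) -[RHS]/(counting A) /counting.
have bA : b @^-1` A = c @` A.
  apply/seteqP; split => [k /= Abk|k /= [j Aj <-]]; last by rewrite cK.
  by exists (b k).
have Ab : A = b @` (b @^-1` A).
  apply/seteqP; split => [k /= Ak|k /= [j Aj <-]//].
  by exists (c k); rewrite /= ?cK.
have [fA|nfA] := pselect (finite_set A).
  have fbA : finite_set (b @^-1` A) by rewrite bA; exact: finite_image.
  rewrite !asboolT//; congr (_%:R%:E).
  rewrite bA fset_set_image//; apply: finmap.card_imfset; exact: can_inj cK.
rewrite !asboolF// => fbA; apply: nfA; rewrite Ab; exact: finite_image.
Qed.

Lemma ge0_reindex_Zn (b : Z -> Z) (f : Z -> \bar R) : bijective b ->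
  (forall k, 0 <= f k)%E ->
  (\int[cnt]_k f (b k) = \int[cnt]_k f k)%E.
Proof.
move=> bb f0.
rewrite -(@ge0_integral_pushforward _ _ _ _ _ b (measurable_fun_Zn b) cnt setT f)//.
apply: (@eq_measure_integral _ _ _ setT cnt).
  exact: (measurable_fun_Zn b).
by move=> mb A _ _; exact: pushforward_countZ.
Qed.

Lemma nint_reindex (b : Z -> Z) (F : Z -> R[i]) : bijective b ->
  nint cnt (fun k => F (b k)) = nint cnt F.
Proof.
move=> bb; rewrite /nint (ge0_reindex_Zn (f := fun k => (normc (F k))%:E))//.
by move=> k; rewrite lee_fin normc_ge0.
Qed.

Lemma cintegrable_Zn F : (nint cnt F < +oo)%E -> cintegrable cnt F.
Proof. by move=> Foo; apply/cintegrableP. Qed.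

Lemma bij_sub (m : Z) : bijective (fun k : Z => k - m).
Proof. by exists (fun k => k + m) => k; rewrite ?subrK ?addrK. Qed.

Lemma bij_rsub (m : Z) : bijective (fun k : Z => m - k).
Proof. by exists (fun k => m - k) => k; rewrite opprB addrC subrK. Qed.

Lemma weight_ge1 (k : Z) : 1 <= weight R k.
Proof. by rewrite lerDl ler0z sumr_ge0. Qed.

Lemma weight_gt0 (k : Z) : 0 < weight R k.
Proof. exact: lt_le_trans ltr01 (weight_ge1 k). Qed.

Lemma weight_coord (k : Z) i : (`|k ord0 i|)%:~R <= weight R k.
Proof.
rewrite /weight (bigD1 i)//= intrD addrCA lerDl addr_ge0//.
by rewrite ler0z sumr_ge0.
Qed.

(** A bound on the weight bounds every coordinate, so the ball lies in the image of a finite cube.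
    The enumeration later gives finite sums over balls ([box]). *)
Lemma weight_enum (M : nat) : exists s : seq Z, uniq s /\
  forall k, (k \in s) = (weight R k <= M%:R).
Proof.
have fin : finite_set [set k : Z | weight R k <= M%:R].
  (* The shift by [M] sends the indices 0, ..., 2 M to the coordinates -M, ..., M. *)
  pose h (a : {ffun 'I_n -> 'I_(M + M).+1}) : Z := \row_i ((a i)%:Z - M%:Z).
  apply: (@sub_finite_set _ _ (h @` setT)); last first.
    by apply: finite_image; exact: finite_finset.
  move=> k /= wk; exists [ffun i => inord (absz (k ord0 i + M%:Z))] => //.
  apply/rowP => i; rewrite mxE ffunE.
  have := le_trans (weight_coord k i) wk.
  rewrite -[M%:R]/(M%:Z%:~R) ler_int ler_norml => /andP[h1 h2].
  rewrite inordK; first by rewrite gez0_abs ?addrK// -lerBlDr sub0r.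
  rewrite ltnS -lez_nat gez0_abs; last by rewrite -lerBlDr sub0r.
  by rewrite PoszD lerD2r.
have [s sE] := (finite_seqP _).1 fin.
exists (undup s); split; first exact: undup_uniq.
move=> k; rewrite mem_undup; apply/idP/idP => [ks|wk].
  by have : [set` s] k by []; rewrite -sE.
by have : [set k | weight R k <= M%:R] k by []; rewrite sE.
Qed.

(** Dominated convergence: each [k] eventually lies in the ball of radius [M]. Infinite sums are cut
    this way in [wser_approx] and [dominated_subseq]. *)
Lemma integral_tail (f : Z -> R) : (forall k, 0 <= f k) ->
  (\int[cnt]_k (f k)%:E < +oo)%E -> forall e, 0 < e -> exists M : nat,
  (\int[cnt]_k (if weight R k <= M%:R then 0 else f k)%:E < e%:E)%E.
Proof.
move=> f0 foo e e0.
have fi : cnt.-integrable setT (fun k => (f k)%:E).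
  apply/integrableP; split => //.
  by under eq_integral do rewrite gee0_abs ?lee_fin//.
have : (\int[cnt]_k (if weight R k <= m%:R then 0 else f k)%:E)%E
    @[m --> \oo] --> (\int[cnt]_k (cst 0 k))%E.
  apply: (@dominated_cvg _ _ _ cnt setT measurableT
    (fun m k => (if weight R k <= m%:R then 0 else f k)%:E) (cst 0%E)
    (fun k => (f k)%:E)) => //.
  - move=> k _; apply: cvg_near_cst.
    have [M _ hM] := nbhs_infty_ger (weight R k).
    by exists M => // m /hM /= ->.
  - by move=> m k _; rewrite gee0_abs ?lee_fin; case: ifP.
rewrite integral_cst// mul0e => /fine_cvgP[/= [N1 _ h1]].
move/cvgrPdist_lt => /(_ e e0) [N2 _ h2].
exists (maxn N1 N2); have := h1 (maxn N1 N2) (leq_maxl _ _).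
move=> /= fn; have := h2 (maxn N1 N2) (leq_maxr _ _).
rewrite /= sub0r normrN => h; rewrite -(fineK fn) lte_fin.
exact: le_lt_trans (ler_norm _) h.
Qed.

End counting_Zn.

(** * Derivatives of complex-valued functions *)

Section cexp.
Context (R : realType).

Definition cexp (t : R) : R[i] := cos t +i* sin t.

Lemma cexpD s t : cexp (s + t) = cexp s * cexp t.
Proof.
rewrite /cexp cosD sinD; apply/eqP; rewrite eq_complex /= eqxx /=.
by rewrite addrC.
Qed.

Lemma cexp0 : cexp 0 = 1.
Proof. by rewrite /cexp cos0 sin0. Qed.

Lemma conj_cexp t : conjc (cexp t) = cexp (- t).
Proof. by rewrite /cexp /= cosN sinN. Qed.

Lemma normc_cexp t : normc (cexp t) = 1.
Proof. by rewrite /= cos2Dsin2 sqrtr1. Qed.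

Lemma normc_cexpB1 t : normc (cexp (2 * t) - 1) = 2 * `|sin t|.
Proof.
apply/eqP; rewrite -(@eqrXn2 _ 2)// ?normc_ge0// ?mulr_ge0//; apply/eqP.
have := mulcJ (cexp (2 * t) - 1).
rewrite (_ : 2 * t = t + t); last by ring.
rewrite /cexp cosD sinD.
move=> /(congr1 (@Re R)) /= <-.
rewrite exprMn real_normK ?num_real//.
have hc : cos t ^+ 2 = 1 - sin t ^+ 2 by rewrite -(cos2Dsin2 t) addrK.
transitivity ((cos t ^+ 2 - sin t ^+ 2 - 1) ^+ 2 +
  4 * (sin t ^+ 2 * cos t ^+ 2)); first by ring.
by rewrite hc; ring.
Qed.

(** The addition formula with |cos| <= 1. It makes the chordal distance |sin (pi t)| compatible with
    integer frequencies, whence [lip_echar]; at t = pi it gives the zeros of the sine. *)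
Lemma sin_natmul (m : nat) (t : R) : `|sin (m%:R * t)| <= m%:R * `|sin t|.
Proof.
elim: m => [|m ih]; first by rewrite !mul0r sin0 normr0.
rewrite -natr1 mulrDl mul1r sinD mulrDl mul1r.
apply: le_trans (ler_normD _ _) _; rewrite !normrM lerD//.
  apply: le_trans ih; rewrite ler_piMr// ler_norml; apply/andP; split.
    exact: cos_geN1.
  exact: cos_le1.
rewrite ler_piMl// ler_norml; apply/andP; split.
  exact: cos_geN1.
exact: cos_le1.
Qed.

Lemma sin_intmul (m : int) (t : R) : `|sin (m%:~R * t)| <= `|m|%:~R * `|sin t|.
Proof.
case: m => m; first by rewrite -pmulrn; exact: sin_natmul.
rewrite NegzE mulrNz mulNr sinN normrN normrN; exact: sin_natmul.
Qed.

Lemma sinMpi_int (z : int) : sin (z%:~R * pi) = 0 :> R.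
Proof.
by apply/eqP; rewrite -normr_le0 (le_trans (sin_intmul _ _))// sinpi normr0 mulr0.
Qed.

Lemma cexp_int (z : int) : cexp (2 * pi * z%:~R) = 1.
Proof.
apply/eqP; rewrite -subr_eq0 -normc_eq0 -mulrA normc_cexpB1 mulrC.
by rewrite mulrC [pi * _]mulrC sinMpi_int normr0 mulr0.
Qed.

(** On [0, t] the mean value theorem fails to help near pi / 2, where the cosine vanishes. It is
    applied on [0, u] with u = t / 2 <= pi / 4, and then sin t = 2 sin u cos u >= 2 u cos (pi / 4) ^
    2 = u. *)
Lemma le_sin_half (t : R) : 0 <= t -> t <= pi / 2 -> t / 2 <= sin t.
Proof.
move=> t0 tpi; set u := t / 2.
have u0 : 0 <= u by rewrite divr_ge0.
have pi0 : 0 < pi :> R := pi_gt0 R.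
have cosu v : 0 <= v -> v <= u -> cos (pi / 4) <= cos v.
  move=> v0 vu; have vpi : v <= pi / 4.
    by apply: le_trans vu _; rewrite /u; lra.
  rewrite leNgt ltr_cos ?in_itv/= -?leNgt//; apply/andP; split; lra.
have c4 : cos (pi / 4) ^+ 2 = 1 / 2 :> R.
  have := cosD (pi / 4) (pi / 4) : cos _ = _ :> R.
  rewrite (_ : pi / 4 + pi / 4 = pi / 2 :> R); last by lra.
  rewrite cos_pihalf -!expr2 => /esym/eqP; rewrite subr_eq0 => /eqP h.
  by have := cos2Dsin2 (pi / 4 : R); rewrite -h; lra.
have c40 : 0 <= cos (pi / 4) :> R.
  by apply: cos_ge0_pihalf; apply/andP; split; lra.
have su : u * cos (pi / 4) <= sin u.
  have [->|un0] := eqVneq u 0; first by rewrite mul0r sin0.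
  have up : 0 < u by rewrite lt_neqAle eq_sym un0.
  have [v] := @MVT _ sin cos 0 u up (fun x _ => is_derive_sin x)
    (continuous_subspaceT (@continuous_sin R)).
  rewrite in_itv /= => /andP[v0 vu]; rewrite sin0 !subr0 => ->.
  by rewrite mulrC ler_wpM2r// cosu// ltW.
have -> : t = u + u by rewrite /u; lra.
rewrite sinD.
have := cosu u u0 (lexx _) => cu.
have h1 : u * cos (pi / 4) * cos (pi / 4) <= sin u * cos u.
  by apply: ler_pM => //; rewrite mulr_ge0.
rewrite -mulrA -expr2 c4 in h1; rewrite [cos u * _]mulrC; lra.
Qed.

Lemma le_sin_pi (t : R) : `|t| <= 1 / 2 -> `|t| <= `|sin (pi * t)|.
Proof.
move=> t1; have pi0 : 0 < pi :> R := pi_gt0 R.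
have -> : `|sin (pi * t)| = `|sin (pi * `|t|)|.
  have [t0|t0] := leP 0 t; first by rewrite (ger0_norm t0).
  by rewrite (ltr0_norm t0) mulrN sinN normrN.
have h : pi * `|t| / 2 <= sin (pi * `|t|).
  apply: le_sin_half; first by rewrite mulr_ge0// ltW.
  by have := ler_wpM2l (ltW pi0) t1; lra.
apply: le_trans (ler_norm _); apply: le_trans h.
by have := ler_wpM2r (normr_ge0 t) (pi_ge2 R); lra.
Qed.

Lemma continuous_cosM (c : R) : continuous (fun x : R => cos (c * x)).
Proof.
move=> x; apply: (@continuous_comp _ _ _ (fun x => c * x) cos).
  by apply: mulrl_continuous.
exact: continuous_cos.
Qed.

Lemma continuous_sinM (c : R) : continuous (fun x : R => sin (c * x)).
Proof.
move=> x; apply: (@continuous_comp _ _ _ (fun x => c * x) sin).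
  by apply: mulrl_continuous.
exact: continuous_sin.
Qed.

Definition cderive (f : R -> R[i]) (t : R) (df : R[i]) : Prop :=
  is_derive t 1 (fun s => Re (f s)) (Re df) /\
  is_derive t 1 (fun s => Im (f s)) (Im df).

Lemma is_derive_ext (f g : R -> R) (t d e : R) : f =1 g -> d = e ->
  is_derive t 1 f d -> is_derive t 1 g e.
Proof. by move=> /funext -> ->. Qed.

Lemma cderive_ext f g t df dg : f =1 g -> df = dg ->
  cderive f t df -> cderive g t dg.
Proof. by move=> /funext -> ->. Qed.

Lemma cderiveD f g t df dg : cderive f t df -> cderive g t dg ->
  cderive (fun s => f s + g s) t (df + dg).
Proof.
move=> [f1 f2] [g1 g2]; split.
  by apply: is_derive_ext (is_deriveD f1 g1) => [s|]; rewrite ReD.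
by apply: is_derive_ext (is_deriveD f2 g2) => [s|]; rewrite ImD.
Qed.

Lemma cderiveM f g t df dg : cderive f t df -> cderive g t dg ->
  cderive (fun s => f s * g s) t (df * g t + f t * dg).
Proof.
move=> [f1 f2] [g1 g2]; split.
  apply: is_derive_ext (is_deriveB (is_deriveM f1 g1) (is_deriveM f2 g2)) => [s|].
    by rewrite ReM.
  by rewrite /GRing.scale/= ReD !ReM; ring.
apply: is_derive_ext (is_deriveD (is_deriveM f1 g2) (is_deriveM f2 g1)) => [s|].
  by rewrite ImM.
by rewrite /GRing.scale/= ImD !ImM; ring.
Qed.

Lemma cderive_cst c t : cderive (fun _ => c) t 0.
Proof. by split; exact: is_derive_cst. Qed.

Lemma cderiveZ c f t df : cderive f t df ->
  cderive (fun s => c * f s) t (c * df).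
Proof.
move=> fd; apply: cderive_ext (cderiveM (cderive_cst c t) fd) => //.
by rewrite mul0r add0r.
Qed.

Lemma cderiveJ f t df : cderive f t df ->
  cderive (fun s => conjc (f s)) t (conjc df).
Proof.
move=> [f1 f2]; split.
  by apply: is_derive_ext f1 => [s|]; rewrite Re_conj.
by apply: is_derive_ext (is_deriveN f2) => [s|]; rewrite Im_conj.
Qed.

Lemma cderive_affine f a t df : cderive f (a + t) df ->
  cderive (fun s => f (a + s)) t df.
Proof.
have h : is_derive t 1 (fun s : R => a + s) 1.
  apply: is_derive_ext (is_deriveD (is_derive_cst a t 1) (is_derive_id t 1)) => //.
  by rewrite add0r.
move=> [f1 f2]; split.
  by apply: is_derive_ext (is_derive1_comp f1 h) => //; rewrite mulr1.
by apply: is_derive_ext (is_derive1_comp f2 h) => //; rewrite mulr1.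
Qed.

Lemma cderive_cexp a t : cderive (fun s => cexp (a * s)) t (a *i * cexp (a * t)).
Proof.
have h : is_derive t 1 (fun s : R => a * s) a.
  apply: is_derive_ext (is_deriveZ a (is_derive_id t 1)) => //.
  by rewrite /GRing.scale/= mulr1.
split.
  apply: is_derive_ext (is_derive1_comp (is_derive_cos (a * t)) h) => //.
  by rewrite /=; ring.
apply: is_derive_ext (is_derive1_comp (is_derive_sin (a * t)) h) => //.
by rewrite /=; ring.
Qed.

Lemma MVT_le (f df : R -> R) (B : R) : (forall t : R, is_derive t 1 f (df t)) ->
  forall t, (forall s, `|s| <= `|t| -> `|df s| <= B) ->
  `|f t - f 0| <= B * `|t|.
Proof.
move=> fd t dB.
have cf : continuous f.
  move=> s; apply: differentiable_continuous; apply/derivable1_diffP.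
  by have [] := fd s.
have [->|t0] := eqVneq t 0; first by rewrite subrr normr0 mulr0.
have [tp|tn] := ltP 0 t.
  have [c] := @MVT _ f df 0 t tp (fun s _ => fd s) (continuous_subspaceT cf).
  rewrite in_itv/= => /andP[c0 ct] ->; rewrite subr0 normrM ler_wpM2r//.
  by apply: dB; rewrite !ger0_norm ?ltW.
have {}tn : t < 0 by rewrite lt_neqAle t0.
have [c] := @MVT _ f df t 0 tn (fun s _ => fd s) (continuous_subspaceT cf).
rewrite in_itv/= => /andP[c0 ct]; rewrite distrC => ->.
rewrite sub0r normrM normrN ler_wpM2r//.
by apply: dB; rewrite !ltr0_norm// lerN2 ltW.
Qed.

(** The mean value theorem is applied to the real and the imaginary part separately, which costs the
    factor 2. *)
Lemma cMVT_le (f df : R -> R[i]) (B : R) : (forall t, cderive f t (df t)) ->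
  forall t, (forall s, `|s| <= `|t| -> normc (df s) <= B) ->
  normc (f t - f 0) <= 2 * B * `|t|.
Proof.
move=> fd t dB; apply: le_trans (normc_le _) _.
rewrite ReD ReN ImD ImN mulrAC mulr_natl mulr2n mulrC mulrDr lerD//.
  apply: (@MVT_le (fun s => Re (f s)) (fun s => Re (df s))) => s.
    exact: (fd s).1.
  by move=> /dB; apply: le_trans; exact: normRe_le.
apply: (@MVT_le (fun s => Im (f s)) (fun s => Im (df s))) => s.
  exact: (fd s).2.
by move=> /dB; apply: le_trans; exact: normIm_le.
Qed.

(** [cMVT_le] for s |-> f s - s f'(0), whose derivative f'(s) - f'(0) is bounded by a second use of
    [cMVT_le]: hence 4 = 2 * 2. *)
Lemma cTaylor_le (f df ddf : R -> R[i]) (B : R) :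
  (forall t, cderive f t (df t)) -> (forall t, cderive df t (ddf t)) ->
  (forall t, normc (ddf t) <= B) -> forall t,
  normc (f t - f 0 - t%:C * df 0) <= 4 * B * `|t| ^+ 2.
Proof.
move=> fd dfd dB t.
have gd s : cderive (fun s => f s - s%:C * df 0) s (df s - df 0).
  have h : cderive (fun s => s%:C) s 1.
    by split; [exact: is_derive_id|exact: is_derive_cst].
  apply: cderive_ext (cderiveD (fd s) (cderiveZ (- df 0) h)) => [u|].
    by rewrite mulNr mulrC.
  by rewrite mulr1.
have := cMVT_le gd (t := t) (B := 2 * B * `|t|).
rewrite [f 0 - _](_ : _ = f 0); last by rewrite mul0r subr0.
rewrite addrAC expr2 !mulrA (_ : 2 * 2 = 4 :> R); last by ring.
apply => s st; apply: le_trans (cMVT_le dfd (fun u _ => dB u)) _.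
rewrite ler_wpM2l// mulr_ge0//; apply: le_trans (dB 0); exact: normc_ge0.
Qed.

End cexp.

(** * Functions on the torus *)

Section haar_characters.
Context (R : realType).

Lemma derive1_LR (f F : R -> R) a b : a < b -> continuous f ->
  (forall x : R, is_derive x 1 F (f x)) ->
  (\int[lebesgue_measure]_(x in `[a, b]) (f x)%:E = (F b)%:E - (F a)%:E)%E.
Proof.
move=> ab cf dF.
have cF : continuous F.
  move=> s; apply: differentiable_continuous; apply/derivable1_diffP.
  by have [] := dF s.
apply: continuous_FTC2 => //.
- exact: continuous_subspaceT.
- split; first by move=> x _; have [] := dF x.
    exact: (cvg_at_right_filter (cF a)).
  exact: (cvg_at_left_filter (cF b)).
- by move=> x _; rewrite derive1E; exact: derive_val.
Qed.

Local Notation U := (uniform_prob (@ltr01 R)).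

Lemma integral_uniform_ge0 (f F : R -> R) : continuous f ->
  (forall x, 0 <= f x) -> (forall x : R, is_derive x 1 F (f x)) ->
  \int[U]_x f x = F 1 - F 0.
Proof.
move=> cf f0 dF; rewrite /Rintegral integral_uniform; last 2 first.
- by apply/measurable_EFinP; exact: continuous_measurable_fun.
- by move=> x; rewrite lee_fin.
by rewrite subr0 invr1 mul1e (derive1_LR _ cf dF).
Qed.

Lemma integrable_bounded_prob d (T : measurableType d)
    (P : probability T R) (f : T -> R) (B : R) : measurable_fun setT f ->
  (forall x, `|f x| <= B) -> P.-integrable setT (fun x => (f x)%:E).
Proof.
move=> mf fB; apply: measurable_bounded_integrable => //.
  by rewrite (le_lt_trans (probability_le1 _ _))// ltry.
exists B; split; [exact: num_real|move=> M BM x _].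
exact: le_trans (fB x) (ltW BM).
Qed.

Lemma cintegrable_bounded d (T : measurableType d)
    (P : probability T R) (F : T -> R[i]) (B : R) : cmeasurable F ->
  (forall x, normc (F x) <= B) -> cintegrable P F.
Proof.
move=> [mr mi] FB; split.
  refine (@integrable_bounded_prob d T P (fun x => Re (F x)) B mr _) => x.
  exact: le_trans (normRe_le _) (FB x).
refine (@integrable_bounded_prob d T P (fun x => Im (F x)) B mi _) => x.
exact: le_trans (normIm_le _) (FB x).
Qed.

Arguments cintegrable_bounded {d T} P {F B}.

Lemma measure_prob_setT d (T : measurableType d) (P : probability T R) :
  (P : {measure set T -> \bar R}) setT = 1%E.
Proof. exact: probability_setT. Qed.

Lemma nint_bounded d (T : measurableType d)
    (P : probability T R) (F : T -> R[i]) (B : R) : cmeasurable F ->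
  (forall x, normc (F x) <= B) -> (nint P F <= B%:E)%E.
Proof.
move=> mF FB; apply: (@le_trans _ _ (\int[P]_x (cst B%:E x))%E).
  by apply: le_nint => // x; rewrite lee_fin.
by rewrite integral_cst// measure_prob_setT mule1.
Qed.

Lemma normc_cint_bounded d (T : measurableType d)
    (P : probability T R) (F : T -> R[i]) (B : R) : cmeasurable F ->
  (forall x, normc (F x) <= B) -> normc (cint P F) <= B.
Proof.
move=> mF FB; rewrite -lee_fin.
apply: le_trans (normc_cint (cintegrable_bounded P mF FB)) _.
exact: nint_bounded.
Qed.

Lemma cint_cst_prob d (T : measurableType d) (P : probability T R) (c : R[i]) :
  cint P (fun _ => c) = c.
Proof.
by apply: complexP; rewrite /cint /= Rintegral_cst// measure_prob_setT mulr1.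
Qed.

Lemma cmeasurable_cexp d (T : measurableType d) (h : T -> R) :
  measurable_fun setT h -> cmeasurable (fun x => cexp (h x)).
Proof.
move=> mh; split; (apply: measurableT_comp => //;
  apply: continuous_measurable_fun); [exact: continuous_cos|exact: continuous_sin].
Qed.

Lemma cint_uniform_cexp (z : int) :
  cint U (fun x => cexp (2 * pi * (x * z%:~R))) = (z == 0)%:R.
Proof.
have [->|z0] := eqVneq z 0.
  under eq_cint do rewrite mulr0 mulr0 cexp0.
  by rewrite cint_cst_prob.
pose c : R := 2 * pi * z%:~R.
have c0 : c != 0.
  by rewrite !mulf_neq0// ?intr_eq0// gt_eqF// pi_gt0.
have cE x : 2 * pi * (x * z%:~R) = c * x by rewrite /c; ring.
under eq_cint do rewrite cE.
have ec : cexp c = 1 :> R[i] by exact: cexp_int.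
have cc1 : cos c = 1 by have /(congr1 (@Re R)) := ec.
have sc0 : sin c = 0 by have /(congr1 (@Im R)) := ec.
have dlin x : is_derive (x : R) 1 ( *%R c) c.
  apply: is_derive_ext (is_deriveZ c (is_derive_id x 1)) => //.
  by rewrite /GRing.scale/= mulr1.
have mc : measurable_fun [set: R] (fun x : R => cos (c * x)).
  by apply: continuous_measurable_fun; exact: continuous_cosM.
have ms : measurable_fun [set: R] (fun x : R => sin (c * x)).
  by apply: continuous_measurable_fun; exact: continuous_sinM.
have ic : U.-integrable setT (EFin \o (fun x : R => cos (c * x))).
  refine (@integrable_bounded_prob _ _ U _ 1 mc _) => x.
  by rewrite ler_norml cos_geN1 cos_le1.
have isn : U.-integrable setT (EFin \o (fun x : R => sin (c * x))).
  refine (@integrable_bounded_prob _ _ U _ 1 ms _) => x.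
  by rewrite ler_norml sin_geN1 sin_le1.
have i1 : U.-integrable setT (EFin \o (fun x : R => 1%R)).
  refine (@integrable_bounded_prob _ _ U (fun=> 1) 1 _ _) => // x.
  by rewrite normr1.
apply: complexP; rewrite /cexp /=.
  (* [integral_uniform_ge0] is for nonnegative integrands, so 1 is added and its integral removed
     again. The periodic part of the primitive takes equal values at 0 and 1 because [c] is 2 pi
     times an integer. *)
  have := @integral_uniform_ge0 (fun x => 1 + cos (c * x))
    (fun x => x + c^-1 * sin (c * x)).
  rewrite mulr1 mulr0 sin0 sc0 mulr0 !addr0 subr0.
  rewrite RintegralD// Rintegral_cst// measure_prob_setT mulr1 => h.
  apply: (addrI 1); rewrite addr0; apply: h => x.
  - apply: cvgD; first exact: cvg_cst.
    exact: continuous_cosM.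
  - by rewrite -lerBlDl sub0r cos_geN1.
  - apply: is_derive_ext (is_deriveD (is_derive_id x 1)
      (is_deriveZ c^-1 (is_derive1_comp (is_derive_sin (c * x)) (dlin x)))) => //.
    by rewrite /GRing.scale/=; congr (_ + _); rewrite mulrCA mulVf// mulr1.
have := @integral_uniform_ge0 (fun x => 1 + sin (c * x))
  (fun x => x - c^-1 * cos (c * x)).
rewrite mulr1 mulr0 cos0 cc1 mulr1 sub0r opprK subrK.
rewrite RintegralD// Rintegral_cst// measure_prob_setT mulr1 => h.
apply: (addrI 1); rewrite addr0; apply: h => x.
- apply: cvgD; first exact: cvg_cst.
  exact: continuous_sinM.
- by rewrite -lerBlDl sub0r sin_geN1.
- apply: is_derive_ext (is_deriveB (is_derive_id x 1)
    (is_deriveZ c^-1 (is_derive1_comp (is_derive_cos (c * x)) (dlin x)))) => //.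
  by rewrite /GRing.scale/= mulNr mulrN opprK; congr (_ + _); rewrite mulrCA mulVf// mulr1.
Qed.

Lemma echarE n (w : Tn R n) k : echar w k = cexp (2 * pi * dot w k).
Proof. by []. Qed.

Lemma dotD n (w : Tn R n) k l : dot w (k + l) = dot w k + dot w l.
Proof.
by rewrite /dot -big_split; apply: eq_bigr => i _; rewrite mxE intrD mulrDr.
Qed.

Lemma dotN n (w : Tn R n) k : dot w (- k) = - dot w k.
Proof.
by rewrite /dot -sumrN; apply: eq_bigr => i _; rewrite mxE intrN mulrN.
Qed.

Lemma echarD n (w : Tn R n) k l : echar w (k + l) = echar w k * echar w l.
Proof. by rewrite !echarE dotD mulrDr cexpD. Qed.

Lemma conj_echar n (w : Tn R n) k : conjc (echar w k) = echar w (- k).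
Proof. by rewrite !echarE conj_cexp dotN mulrN. Qed.

Lemma echarB n (w : Tn R n) k l : echar w (k - l) = echar w k * conjc (echar w l).
Proof. by rewrite echarD conj_echar. Qed.

Lemma echar0 n (w : Tn R n) : echar w 0 = 1.
Proof.
rewrite echarE /dot big1 ?mulr0 ?cexp0// => i _; first by rewrite mxE mulr0.
Qed.

Lemma normc_echar n (w : Tn R n) k : normc (echar w k) = 1.
Proof. exact: normc_cexp. Qed.

Definition addT n (x y : Tn R n) : Tn R n := [tuple tnth x i + tnth y i | i < n].

Lemma echar_addT n (x y : Tn R n) k : echar (addT x y) k = echar x k * echar y k.
Proof.
rewrite !echarE -cexpD -mulrDr; congr (cexp (_ * _)).
by rewrite /dot -big_split; apply: eq_bigr => i _; rewrite tnth_mktuple mulrDl.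
Qed.

Lemma echar_subT n (x y : Tn R n) k :
  echar (subT x y) k = echar x k * conjc (echar y k).
Proof.
rewrite conj_echar !echarE -cexpD -mulrDr; congr (cexp (_ * _)).
rewrite dotN /dot -sumrN -big_split; apply: eq_bigr => i _.
by rewrite tnth_mktuple mulrBl.
Qed.

Lemma echar_shift n (x : Tn R n) i t k : echar (Defs.shift x i t) k =
  cexp (2 * pi * (k ord0 i)%:~R * t) * echar x k.
Proof.
rewrite !echarE -cexpD; congr cexp.
rewrite /dot (bigD1 i)//= [in RHS](bigD1 i)//= tnth_mktuple eqxx.
rewrite (eq_bigr (fun j => tnth x j * (k ord0 j)%:~R)); first by ring.
by move=> j /negbTE ji; rewrite tnth_mktuple ji addr0.
Qed.

Lemma cmeasurable_echar n k : cmeasurable (fun w : Tn R n => echar w k).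
Proof.
apply: cmeasurable_cexp; apply: measurable_funM => //.
apply: measurable_sum => i; apply: measurable_funM => //.
exact: measurable_tnth.
Qed.

Lemma echar_cons n (x : R) (w : Tn R n) (k : Zn n.+1) :
  echar (cons_Tn (x, w)) k =
  cexp (2 * pi * (x * (k ord0 ord0)%:~R)) *
  echar w (\row_i k ord0 (lift ord0 i)).
Proof.
rewrite !echarE -cexpD -mulrDr /dot; congr (cexp (_ * _)).
rewrite big_ord_recl; congr (_ * _ + _).
apply: eq_bigr => i _; rewrite mxE; congr (_ * _).
by rewrite /cons_Tn /= tnthS.
Qed.

Lemma cint_distribution d d' (T : measurableType d) (U : measurableType d')
    (P : probability T R) (X : {mfun T >-> U}) (F : U -> R[i]) :
  cmeasurable F -> cintegrable P (F \o X) ->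
  cint (distribution P X) F = cint P (F \o X).
Proof.
move=> [mr mi] [ir ii]; apply: complexP; rewrite /= /Rintegral.
  by rewrite integral_distribution//; exact/measurable_EFinP.
by rewrite integral_distribution//; exact/measurable_EFinP.
Qed.

(** Induction on the dimension: the measure is a product and the character factors, so Fubini splits
    off the integral in the first coordinate. *)
Lemma haar_echar n (k : Zn n) : cint (haar R n) (fun w => echar w k) = (k == 0)%:R.
Proof.
elim: n k => [|n ih] k.
  rewrite (_ : k = 0) ?eqxx; last by apply/rowP => -[].
  by under eq_cint do rewrite echar0; rewrite cint_cst_prob.
pose k' : Zn n := \row_i k ord0 (lift ord0 i).
have mF : cmeasurable (fun w : Tn R n.+1 => echar w k) by exact: cmeasurable_echar.
have mG : cmeasurable ((fun w : Tn R n.+1 => echar w k) \o @cons_Tn R n).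
  by apply: cmeasurable_comp mF; exact: measurable_cons_Tn.
have iG : cintegrable (U \x haar R n)%E
    ((fun w : Tn R n.+1 => echar w k) \o @cons_Tn R n).
  by apply: (cintegrable_bounded (U \x haar R n)%E (B := 1) mG) => x;
    rewrite [leLHS](normc_echar (cons_Tn x) k).
rewrite [LHS]cint_distribution// -(cfubini1 iG).2.
rewrite (eq_cint _ (G := fun x : measurableTypeR R =>
    cexp (2 * pi * ((x : R) * (k ord0 ord0)%:~R)) * (k' == 0)%:R)); last first.
  move=> x; rewrite /= -ih -cintZ; last first.
    apply: (cintegrable_bounded (haar R n) (B := 1)).
      exact: cmeasurable_echar.
    by move=> w; rewrite normc_echar.
  by apply: eq_cint => w; rewrite echar_cons.
rewrite cintZr; last first.
  apply: (cintegrable_bounded U (B := 1)); last by move=> x; rewrite normc_cexp.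
  apply: cmeasurable_cexp; apply: measurable_funM => //; exact: measurable_funM.
rewrite cint_uniform_cexp -natrM mulnb; congr ((nat_of_bool _)%:R).
apply/andP/eqP => [[/eqP k0 /eqP kk]|k0]; last first.
  split; first by rewrite k0 mxE.
  by apply/eqP/rowP => i; rewrite /k' k0 !mxE.
apply/rowP => i; rewrite mxE; case: (unliftP ord0 i) => [j ->|->//].
by move/rowP/(_ j): kk; rewrite !mxE.
Qed.

End haar_characters.

(** * Functions that are Lipschitz for the chordal distance *)

Section lip.
Context (R : realType) (n : nat).
Local Notation T := (Tn R n).
Local Notation C := R[i].
Implicit Types (f g q : T -> C) (x y w : T).

Lemma le_norm_sin (t : R) : `|sin t| <= `|t|.
Proof.
have := @MVT_le R sin cos 1 (fun s => is_derive_sin s) t.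
rewrite sin0 subr0 mul1r; apply => s _.
by rewrite ler_norml cos_geN1 cos_le1.
Qed.

Lemma shift0 x i : Defs.shift x i 0 = x.
Proof.
by apply: eq_from_tnth => j; rewrite tnth_mktuple; case: ifP; rewrite addr0.
Qed.

Lemma shiftD x i s t : Defs.shift (Defs.shift x i s) i t = Defs.shift x i (s + t).
Proof.
apply: eq_from_tnth => j; rewrite !tnth_mktuple.
by case: ifP => _; rewrite -addrA ?addr0.
Qed.

Lemma addT_shift x y i t : addT x (Defs.shift y i t) = Defs.shift (addT x y) i t.
Proof. by apply: eq_from_tnth => j; rewrite !tnth_mktuple addrA. Qed.

Lemma subT_addT x y : subT (addT x y) y = x.
Proof. by apply: eq_from_tnth => j; rewrite !tnth_mktuple addrK. Qed.

(* Lipschitz continuity for the chordal distance on each coordinate circle;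
   as [sin pi = 0], this forces periodicity. *)
Definition lip (B : R) f := forall x i t,
  normc (f (Defs.shift x i t) - f x) <= B * `|sin (pi * t)|.

Lemma lip_periodic B f : lip B f -> Defs.periodic f.
Proof.
move=> fB x i; apply/eqP; rewrite -subr_eq0 -normc_eq0 eq_le normc_ge0 andbT.
by apply: le_trans (fB x i 1) _; rewrite mulr1 sinpi normr0 mulr0.
Qed.

(** The coordinates of [x] are replaced by those of [y] one at a time, and the increments
    telescope. *)
Lemma lip_dist B f : lip B f -> forall x y,
  normc (f y - f x) <= B * \sum_(i < n) `|sin (pi * (tnth y i - tnth x i))|.
Proof.
move=> fB x y; pose z (m : nat) : T := [tuple if (j < m)%N then tnth y j else tnth x j | j < n].
have zn : z n = y.
  by apply: eq_from_tnth => j; rewrite tnth_mktuple ltn_ord.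
have z0 : z 0%N = x.
  by apply: eq_from_tnth => j; rewrite tnth_mktuple ltn0.
have zS (i : 'I_n) : z i.+1 = Defs.shift (z i) i (tnth y i - tnth x i).
  apply: eq_from_tnth => j; rewrite !tnth_mktuple ltnS leq_eqVlt.
  have [/eqP ij|ij] := eqVneq (val j) (val i).
    move: ij => /eqP/val_inj ->; rewrite eqxx /= ltnn addrC subrK//.
  by rewrite /= (_ : (j == i) = false) ?addr0//; apply/negbTE.
rewrite -[f y]/(f y) -[in f y]zn -[in X in _ - X]z0 mulr_sumr.
rewrite -(telescope_sumr (fun i => f (z i)) (leq0n n)) big_mkord.
apply: le_trans (normc_sum _ _ _) _; apply: ler_sum => i _.
by rewrite zS fB.
Qed.

Lemma lip_ge0 B f : lip B f -> 0 <= B \/ f = (fun=> f [tuple 0 | i < n]).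
Proof.
move=> fB; have [B0|B0] := leP 0 B; first by left.
right; apply/funext => x; apply/eqP; rewrite -subr_eq0 -normc_eq0.
rewrite eq_le normc_ge0 andbT; apply: le_trans (lip_dist fB _ _) _.
by rewrite nmulr_rle0// sumr_ge0.
Qed.

Lemma lip_bounded B f : lip B f -> exists M, forall x, normc (f x) <= M.
Proof.
move=> fB; pose o : T := [tuple 0 | i < n].
exists (normc (f o) + `|B| * n%:R) => x.
rewrite -[f x](subrK (f o)) addrC; apply: le_trans (normcD_le _ _) _.
rewrite lerD2l; apply: le_trans (lip_dist fB _ _) _.
apply: (@le_trans _ _ (`|B| * \sum_(i < n) `|sin (pi * (tnth x i - tnth o i))|)).
  by rewrite ler_wpM2r ?ler_norm// sumr_ge0.
rewrite ler_wpM2l//; apply: (@le_trans _ _ (\sum_(i < n) 1)).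
  by apply: ler_sum => i _; rewrite ler_norml sin_geN1 sin_le1.
by rewrite sumr_const card_ord.
Qed.

Lemma lipM B B' M M' f g : lip B f -> lip B' g ->
  (forall x, normc (f x) <= M) -> (forall x, normc (g x) <= M') ->
  lip (B * M' + M * B') (fun x => f x * g x).
Proof.
move=> fB gB fM gM x i t.
have -> : f (Defs.shift x i t) * g (Defs.shift x i t) - f x * g x =
    (f (Defs.shift x i t) - f x) * g (Defs.shift x i t) +
    f x * (g (Defs.shift x i t) - g x) by ring.
apply: le_trans (normcD_le _ _) _; rewrite !Normc.normcM mulrDl lerD//.
  by rewrite mulrAC ler_pM ?normc_ge0.
by rewrite -mulrA ler_pM ?normc_ge0.
Qed.

Lemma lipJ B f : lip B f -> lip B (fun x => conjc (f x)).
Proof. by move=> fB x i t; rewrite -conjcB normc_conj. Qed.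

Lemma lip_normc B f : lip B f -> lip B (fun x => (normc (f x))%:C).
Proof.
move=> fB x i t; rewrite -rmorphB [leLHS]normc_real.
exact: le_trans (normc_dist _ _) (fB x i t).
Qed.

Lemma lip_addT B f x : lip B f -> lip B (fun w => f (addT x w)).
Proof. by move=> fB w i t; rewrite addT_shift; exact: fB. Qed.

Lemma lip_echar k : lip (2 * weight R k) (fun w : T => echar w k).
Proof.
move=> x i t; rewrite echar_shift -[X in _ - X]mul1r -mulrBl Normc.normcM.
rewrite normc_echar mulr1 -!mulrA normc_cexpB1 ler_wpM2l//.
rewrite mulrCA; apply: le_trans (sin_intmul _ _) _.
by rewrite ler_wpM2r// weight_coord.
Qed.

(** The floor map takes countably many values, and each of its fibres is a finite intersection of
    strips, one per coordinate. *)
Lemma cmeasurable_grid (m : nat) (G : Zn n -> C) :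
  cmeasurable (fun x : T => G (\row_i Num.floor (m%:R * tnth x i))).
Proof.
have mfl : measurable_fun [set: T]
    (fun x : T => (\row_i Num.floor (m%:R * tnth x i)) : Zn n).
  move=> _ Y _; rewrite setTI.
  rewrite (_ : _ @^-1` Y = \bigcup_(k in Y)
      \bigcap_(i in [set: 'I_n]) [set x : T |
        (k ord0 i)%:~R <= m%:R * tnth x i < (k ord0 i + 1)%:~R]); last first.
    apply/seteqP; split => [x /= Yx|x [k Yk] /=].
      exists (\row_i Num.floor (m%:R * tnth x i)) => //.
      by move=> i _ /=; rewrite mxE floor_itv.
    move=> h.
    suff -> : (\row_i Num.floor (m%:R * tnth x i)) = k by [].
    by apply/rowP => i; rewrite mxE; apply: floor_def; exact: (h i I).
  rewrite bigcup_mkcond; apply: countable_bigcupT_measurable => [|k].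
    exact: countableP.
  case: ifP => _ //; apply: fin_bigcap_measurable => // i _.
  have mt : measurable_fun [set: T] (fun x : T => m%:R * tnth x i : R).
    by apply: measurable_funM => //; exact: measurable_tnth.
  rewrite -[X in measurable X]setTI.
  rewrite (_ : [set x : T | _] = (fun x : T => m%:R * tnth x i : R) @^-1`
    [set` `[(k ord0 i)%:~R, (k ord0 i + 1)%:~R[ ]); first exact: mt.
  by apply/seteqP; split => x /=; rewrite in_itv.
exact: (cmeasurable_comp mfl (cmeasurable_Zn G)).
Qed.

(** [f] is a pointwise limit of functions constant on the cells of a grid of mesh 1 / (m + 1). *)
Lemma lip_cmeasurable B f : lip B f -> cmeasurable f.
Proof.
move=> fB.
have [B0|->] := lip_ge0 fB; last exact: cmeasurable_cst.
pose G (m : nat) (k : Zn n) := f [tuple (k ord0 i)%:~R / m.+1%:R | i < n].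
apply: (@cmeasurable_cvg _ _ _
  (fun m x => G m (\row_i Num.floor (m.+1%:R * tnth x i)))) => [m|x].
  exact: cmeasurable_grid.
apply/cvgrPdist_le => e e0.
have := @cvg_harmonic R; move/cvgrPdist_le.
(* The error on a cell is at most B pi n / (m + 1); the added 1 keeps the denominator positive when
   [B] or [n] is 0. *)
have e'0 : 0 < e / (B * pi * n%:R + 1).
  by rewrite divr_gt0// ltr_wpDl// !mulr_ge0// pi_ge0.
move=> /(_ _ e'0); apply: filterS => m; rewrite /= !sub0r !normrN => hm.
rewrite ger0_norm ?normc_ge0// normcBC; apply: le_trans (lip_dist fB _ _) _.
have h : B * (\sum_(i < n) (pi * m.+1%:R^-1)) <= e.
  have -> : B * (\sum_(i < n) (pi * m.+1%:R^-1)) = (B * pi * n%:R) * m.+1%:R^-1.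
    by rewrite sumr_const card_ord -[_ *+ n]mulr_natl; ring.
  apply: (@le_trans _ _ ((B * pi * n%:R + 1) * m.+1%:R^-1)).
    by rewrite ler_wpM2r ?invr_ge0// lerDl.
  rewrite mulrC -ler_pdivlMr; last by rewrite ltr_wpDl// !mulr_ge0// pi_ge0.
  by apply: le_trans hm; exact: ler_norm.
apply: le_trans h; rewrite ler_wpM2l//; apply: ler_sum => i _.
apply: le_trans (le_norm_sin _) _.
rewrite normrM (ger0_norm (pi_ge0 R)) ler_wpM2l ?pi_ge0//.
rewrite tnth_mktuple mxE.
have /andP[h1 h2] := floor_itv (m.+1%:R * tnth x i).
have m0 : 0 < m.+1%:R :> R by [].
rewrite -(ler_pM2l m0) mulfV ?gt_eqF// -{1}(gtr0_norm m0) -normrM mulrBr.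
rewrite mulrCA mulfV ?gt_eqF// mulr1.
rewrite ger0_norm ?subr_ge0// lerBlDl ltW// (lt_le_trans h2)//.
by rewrite intrD.
Qed.

End lip.

Arguments conjc {R} x : simpl never.
Arguments echar {R n} w k : simpl never.
Arguments Normc.normc {R} x : simpl never.

Lemma conjc_sum (R : realType) I (r : seq I) (P : pred I) (F : I -> R[i]) :
  conjc (\sum_(i <- r | P i) F i) = \sum_(i <- r | P i) conjc (F i).
Proof. exact: rmorph_sum. Qed.

Lemma rcM (R : realType) (a b : R) : (a * b)%:C = a%:C * b%:C.
Proof. exact: (rmorphM (real_complex R)). Qed.

Lemma rcD (R : realType) (a b : R) : (a + b)%:C = a%:C + b%:C.
Proof. exact: (rmorphD (real_complex R)). Qed.

Lemma rc_sum (R : realType) I (r : seq I) (P : pred I) (F : I -> R) :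
  (\sum_(i <- r | P i) F i)%:C = \sum_(i <- r | P i) (F i)%:C.
Proof. exact: (rmorph_sum (real_complex R)). Qed.

(** Arithmetic-geometric mean. It trades |sin| for sin^2, a trigonometric polynomial whose integral
    against the Fejer kernel is explicit. *)
Lemma young_half (R : realType) (d s : R) : 0 < d ->
  s <= d / 2 + s ^+ 2 / (2 * d).
Proof.
move=> d0; rewrite -subr_ge0.
have -> : d / 2 + s ^+ 2 / (2 * d) - s = (d - s) ^+ 2 / (2 * d).
  by field; rewrite gt_eqF.
by rewrite divr_ge0 ?sqr_ge0// mulr_ge0// ltW.
Qed.

Section bounded_measurable.
Context d (T : measurableType d) (R : realType).
Implicit Types f g : T -> R[i].

(** Bounded measurable functions form an algebra and are integrable for every probability, so
    integrability on the torus reduces to closure properties. *)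
Definition bmeas f := cmeasurable f /\ exists B, forall x, normc (f x) <= B.

Lemma bmeas_meas f : bmeas f -> cmeasurable f. Proof. by case. Qed.

Lemma bmeas_cst c : bmeas (fun=> c).
Proof. by split; [exact: cmeasurable_cst|exists (normc c)]. Qed.

Lemma bmeasD f g : bmeas f -> bmeas g -> bmeas (fun x => f x + g x).
Proof.
move=> [mf [B fB]] [mg [B' gB]]; split; first exact: cmeasurableD.
exists (B + B') => x; apply: le_trans (normcD_le _ _) _; exact: lerD.
Qed.

Lemma bmeasM f g : bmeas f -> bmeas g -> bmeas (fun x => f x * g x).
Proof.
move=> [mf [B fB]] [mg [B' gB]]; split; first exact: cmeasurableM.
by exists (B * B') => x; rewrite Normc.normcM ler_pM ?normc_ge0.
Qed.

Lemma bmeasZ c f : bmeas f -> bmeas (fun x => c * f x).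
Proof. exact: bmeasM (bmeas_cst c). Qed.

Lemma bmeasB f g : bmeas f -> bmeas g -> bmeas (fun x => f x - g x).
Proof.
move=> bf bg; have := bmeasD bf (bmeasZ (-1) bg).
by under eq_fun do rewrite mulN1r.
Qed.

Lemma bmeasJ f : bmeas f -> bmeas (fun x => conjc (f x)).
Proof.
move=> [mf [B fB]]; split; first exact: cmeasurableJ.
by exists B => x; rewrite normc_conj.
Qed.

Lemma bmeas_sum I (r : seq I) (P : pred I) (F : I -> T -> R[i]) :
  (forall i, bmeas (F i)) -> bmeas (fun x => \sum_(i <- r | P i) F i x).
Proof.
move=> bF; elim: r => [|i r ih].
  by under eq_fun do rewrite big_nil; exact: bmeas_cst.
have [Pi|/negbTE nPi] := boolP (P i); last by under eq_fun do rewrite big_cons nPi.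
by under eq_fun do rewrite big_cons Pi; exact: bmeasD.
Qed.

Lemma bmeas_integrable (P : probability T R) f : bmeas f -> cintegrable P f.
Proof. by move=> [mf [B fB]]; exact: (cintegrable_bounded P mf fB). Qed.

End bounded_measurable.

(** * Fejer means on the torus *)

Section fejer.
Context (R : realType) (n : nat).
Local Notation T := (Tn R n).
Local Notation C := R[i].
Implicit Types (f g q : T -> C) (x y w : T).
Local Notation haar := (haar R n).

Lemma lip_bmeas B f : lip B f -> bmeas f.
Proof. by move=> fB; split; [exact: lip_cmeasurable fB|exact: lip_bounded fB]. Qed.

Lemma bmeas_echar k : bmeas (fun x : T => echar x k).
Proof. exact: lip_bmeas (lip_echar k). Qed.

Lemma hint f : bmeas f -> cintegrable haar f.
Proof. exact: bmeas_integrable. Qed.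

Definition fc f (k : Zn n) : C := cint haar (fun x => f x * conjc (echar x k)).

Lemma bmeas_fc f k : bmeas f -> bmeas (fun x => f x * conjc (echar x k)).
Proof. by move=> bf; apply: bmeasM => //; apply: bmeasJ; exact: bmeas_echar. Qed.

Lemma fc_echar k l : fc (fun x => echar x k) l = (k == l)%:R.
Proof.
rewrite /fc (eq_cint _ (G := fun x => echar x (k - l))); last first.
  by move=> x; rewrite echarB.
by rewrite haar_echar subr_eq0.
Qed.

Lemma fcZ c f k : bmeas f -> fc (fun x => c * f x) k = c * fc f k.
Proof.
move=> bf; rewrite /fc -cintZ; last by apply: hint; exact: bmeas_fc.
by apply: eq_cint => x; rewrite mulrA.
Qed.

Definition vecZ M (a : {ffun 'I_n -> 'I_M}) : Zn n := \row_i (a i)%:Z.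

Lemma vecZ_inj M : injective (@vecZ M).
Proof.
move=> a b /rowP ab; apply/ffunP => i; apply: val_inj.
by have := ab i; rewrite !mxE => -[].
Qed.

Definition fsize m : nat := (m.+1 ^ 2)%N.

Definition fnorm m : R := ((fsize m ^ n)%N)%:R^-1.

Lemma fsize_gt0 m : (0 < fsize m)%N.
Proof. by rewrite expn_gt0. Qed.

Lemma fnorm_ge0 m : 0 <= fnorm m.
Proof. by rewrite invr_ge0. Qed.

Lemma fnormM m : fnorm m * ((fsize m ^ n)%N)%:R = 1.
Proof. by rewrite mulVf// pnatr_eq0 -lt0n expn_gt0 fsize_gt0. Qed.

(* Averaging over the differences of two points of a cube makes the kernel
   [fkern] nonnegative; the side length (m + 1)^2 of the cube gives an
   approximation error of order 1 / (m + 1), see [fejer_close]. *)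
Definition fejer m f x : C := (fnorm m)%:C *
  \sum_(a : {ffun 'I_n -> 'I_(fsize m)}) \sum_(b : {ffun 'I_n -> 'I_(fsize m)})
    fc f (vecZ a - vecZ b) * echar x (vecZ a - vecZ b).

(** The product over the coordinates of the one-dimensional Fejer kernels of order [fsize m] at
    [x - y], written as a normalized square of a Dirichlet sum over a cube. *)
Definition fkern m x y : R := fnorm m *
  normc (\sum_(a : {ffun 'I_n -> 'I_(fsize m)})
    echar x (vecZ a) * conjc (echar y (vecZ a))) ^+ 2.

Lemma fkern_ge0 m x y : 0 <= fkern m x y.
Proof. by rewrite mulr_ge0 ?fnorm_ge0// sqr_ge0. Qed.

Lemma fkernE m x y : (fkern m x y)%:C = (fnorm m)%:C *
  \sum_(a : {ffun 'I_n -> 'I_(fsize m)}) \sum_(b : {ffun 'I_n -> 'I_(fsize m)})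
    conjc (echar y (vecZ a - vecZ b)) * echar x (vecZ a - vecZ b).
Proof.
rewrite /fkern rmorphM /=; congr (_ * _); rewrite -mulcJ conjc_sum mulr_suml.
apply: eq_bigr => a _; rewrite mulr_sumr; apply: eq_bigr => b _.
rewrite !echarB !conjcM !conjcK; ring.
Qed.

Lemma bmeas_fkern m x : bmeas (fun y => (fkern m x y)%:C).
Proof.
under eq_fun do rewrite fkernE.
apply: bmeasZ; apply: bmeas_sum => a; apply: bmeas_sum => b.
apply: bmeasM; last exact: bmeas_cst.
by apply: bmeasJ; exact: bmeas_echar.
Qed.

Lemma fejerE m f x : bmeas f ->
  fejer m f x = cint haar (fun y => f y * (fkern m x y)%:C).
Proof.
move=> bf.
have b1 k : bmeas (fun y => f y * conjc (echar y k) * echar x k).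
  by apply: bmeasM; [exact: bmeas_fc|exact: bmeas_cst].
rewrite (eq_cint _ (G := fun y => (fnorm m)%:C *
  \sum_(a : {ffun 'I_n -> 'I_(fsize m)}) \sum_(b : {ffun 'I_n -> 'I_(fsize m)})
    f y * conjc (echar y (vecZ a - vecZ b)) * echar x (vecZ a - vecZ b))); last first.
  move=> y; rewrite fkernE mulrCA; congr (_ * _).
  rewrite mulr_sumr; apply: eq_bigr => a _; rewrite mulr_sumr.
  by apply: eq_bigr => b _; rewrite mulrA.
rewrite cintZ; last first.
  by apply: hint; apply: bmeas_sum => a; apply: bmeas_sum.
rewrite cint_sum; last by move=> a _; apply: hint; exact: bmeas_sum.
congr (_ * _); apply: eq_bigr => a _.
rewrite cint_sum; last by move=> b _; exact: hint.
by apply: eq_bigr => b _; rewrite cintZr//; apply: hint; exact: bmeas_fc.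
Qed.

(** The Fourier multiplier of [fejer m]. Counting pairs with difference [k] would give the product
    over [i] of the positive parts of 1 - |k_i| / fsize m; below it is evaluated at 0 and bounded at
    the unit vectors. *)
Definition fcoef m (k : Zn n) : R := fnorm m *
  \sum_(a : {ffun 'I_n -> 'I_(fsize m)}) \sum_(b : {ffun 'I_n -> 'I_(fsize m)})
    (vecZ a - vecZ b == k)%:R.

Lemma fejer_echar m k x :
  fejer m (fun x => echar x k) x = (fcoef m k)%:C * echar x k.
Proof.
rewrite /fejer /fcoef rmorphM /= -mulrA; congr (_ * _).
rewrite rmorph_sum mulr_suml; apply: eq_bigr => a _.
rewrite rmorph_sum mulr_suml; apply: eq_bigr => b _.
rewrite fc_echar eq_sym rmorph_nat.
by case: eqP => [->|_]; rewrite ?mul0r.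
Qed.

Lemma fcoef0 m : fcoef m 0 = 1.
Proof.
rewrite -(fnormM m) /fcoef; congr (_ * _).
rewrite (eq_bigr (fun=> 1)); last first.
  move=> a _; rewrite (bigD1 a)//= subrr eqxx big1 ?addr0// => b ba.
  by rewrite subr_eq0 (inj_eq (@vecZ_inj _)) eq_sym (negbTE ba).
by rewrite sumr_const card_ffun !card_ord.
Qed.

Definition unitZ (i : 'I_n) : Zn n := \row_j (j == i)%:Z.

Lemma sum_ltn_pred M : (0 < M)%N ->
  \sum_(c < M) (c.+1 < M)%:R = (M.-1)%:R :> R.
Proof.
case: M => // M _; rewrite big_ord_recr /= ltnn addr0 (eq_bigr (fun=> 1)).
  by rewrite sumr_const card_ord.
by move=> j _; rewrite /= ltnS ltn_ord.
Qed.

(** Each [b] whose i-th coordinate can be raised by 1 inside the cube contributes the pair (b + e_i,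
    b), and there are (M - 1) M^(n-1) such [b]. *)
Lemma fcoef_unit m i : 1 - (fsize m)%:R^-1 <= fcoef m (unitZ i).
Proof.
have Mp := fsize_gt0 m; set M := fsize m in Mp *.
have n0 : (0 < n)%N := leq_ltn_trans (leq0n i) (ltn_ord i).
pose phi (j : 'I_n) (c : 'I_M) : R := if j == i then (c.+1 < M)%:R else 1.
(* The condition involves one coordinate only, so the count factors as a product over the
   coordinates. *)
have E : \sum_(b : {ffun 'I_n -> 'I_M}) ((b i).+1 < M)%:R =
    (M.-1)%:R * (M ^ n.-1)%:R :> R.
  transitivity (\sum_(b : {ffun 'I_n -> 'I_M}) \prod_j phi j (b j)).
    apply: eq_bigr => b _; rewrite (bigD1 i)//= /phi eqxx big1 ?mulr1//.
    by move=> j /negbTE ->.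
  rewrite -(bigA_distr_bigA phi) (bigD1 i)//=; congr (_ * _).
    by rewrite /phi eqxx sum_ltn_pred.
  rewrite (eq_bigr (fun=> M%:R)); last first.
    by move=> j /negbTE ji; rewrite /phi ji sumr_const card_ord.
  by rewrite prodr_const cardC1 card_ord natrX.
have H : fnorm m * ((M.-1)%:R * (M ^ n.-1)%:R) = 1 - M%:R^-1.
  have M0 : M%:R != 0 :> R by rewrite pnatr_eq0 -lt0n.
  rewrite /fnorm -/M -[in X in X^-1](prednK n0) expnS natrM.
  have P0 : (M ^ n.-1)%:R != 0 :> R by rewrite pnatr_eq0 -lt0n expn_gt0 Mp.
  have -> : (M.-1)%:R = M%:R - 1 :> R by rewrite -subn1 natrB.
  by field; rewrite M0 P0.
rewrite -H /fcoef; apply: ler_wpM2l; first exact: fnorm_ge0.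
rewrite -E exchange_big /=; apply: ler_sum => b _.
case: (ltnP (b i).+1 M) => [bM|_]; last first.
  by apply: sumr_ge0 => a _; exact: ler0n.
pose a : {ffun 'I_n -> 'I_M} := [ffun j => if j == i then Ordinal bM else b j].
rewrite (bigD1 a)//= (_ : (_ == _) = true); last first.
  apply/eqP/rowP => j; rewrite !mxE ffunE; case: eqP => [->|_] /=.
    by rewrite -addn1 PoszD addrC addKr.
  by rewrite subrr.
by rewrite lerDl; apply: sumr_ge0 => c _; exact: ler0n.
Qed.

Lemma cint_fkern m x : cint haar (fun y => (fkern m x y)%:C) = 1.
Proof.
transitivity (fejer m (fun x => echar x 0) x); last first.
  by rewrite fejer_echar echar0 fcoef0 mulr1.
rewrite fejerE; last exact: bmeas_echar.
by apply: eq_cint => y; rewrite echar0 mul1r.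
Qed.

Definition sin2 (i : 'I_n) x y : R := `|sin (pi * (tnth y i - tnth x i))| ^+ 2.

Lemma sin2E i x y : (sin2 i x y)%:C = (1 / 4)%:C *
  (2 - conjc (echar x (unitZ i)) * echar y (unitZ i)
     - echar x (unitZ i) * conjc (echar y (unitZ i))).
Proof.
have dE w : dot w (unitZ i) = tnth w i.
  rewrite /dot (bigD1 i)//= mxE eqxx mulr1 big1 ?addr0// => j /negbTE ji.
  by rewrite mxE ji mulr0.
set z := conjc _ * _.
have zE : z = cexp (2 * (pi * (tnth y i - tnth x i))).
  rewrite /z conj_echar !echarE -cexpD dotN !dE; congr cexp; ring.
have -> : echar x (unitZ i) * conjc (echar y (unitZ i)) = conjc z.
  by rewrite conjcM conjcK.
have h := normc_cexpB1 (pi * (tnth y i - tnth x i)).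
rewrite -zE in h.
have := mulcJ (z - 1); rewrite h => h2.
have zz : z * conjc z = 1 by rewrite mulcJ zE normc_cexp expr1n.
have -> : 2 - z - conjc z = (z - 1) * conjc (z - 1).
  by rewrite conjcB conjc1 mulrBl mulrBr zz; ring.
rewrite h2 -rmorphM /=; congr (_%:C); rewrite /sin2; by field.
Qed.

Lemma bmeas_sin2 i x : bmeas (fun y => (sin2 i x y)%:C).
Proof.
under eq_fun do rewrite sin2E.
apply: bmeasZ; apply: bmeasB; first apply: bmeasB; first exact: bmeas_cst.
  by apply: bmeasZ; exact: bmeas_echar.
by apply: bmeasZ; apply: bmeasJ; exact: bmeas_echar.
Qed.

(** By [sin2E] the function sin^2 has only the frequencies 0 and +- e_i, so the integral is read off
    from the multipliers there. *)
Lemma cint_sin2_fkern m i x :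
  cint haar (fun y => (sin2 i x y)%:C * (fkern m x y)%:C) =
  ((1 - fcoef m (unitZ i)) / 2)%:C.
Proof.
set u := unitZ i.
have bK := bmeas_fkern m x.
have be : bmeas (fun y => echar y u) by exact: bmeas_echar.
have b1 : bmeas (fun y => echar y u * (fkern m x y)%:C) by exact: bmeasM.
have b2 : bmeas (fun y => conjc (echar y u * (fkern m x y)%:C)) by exact: bmeasJ.
have E : cint haar (fun y => echar y u * (fkern m x y)%:C) =
    (fcoef m u)%:C * echar x u.
  by rewrite -fejerE// fejer_echar.
rewrite (eq_cint _ (G := fun y => (1 / 4)%:C * (2 * (fkern m x y)%:C
   - conjc (echar x u) * (echar y u * (fkern m x y)%:C)
   - echar x u * conjc (echar y u * (fkern m x y)%:C)))); last first.
  by move=> y; rewrite sin2E conjcM conjc_real; ring.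
rewrite cintZ; last first.
  by apply: hint; apply: bmeasB; [apply: bmeasB|]; exact: bmeasZ.
rewrite cintB; last 2 first.
- by apply: hint; apply: bmeasB; apply: bmeasZ.
- by apply: hint; apply: bmeasZ.
rewrite cintB; try by apply: hint; apply: bmeasZ.
rewrite !cintZ; try exact: hint.
rewrite cintJ; last exact: hint.
rewrite E cint_fkern conjcM conjc_real mulr1.
have xx : echar x u * conjc (echar x u) = 1.
  by rewrite mulcJ normc_echar expr1n.
have -> : 2 - conjc (echar x u) * ((fcoef m u)%:C * echar x u) -
   echar x u * ((fcoef m u)%:C * conjc (echar x u)) =
   2 - 2 * (fcoef m u)%:C * (echar x u * conjc (echar x u)) by ring.
rewrite xx mulr1 -[2]/(2%:R) -(rmorph_nat (real_complex R)) -!rmorphM -rmorphB -rmorphM /=.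
by congr (_%:C); field.
Qed.

Lemma nint_real_kern (r : T -> R) (c : R) : (forall y, 0 <= r y) ->
  bmeas (fun y => (r y)%:C) -> cint haar (fun y => (r y)%:C) = c%:C ->
  (\int[haar]_y (r y)%:E = c%:E)%E.
Proof.
move=> r0 br; rewrite cint_real => /complexI <-.
by rewrite /Rintegral fineK//; apply: integrable_fin_num => //; exact: (hint br).1.
Qed.

(** The kernel is nonnegative with integral 1, so taking Fejer means is a contraction in the sup
    norm. *)
Lemma fejer_close m f g e x : bmeas f -> bmeas g ->
  (forall y, normc (f y - g y) <= e) -> normc (fejer m f x - fejer m g x) <= e.
Proof.
move=> bf bg fge; have bK := bmeas_fkern m x.
have bfK : bmeas (fun y => f y * (fkern m x y)%:C) by exact: bmeasM.
have bgK : bmeas (fun y => g y * (fkern m x y)%:C) by exact: bmeasM.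
rewrite !fejerE// -cintB; try exact: hint.
rewrite -lee_fin; apply: le_trans (normc_cint _) _.
  by apply: hint; exact: bmeasB.
have e0 : 0 <= e by apply: le_trans (fge x); exact: normc_ge0.
have beK : bmeas (fun y => (e * fkern m x y)%:C).
  by under eq_fun do rewrite rmorphM; exact: bmeasZ.
rewrite -(@nint_real_kern (fun y => e * fkern m x y) e)//.
- apply: le_nint; first by apply: bmeas_meas; exact: bmeasB.
    by apply/measurable_EFinP; exact: (bmeas_meas beK).1.
  move=> y; rewrite -mulrBl Normc.normcM lee_fin.
  by rewrite (ge0_normc_real (fkern_ge0 m x y)) ler_wpM2r// fkern_ge0.
- by move=> y; rewrite mulr_ge0// fkern_ge0.
- under eq_cint do rewrite rmorphM.
  by rewrite cintZ ?cint_fkern ?mulr1//; exact: hint.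
Qed.

(** Averaging [lip_dist] against the kernel leaves first moments of |sin|, which [young_half] bounds
    by dl / 2 plus a second moment divided by 2 dl. The second moment is at most dl^2 / 2 by
    [fcoef_unit], so each coordinate contributes at most dl / 2 + dl / 4. *)
Lemma fejer_le m B f x : 0 <= B -> lip B f ->
  normc (fejer m f x - f x) <= B * n%:R * m.+1%:R^-1.
Proof.
move=> B0 fB; have bf := lip_bmeas fB; have bK := bmeas_fkern m x.
(* The square of [dl] is 1 / fsize m, the bound on 1 - fcoef at a unit vector; this balances the two
   terms of [young_half]. *)
pose dl : R := m.+1%:R^-1.
have dl0 : 0 < dl by rewrite invr_gt0.
have bfK : bmeas (fun y => f y * (fkern m x y)%:C) by exact: bmeasM.
have -> : fejer m f x - f x = cint haar (fun y => (f y - f x) * (fkern m x y)%:C).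
  rewrite fejerE// -[X in _ - X]mulr1 -(cint_fkern m x) -cintZ; last exact: hint.
  rewrite -cintB; [|exact: hint|by apply: hint; exact: bmeasZ].
  by apply: eq_cint => y; rewrite mulrBl.
have bs i : bmeas (fun y => (sin2 i x y)%:C * (fkern m x y)%:C).
  by apply: bmeasM => //; exact: bmeas_sin2.
pose r y := B * \sum_(i < n) (dl / 2 + sin2 i x y / (2 * dl)) * fkern m x y.
have rE y : (r y)%:C = B%:C * \sum_(i < n) ((dl / 2)%:C * (fkern m x y)%:C +
    ((2 * dl)^-1)%:C * ((sin2 i x y)%:C * (fkern m x y)%:C)).
  rewrite /r rmorphM rmorph_sum /=; congr (_ * _); apply: eq_bigr => i _.
  by rewrite -!rmorphM -rmorphD /=; congr (_%:C); ring.
have bi i : bmeas (fun y => (dl / 2)%:C * (fkern m x y)%:C +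
    ((2 * dl)^-1)%:C * ((sin2 i x y)%:C * (fkern m x y)%:C)).
  by apply: bmeasD; exact: bmeasZ.
have br : bmeas (fun y => (r y)%:C).
  by under eq_fun do rewrite rE; apply: bmeasZ; apply: bmeas_sum.
have rint : cint haar (fun y => (r y)%:C) = (B * \sum_(i < n)
    (dl / 2 + (2 * dl)^-1 * ((1 - fcoef m (unitZ i)) / 2)))%:C.
  under eq_cint do rewrite rE.
  rewrite cintZ; last by apply: hint; exact: bmeas_sum.
  rewrite cint_sum; last by move=> i _; exact: hint.
  rewrite [RHS]rcM rc_sum; congr (_ * _); apply: eq_bigr => i _.
  rewrite cintD; try by apply: hint; exact: bmeasZ.
  by rewrite !cintZ ?cint_fkern ?cint_sin2_fkern ?mulr1 ?rcD ?rcM//;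
    exact: hint.
have r0 y : 0 <= r y.
  rewrite mulr_ge0// sumr_ge0// => i _; rewrite mulr_ge0 ?fkern_ge0// addr_ge0//.
    by rewrite divr_ge0// ltW.
  by rewrite divr_ge0 ?sqr_ge0// mulr_ge0// ltW.
rewrite -lee_fin; apply: le_trans (normc_cint _) _.
  by apply: hint; apply: bmeasM => //; apply: bmeasB => //; exact: bmeas_cst.
apply: (@le_trans _ _ (\int[haar]_y (r y)%:E)%E).
  apply: le_nint.
  - apply: bmeas_meas; apply: bmeasM => //; apply: bmeasB => //; exact: bmeas_cst.
  - by apply/measurable_EFinP; exact: (bmeas_meas br).1.
  - move=> y; rewrite lee_fin Normc.normcM (ge0_normc_real (fkern_ge0 m x y)).
    rewrite /r -mulr_suml [leRHS]mulrA ler_wpM2r ?fkern_ge0//.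
    apply: le_trans (lip_dist fB x y) _; rewrite ler_wpM2l//.
    apply: ler_sum => i _; exact: young_half.
rewrite (nint_real_kern r0 br rint) lee_fin -mulrA ler_wpM2l//.
have -> : n%:R / m.+1%:R = \sum_(i < n) dl by rewrite sumr_const card_ord -[RHS]mulr_natl.
apply: ler_sum => i _.
have h := fcoef_unit m i.
have hd : (fsize m)%:R^-1 = dl ^+ 2 by rewrite /fsize natrX exprVn.
rewrite hd in h.
apply: (@le_trans _ _ (dl / 2 + (2 * dl)^-1 * (dl ^+ 2 / 2))).
  rewrite lerD2l; apply: ler_wpM2l; last by lra.
  by rewrite invr_ge0 mulr_ge0// ltW.
have -> : (2 * dl)^-1 * (dl ^+ 2 / 2) = dl / 4 by field; rewrite gt_eqF.
by lra.
Qed.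

End fejer.

(** * Uniform limits of Lipschitz functions and translation invariance *)

Section approx.
Context (R : realType) (n : nat).
Local Notation T := (Tn R n).
Local Notation C := R[i].
Implicit Types (f g q : T -> C) (x y w : T).
Local Notation haar := (haar R n).
Local Notation cnt := (@countZ R n).

Lemma sum_le_integral_Zn (I : finType) (h : I -> Zn n) (f : Zn n -> R) :
  injective h -> (forall k, 0 <= f k) ->
  ((\sum_i f (h i))%:E <= \int[cnt]_k (f k)%:E)%E.
Proof.
move=> hI f0.
have -> : (\sum_i f (h i))%:E =
    (\int[cnt]_k (\sum_i (if k == h i then (f k)%:E else 0%E))%E)%E.
  rewrite ge0_integral_sum//; last by move=> i k _; case: ifP; rewrite ?lee_fin.
  rewrite -sumEFin; apply: eq_bigr => i _.
  by rewrite (@integral_Zn_supp1 _ _ _ (h i)) ?eqxx// => k /negbTE ->.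
apply: ge0_le_integral => //.
  by move=> k _; apply: sume_ge0 => i _; case: ifP; rewrite ?lee_fin.
move=> k _; have [[i ki]|nk] := pselect (exists i, k = h i).
  rewrite (bigD1 i)//= ki eqxx big1 ?adde0// => j ji.
  by rewrite (inj_eq hI) eq_sym (negbTE ji).
by rewrite big1 ?lee_fin// => i _; case: eqP => // ki; case: nk; exists i.
Qed.

(** For fixed [b] the frequencies [vecZ a - vecZ b] are distinct, so the sum over [a] is at most the
    full l^1 norm; the number of [b] cancels [fnorm]. *)
Lemma fejer_le_sum m f x : ((normc (fejer m f x))%:E <= nint cnt (fc f))%E.
Proof.
rewrite /fejer Normc.normcM (ge0_normc_real (fnorm_ge0 R n m)).
have [[r rE]|] := pselect (exists r : R, nint cnt (fc f) = r%:E); last first.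
  have := nint_ge0 cnt (fc f); case: (nint cnt (fc f)) => [r _ []|_ _|//].
    by exists r.
  by rewrite leey.
rewrite rE lee_fin -[leRHS]mul1r -(fnormM R n m) -mulrA.
rewrite ler_wpM2l ?fnorm_ge0// exchange_big /=.
apply: le_trans (normc_sum _ _ _) _.
have -> : ((fsize m ^ n)%N)%:R * r =
    \sum_(b : {ffun 'I_n -> 'I_(fsize m)}) r.
  by rewrite sumr_const card_ffun !card_ord -[RHS]mulr_natl.
apply: ler_sum => b _; apply: le_trans (normc_sum _ _ _) _.
rewrite -lee_fin -rE.
under eq_bigr do rewrite Normc.normcM normc_echar mulr1.
apply: (sum_le_integral_Zn (h := fun a : {ffun 'I_n -> 'I_(fsize m)} => vecZ a - vecZ b)
  (f := fun k => normc (fc f k))).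
  by move=> a a' /addIr/vecZ_inj.
by move=> k; exact: normc_ge0.
Qed.

(** The approximations have errors of the form c / (m + 1), and equalities are deduced from them by
    this criterion. *)
Lemma normc_small (z : C) (c : R) :
  (forall m : nat, normc z <= c * m.+1%:R^-1) -> z = 0.
Proof.
move=> zc; apply/eqP; rewrite -normc_eq0 eq_le normc_ge0 andbT.
have hc : (fun m : nat => c * m.+1%:R^-1) @ \oo --> c * 0.
  by apply: cvgM; [exact: cvg_cst|exact: cvg_harmonic].
rewrite mulr0 in hc; rewrite -(cvg_lim _ hc)//.
by apply: limr_ge; [apply/cvg_ex; exists 0|exact: nearW].
Qed.

(** A translation multiplies each Fourier coefficient of a trigonometric polynomial by a unimodular
    number, which is 1 for the coefficient of index 0. Invariance of [haar], defined on a cube that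
    translations do not preserve, extends from here to Lipschitz functions and then to their uniform
    limits. *)
Lemma cint_fejer_addT m f x : cint haar (fun w => fejer m f (addT x w)) =
  cint haar (fejer m f).
Proof.
have be k (c : C) : bmeas (fun w : T => c * echar w k).
  by apply: bmeasZ; exact: bmeas_echar.
have h y : cint haar (fun w => fejer m f (addT y w)) = (fnorm R n m)%:C *
    \sum_(a : {ffun 'I_n -> 'I_(fsize m)}) \sum_(b : {ffun 'I_n -> 'I_(fsize m)})
    fc f (vecZ a - vecZ b) * (vecZ a - vecZ b == 0)%:R.
  rewrite (eq_cint _ (G := fun w => (fnorm R n m)%:C *
    \sum_(a : {ffun 'I_n -> 'I_(fsize m)}) \sum_(b : {ffun 'I_n -> 'I_(fsize m)})
    (fc f (vecZ a - vecZ b) * echar y (vecZ a - vecZ b)) *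
    echar w (vecZ a - vecZ b))); last first.
    move=> w; rewrite /fejer; congr (_ * _); apply: eq_bigr => a _.
    by apply: eq_bigr => b _; rewrite echar_addT mulrA.
  rewrite cintZ; last by apply: hint; apply: bmeas_sum => a; exact: bmeas_sum.
  rewrite cint_sum; last by move=> a _; apply: hint; exact: bmeas_sum.
  congr (_ * _); apply: eq_bigr => a _; rewrite cint_sum; last first.
    by move=> b _; exact: hint.
  apply: eq_bigr => b _; rewrite cintZ; last by apply: hint; exact: bmeas_echar.
  rewrite haar_echar; case: eqP => [->|_]; last by rewrite !mulr0.
  by rewrite echar0 !mulr1.
rewrite h -(h [tuple 0 | i < n]); apply: eq_cint => w; congr (fejer m f).
by apply: eq_from_tnth => j; rewrite !tnth_mktuple add0r.
Qed.

Lemma bmeas_fejer m f : bmeas (fejer m f).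
Proof.
apply: bmeasZ; apply: bmeas_sum => a; apply: bmeas_sum => b.
by apply: bmeasZ; exact: bmeas_echar.
Qed.

Lemma bmeas_fejer_addT m f x : bmeas (fun w => fejer m f (addT x w)).
Proof.
apply: bmeasZ; apply: bmeas_sum => a; apply: bmeas_sum => b.
apply: bmeasZ; apply: (lip_bmeas (B := 2 * weight R (vecZ a - vecZ b))).
by apply: (lip_addT x (f := fun w => echar w (vecZ a - vecZ b))); exact: lip_echar.
Qed.

Lemma lip_haar_addT B f x : 0 <= B -> lip B f ->
  cint haar (fun w => f (addT x w)) = cint haar f.
Proof.
move=> B0 fB; have bf := lip_bmeas fB; have bfx := lip_bmeas (lip_addT x fB).
apply/eqP; rewrite -subr_eq0; apply/eqP.
apply: (@normc_small _ (2 * (B * n%:R))) => m.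
have -> : cint haar (fun w => f (addT x w)) - cint haar f =
  cint haar (fun w => f (addT x w) - fejer m f (addT x w)) +
  cint haar (fun w => fejer m f w - f w).
  rewrite !cintB; try apply: hint; try exact: bmeas_fejer_addT => //.
  - by rewrite cint_fejer_addT subrKA.
  - exact: bmeas_fejer.
  - exact: bf.
  - exact: bfx.
apply: le_trans (normcD_le _ _) _; rewrite -mulrA mulr_natl mulr2n.
apply: lerD; apply: normc_cint_bounded.
- by apply: bmeas_meas; apply: bmeasB => //; exact: bmeas_fejer_addT.
- by move=> w; rewrite normcBC; exact: fejer_le.
- by apply: bmeas_meas; apply: bmeasB => //; exact: bmeas_fejer.
- by move=> w; exact: fejer_le.
Qed.

(* The uniform closure of the Lipschitz functions; it contains the symbol,
   which is only known to have an absolutely convergent Fourier series. *)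
Definition approx f := forall e : R, 0 < e -> exists B q,
  [/\ 0 <= B, lip B q & forall x, normc (f x - q x) <= e].

Lemma approx_lip B f : 0 <= B -> lip B f -> approx f.
Proof.
move=> B0 fB e e0; exists B, f; split => // x.
by rewrite subrr Normc.normc0 ltW.
Qed.

Lemma approx_bmeas f : approx f -> bmeas f.
Proof.
move=> af; split; last first.
  have [B [q [B0 qB fq]]] := af 1 ltr01; have [M qM] := lip_bounded qB.
  exists (1 + M) => x; rewrite -[f x](subrK (q x)).
  by apply: le_trans (normcD_le _ _) _; exact: lerD.
have /choice[q_ hq] : forall m : nat, exists q, cmeasurable q /\
    forall x, normc (f x - q x) <= m.+1%:R^-1.
  move=> m; have m0 : (0 : R) < m.+1%:R^-1 by rewrite invr_gt0.
  have [B [q [B0 qB fq]]] := af _ m0.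
  by exists q; split => //; exact: lip_cmeasurable qB.
apply: (@cmeasurable_cvg _ _ _ q_) => [m|x]; first exact: (hq m).1.
apply: (@squeeze_cvgr _ _ _ _ (fun=> 0) (fun m => m.+1%:R^-1)).
- by apply: nearW => m; rewrite normc_ge0 normcBC (hq m).2.
- exact: cvg_cst.
- exact: cvg_harmonic.
Qed.

Lemma approxM f g : approx f -> approx g -> approx (fun x => f x * g x).
Proof.
move=> af ag e e0.
have [_ [M fM]] := approx_bmeas af; have [_ [N gN]] := approx_bmeas ag.
have M0 : 0 <= M by apply: le_trans (fM [tuple 0 | i < n]); exact: normc_ge0.
have N0 : 0 <= N by apply: le_trans (gN [tuple 0 | i < n]); exact: normc_ge0.
have c0 : 0 < M + N + 1 by rewrite ltr_wpDl// addr_ge0.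
(* The cap 1 bounds the approximant [p] by M + 1, so the total error is at most d N + (M + 1) d = d
   (M + N + 1). *)
pose d := Num.min 1 (e / (M + N + 1)).
have d0 : 0 < d by rewrite lt_min ltr01 divr_gt0.
have [B [p [B0 pB fp]]] := af d d0; have [B' [q [B'0 qB gq]]] := ag d d0.
have pM x : normc (p x) <= M + 1.
  rewrite -[p x](subKr (f x)) addrC; apply: le_trans (normcD_le _ _) _.
  rewrite addrC normcN lerD//; apply: le_trans (fp x) _.
  by rewrite ge_min lexx.
have qN x : normc (q x) <= N + 1.
  rewrite -[q x](subKr (g x)) addrC; apply: le_trans (normcD_le _ _) _.
  rewrite addrC normcN lerD//; apply: le_trans (gq x) _.
  by rewrite ge_min lexx.
exists (B * (N + 1) + (M + 1) * B'), (fun x => p x * q x); split.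
- by rewrite addr_ge0// mulr_ge0// addr_ge0.
- exact: lipM.
move=> x; have -> : f x * g x - p x * q x =
    (f x - p x) * g x + p x * (g x - q x) by ring.
apply: le_trans (normcD_le _ _) _; rewrite !Normc.normcM.
apply: (@le_trans _ _ (d * N + (M + 1) * d)).
  by apply: lerD; apply: ler_pM; rewrite ?normc_ge0.
have -> : d * N + (M + 1) * d = d * (M + N + 1) by ring.
by rewrite -ler_pdivlMr// ge_min lexx orbT.
Qed.

Lemma approx_normc f : approx f -> approx (fun x => (normc (f x))%:C).
Proof.
move=> af e e0; have [B [q [B0 qB fq]]] := af e e0.
exists B, (fun x => (normc (q x))%:C); split => //; first exact: lip_normc.
move=> x; rewrite -(rmorphB (real_complex R)) [leLHS]normc_real.
exact: le_trans (normc_dist _ _) (fq x).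
Qed.

Lemma approxJ f : approx f -> approx (fun x => conjc (f x)).
Proof.
move=> af e e0; have [B [q [B0 qB fq]]] := af e e0.
exists B, (fun x => conjc (q x)); split => //; first exact: lipJ.
by move=> x; rewrite -conjcB normc_conj.
Qed.

Lemma approx_addT f x : approx f -> approx (fun w => f (addT x w)).
Proof.
move=> af e e0; have [B [q [B0 qB fq]]] := af e e0.
exists B, (fun w => q (addT x w)); split => //; first exact: lip_addT.
Qed.

Lemma haar_addT f x : approx f -> cint haar (fun w => f (addT x w)) = cint haar f.
Proof.
move=> af; have bf := approx_bmeas af; have bfx := approx_bmeas (approx_addT x af).
apply/eqP; rewrite -subr_eq0; apply/eqP.
apply: (@normc_small _ 2) => m.
have m0 : (0 : R) < m.+1%:R^-1 by rewrite invr_gt0.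
have [B [q [B0 qB fq]]] := af _ m0.
have bq := lip_bmeas qB; have bqx := lip_bmeas (lip_addT x qB).
have -> : cint haar (fun w => f (addT x w)) - cint haar f =
  cint haar (fun w => f (addT x w) - q (addT x w)) +
  cint haar (fun w => q w - f w).
  rewrite !cintB; try exact: hint.
  by rewrite (lip_haar_addT x B0 qB) subrKA.
apply: le_trans (normcD_le _ _) _; rewrite mulr_natl mulr2n.
apply: lerD; apply: normc_cint_bounded.
- by apply: bmeas_meas; exact: bmeasB.
- by move=> w; exact: fq.
- by apply: bmeas_meas; exact: bmeasB.
- by move=> w; rewrite normcBC; exact: fq.
Qed.

Lemma nint_cint f : bmeas f ->
  nint haar f = (Re (cint haar (fun x => (normc (f x))%:C)))%:E.
Proof.
move=> bf; rewrite cint_real /= /nint /Rintegral fineK//.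
apply: integrable_fin_num => //; apply: cintegrable_norm; exact: hint.
Qed.

Lemma nint_addT f x : approx f -> nint haar (fun w => f (addT x w)) = nint haar f.
Proof.
move=> af; rewrite (nint_cint (approx_bmeas af)).
by rewrite (nint_cint (approx_bmeas (approx_addT x af))) (haar_addT x (approx_normc af)).
Qed.

(** The Fejer means obey the bound uniformly in [m] by [fejer_le_sum]. Those of a Lipschitz function
    near [f] converge uniformly, and [fejer_close] carries the convergence over to [f]. *)
Lemma approx_le_fc f x : approx f -> ((normc (f x))%:E <= nint cnt (fc f))%E.
Proof.
move=> af; have bf := approx_bmeas af.
apply/lee_addgt0Pr => e e0.
have e4 : 0 < e / 4 by rewrite divr_gt0.
have [B [q [B0 qB fq]]] := af _ e4.
have bq := lip_bmeas qB.
have [m hm] : exists m : nat, B * n%:R * m.+1%:R^-1 <= e / 4.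
  exists (Num.truncn (B * n%:R / (e / 4))).
  rewrite ler_pdivrMr// -ler_pdivrMl// [leLHS]mulrC.
  by rewrite ltW// truncnS_gt.
have h : normc (f x) <= normc (fejer m f x) + e.
  have -> : f x = fejer m f x + ((f x - q x) + (q x - fejer m q x) +
      (fejer m q x - fejer m f x)) by ring.
  apply: le_trans (normcD_le _ _) _; rewrite lerD2l.
  have h1 := fq x; have h2 := fejer_le m x B0 qB.
  have h3 : normc (fejer m q x - fejer m f x) <= e / 4.
    by apply: fejer_close => // y; rewrite normcBC.
  apply: le_trans (normcD_le _ _) _; apply: le_trans (lerD (normcD_le _ _) (lexx _)) _.
  rewrite normcBC in h2; apply: le_trans (lerD (lerD h1 (le_trans h2 hm)) h3) _.
  by rewrite -[leLHS](_ : 3 / 4 * e = _); [rewrite ler_piMl ?ltW//; lra|ring].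
apply: (@le_trans _ _ ((normc (fejer m f x))%:E + e%:E)%E).
  by rewrite -EFinD lee_fin.
by rewrite leeD2r// fejer_le_sum.
Qed.

Definition negT x : T := [tuple - tnth x i | i < n].

Lemma subT_negT x y : subT x y = addT (negT y) x.
Proof. by apply: eq_from_tnth => j; rewrite !tnth_mktuple addrC. Qed.

Lemma approx_echar k : approx (fun w => echar w k).
Proof.
apply: approx_lip (lip_echar k); rewrite mulr_ge0// ltW//; exact: weight_gt0.
Qed.

Lemma fc_subT f x k : approx f ->
  fc (fun w => f (subT w x)) k = conjc (echar x k) * fc f k.
Proof.
move=> af; rewrite /fc.
have ag : approx (fun y => f y * conjc (echar y k)).
  by apply: approxM => //; apply: approxJ; exact: approx_echar.
rewrite -(haar_addT (negT x) ag) -cintZ; last first.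
  by apply: hint; apply: approx_bmeas; exact: (approx_addT (negT x) ag).
apply: eq_cint => w; rewrite -subT_negT echar_subT conjcM conjcK.
have xx : echar x k * conjc (echar x k) = 1.
  by rewrite mulcJ normc_echar expr1n.
transitivity (f (subT w x) * conjc (echar w k) * (echar x k * conjc (echar x k))).
  by rewrite xx mulr1.
by ring.
Qed.

End approx.

(** * Density of trigonometric polynomials in the Schwartz space *)

Section smooth.
Context (R : realType) (n : nat).
Local Notation T := (Tn R n).
Local Notation C := R[i].
Implicit Types (f g h : T -> C) (x y w : T).
Local Notation haar := (haar R n).

Lemma cderive_partial i f : has_partial i f ->
  forall x, cderive (fun t => f (Defs.shift x i t)) 0 (partial i f x).
Proof.
move=> fi x; have [d1 d2] := fi x; split; rewrite /partial /= derive1E.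
  exact: DeriveDef.
exact: DeriveDef.
Qed.

Lemma partialP i f (df : T -> C) :
  (forall x, cderive (fun t => f (Defs.shift x i t)) 0 (df x)) ->
  has_partial i f /\ partial i f = df.
Proof.
move=> fd; split=> [x|]; first by have [[d1 _] [d2 _]] := fd x.
apply/funext => x; have [d1 d2] := fd x.
apply: complexP; rewrite /partial /= derive1E; exact: derive_val.
Qed.

Lemma cderive_partial_at i f x t : has_partial i f ->
  cderive (fun s => f (Defs.shift x i s)) t (partial i f (Defs.shift x i t)).
Proof.
move=> fi; have h := cderive_partial fi (Defs.shift x i t).
have {}h : cderive (fun s => f (Defs.shift (Defs.shift x i t) i s)) (- t + t)
  (partial i f (Defs.shift x i t)) by rewrite addNr.
apply: cderive_ext (cderive_affine h) => // s.
by rewrite shiftD addrA subrr add0r.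
Qed.

Lemma shift_int x i (z : int) f : Defs.periodic f -> f (Defs.shift x i z%:~R) = f x.
Proof.
move=> pf.
have hn (m : nat) y : f (Defs.shift y i m%:R) = f y.
  elim: m y => [|m ih] y; first by rewrite shift0.
  by rewrite -natr1 -shiftD pf ih.
case: z => m; first exact: hn.
rewrite NegzE -(hn m.+1 (Defs.shift x i _)) shiftD -[m.+1%:R]/(m.+1%:Z%:~R) -intrD.
by rewrite addNr shift0.
Qed.

(** By periodicity [t] is replaced by its difference [r] from a nearest integer. For |r| <= 1 / 2
    the mean value bound 2 B |r| is at most 2 B |sin (pi r)|. *)
Lemma partial_lip f B : 0 <= B -> Defs.periodic f -> (forall i, has_partial i f) ->
  (forall i x, normc (partial i f x) <= B) -> lip (2 * B) f.
Proof.
move=> B0 pf hf fB x i t.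
pose z := Num.floor (t + 1 / 2); pose r := t - z%:~R.
have tr : t = r + z%:~R by rewrite subrK.
have r2 : `|r| <= 1 / 2.
  have /andP[h1 h2] := floor_itv (t + 1 / 2); rewrite -/z intrD in h1 h2.
  rewrite ler_norml /r; apply/andP; split; lra.
have -> : f (Defs.shift x i t) = f (Defs.shift x i r).
  by rewrite tr -shiftD shift_int.
have -> : `|sin (pi * t)| = `|sin (pi * r)|.
  rewrite tr mulrDr sinD [pi * z%:~R]mulrC sinMpi_int mulr0 addr0 normrM.
  have -> : `|cos (z%:~R * pi)| = 1 :> R.
    apply/eqP; rewrite -(@eqrXn2 _ 2)// expr1n real_normK ?num_real//.
    by have := cos2Dsin2 (z%:~R * pi : R); rewrite sinMpi_int expr0n /= addr0 => ->.
  by rewrite mulr1.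
apply: (@le_trans _ _ (2 * B * `|r|)).
  have := @cMVT_le _ (fun s => f (Defs.shift x i s))
    (fun s => partial i f (Defs.shift x i s)) B
    (fun s => cderive_partial_at x s (hf i)) r.
  by rewrite shift0; apply => s _.
by rewrite ler_wpM2l ?mulr_ge0// le_sin_pi.
Qed.

Definition pbound N (B : R) f := forall s x, (size s <= N)%N ->
  normc (partials s f x) <= B.

Definition smooth f := Defs.periodic f /\ forall s i, has_partial i (partials s f).

(** The class to which the sections of a Schwartz function belong; boundedness of the derivatives is
    recorded, as it comes directly from the seminorms. *)
Definition sm f := smooth f /\ forall N, exists B, pbound N B f.

Lemma pbound_ge0 N B f : pbound N B f -> 0 <= B.
Proof.
move=> fB; apply: le_trans (fB [::] [tuple 0 | i < n] (leq0n _)).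
exact: normc_ge0.
Qed.

Lemma pboundW N M B f : (M <= N)%N -> pbound N B f -> pbound M B f.
Proof. by move=> MN fB s x sM; apply: fB; exact: leq_trans MN. Qed.

Lemma partials_rcons s i f : partials (rcons s i) f = partials s (partial i f).
Proof. by rewrite /partials foldr_rcons. Qed.

Lemma partials_cat s t f : partials (t ++ s) f = partials t (partials s f).
Proof. by rewrite /partials foldr_cat. Qed.

Lemma smooth_lip f B : smooth f -> pbound 1 B f -> lip (2 * B) f.
Proof.
move=> [pf hf] fB; apply: partial_lip => //.
- exact: pbound_ge0 fB.
- by move=> i; exact: hf [::] i.
- by move=> i x; exact: fB [:: i] x isT.
Qed.

Lemma shiftC x i j s t : Defs.shift (Defs.shift x i s) j t =
  Defs.shift (Defs.shift x j t) i s.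
Proof. by apply: eq_from_tnth => l; rewrite !tnth_mktuple addrAC. Qed.

Lemma periodic_partial i f : Defs.periodic f -> Defs.periodic (partial i f).
Proof.
move=> pf x j; rewrite /partial.
by congr (_ +i* _); congr (derive1 _ 0); apply/funext => t;
  rewrite shiftC pf.
Qed.

Lemma sm_partial i f : sm f -> sm (partial i f).
Proof.
move=> [[pf hf] bf]; split.
  split=> [|s j]; first exact: periodic_partial.
  by rewrite -partials_rcons.
move=> N; have [B fB] := bf N.+1; exists B => s x sN.
by rewrite -partials_rcons; apply: fB; rewrite size_rcons.
Qed.

Lemma sm_partials s f : sm f -> sm (partials s f).
Proof. by move=> smf; elim: s => //= i s; exact: sm_partial. Qed.

Lemma sm_approx f : sm f -> approx f.
Proof.
move=> [sf bf]; have [B fB] := bf 1%N.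
apply: (@approx_lip _ _ (2 * B)); last exact: smooth_lip.
by rewrite mulr_ge0//; exact: pbound_ge0 fB.
Qed.

Lemma sm_bmeas f : sm f -> bmeas f.
Proof. by move/sm_approx/approx_bmeas. Qed.

Lemma partial_lin i c f g : has_partial i f -> has_partial i g ->
  has_partial i (fun x => c * f x + g x) /\
  partial i (fun x => c * f x + g x) = (fun x => c * partial i f x + partial i g x).
Proof.
move=> hf hg; apply: partialP => x.
by apply: cderiveD; [apply: cderiveZ|]; exact: cderive_partial.
Qed.

Lemma partials_lin s c f g : smooth f -> smooth g ->
  partials s (fun x => c * f x + g x) =
  (fun x => c * partials s f x + partials s g x).
Proof.
move=> [pf hf] [pg hg]; elim: s => //= i s ->.
exact: (partial_lin c (hf s i) (hg s i)).2.
Qed.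

Lemma smooth_lin c f g : smooth f -> smooth g -> smooth (fun x => c * f x + g x).
Proof.
move=> sf sg; have [pf hf] := sf; have [pg hg] := sg; split.
  by move=> x i; rewrite pf pg.
move=> s i; rewrite partials_lin//.
exact: (partial_lin c (hf s i) (hg s i)).1.
Qed.

Lemma pbound_lin N c B B' f g : smooth f -> smooth g -> pbound N B f ->
  pbound N B' g -> pbound N (normc c * B + B') (fun x => c * f x + g x).
Proof.
move=> sf sg fB gB s x sN; rewrite partials_lin//.
apply: le_trans (normcD_le _ _) _; rewrite Normc.normcM.
by apply: lerD; [rewrite ler_wpM2l ?normc_ge0//; exact: fB|exact: gB].
Qed.

Lemma sm_lin c f g : sm f -> sm g -> sm (fun x => c * f x + g x).
Proof.
move=> [sf bf] [sg bg]; split; first exact: smooth_lin.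
move=> N; have [B fB] := bf N; have [B' gB] := bg N.
by exists (normc c * B + B'); exact: pbound_lin.
Qed.

Lemma smooth0 : smooth (fun=> 0) /\ forall s, partials s (fun=> 0 : C) = (fun=> 0) :> (T -> C).
Proof.
have p0 i : has_partial i (fun=> 0 : C) /\ partial i (fun=> 0 : C) = (fun=> 0) :> (T -> C).
  by apply: partialP => x; exact: cderive_cst.
have ps s : partials s (fun=> 0 : C) = (fun=> 0) :> (T -> C).
  by elim: s => //= i s ->; exact: (p0 i).2.
by split => //; split=> // s i; rewrite ps; exact: (p0 i).1.
Qed.

Lemma sm0 : sm (fun=> 0).
Proof.
split; first exact: smooth0.1.
by move=> N; exists 0 => s x _; rewrite smooth0.2 Normc.normc0.
Qed.

Lemma smJ f : sm f -> sm (fun x => conjc (f x)) /\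
  forall s, partials s (fun x => conjc (f x)) = (fun x => conjc (partials s f x)).
Proof.
move=> [[pf hf] bf].
have p1 i h : has_partial i h -> has_partial i (fun x => conjc (h x)) /\
    partial i (fun x => conjc (h x)) = (fun x => conjc (partial i h x)).
  by move=> hh; apply: partialP => x; apply: cderiveJ; exact: cderive_partial.
have ps s : partials s (fun x => conjc (f x)) = (fun x => conjc (partials s f x)).
  by elim: s => //= i s ->; exact: (p1 i _ (hf s i)).2.
split => //; split.
  split=> [x i|s i]; first by rewrite pf.
  by rewrite ps; exact: (p1 i _ (hf s i)).1.
move=> N; have [B fB] := bf N; exists B => s x sN.
by rewrite ps normc_conj fB.
Qed.

Lemma subT_shift x w i t : subT (Defs.shift x i t) w = Defs.shift (subT x w) i t.
Proof. by apply: eq_from_tnth => j; rewrite !tnth_mktuple addrAC. Qed.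

Lemma sm_subT f w : sm f -> sm (fun x => f (subT x w)) /\
  forall s, partials s (fun x => f (subT x w)) = (fun x => partials s f (subT x w)).
Proof.
move=> [[pf hf] bf].
have p1 i h : has_partial i h -> has_partial i (fun x => h (subT x w)) /\
    partial i (fun x => h (subT x w)) = (fun x => partial i h (subT x w)).
  move=> hh; apply: partialP => x.
  by under eq_fun do rewrite subT_shift; exact: cderive_partial.
have ps s : partials s (fun x => f (subT x w)) = (fun x => partials s f (subT x w)).
  by elim: s => //= i s ->; exact: (p1 i _ (hf s i)).2.
split => //; split.
  split=> [x i|s i]; first by rewrite subT_shift pf.
  by rewrite ps; exact: (p1 i _ (hf s i)).1.
move=> N; have [B fB] := bf N; exists B => s x sN.
by rewrite ps fB.
Qed.

Definition ecoef (k : Zn n) (i : 'I_n) : C := (2 * pi * (k ord0 i)%:~R) *i.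

Lemma normc_ecoef k i : normc (ecoef k i) <= 2 * pi * weight R k.
Proof.
rewrite /ecoef /Normc.normc expr0n add0r sqrtr_sqr !normrM.
rewrite (ger0_norm (pi_ge0 R)) (ger0_norm (ler0n _ 2)).
by rewrite ler_wpM2l ?mulr_ge0 ?pi_ge0// -intr_norm weight_coord.
Qed.

Lemma cderive_echar k x i :
  cderive (fun t => echar (Defs.shift x i t) k) 0 (ecoef k i * echar x k).
Proof.
have h := cderiveZ (echar x k) (cderive_cexp (2 * pi * (k ord0 i)%:~R) 0).
apply: cderive_ext h => [t|]; first by rewrite echar_shift mulrC.
by rewrite mulr0 cexp0 mulr1 mulrC.
Qed.

Lemma partial_echarM k i f : has_partial i f ->
  has_partial i (fun x => echar x k * f x) /\
  partial i (fun x => echar x k * f x) =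
    (fun x => echar x k * (ecoef k i * f x + partial i f x)).
Proof.
move=> hf; apply: partialP => x.
have h := cderiveM (cderive_echar k x i) (cderive_partial hf x).
apply: cderive_ext h => //; rewrite !shift0; ring.
Qed.

Lemma echar_periodic k : Defs.periodic (fun x : T => echar x k).
Proof. exact: lip_periodic (lip_echar k). Qed.

(** A derivative of echar k * g is again echar k times a function, namely ecoef k i * g + partial i
    g. Each one costs a factor 2 pi weight k + 1 and one order of the bound on [f]. Keeping [g]
    existential avoids writing out Leibniz sums. *)
Lemma partials_echarM k s f : sm f -> exists g, [/\ sm g,
  partials s (fun x => echar x k * f x) = (fun x => echar x k * g x) &
  forall N B, pbound (size s + N) B f ->
    pbound N (B * (2 * pi * weight R k + 1) ^+ size s) g].
Proof.
move=> smf; elim: s => [|i s [g [smg gE gB]]].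
  by exists f; split=> // N B; rewrite expr0 mulr1.
exists (fun x => ecoef k i * g x + partial i g x); split.
- by apply: sm_lin => //; exact: sm_partial.
- rewrite /= gE; have [[_ /(_ [::] i) hg] _] := smg.
  exact: (partial_echarM k hg).2.
move=> N B; rewrite /= addSnnS => fB; have {}gB := gB _ _ fB.
have gB' : pbound N (B * (2 * pi * weight R k + 1) ^+ size s) (partial i g).
  move=> t x tN; rewrite -partials_rcons; apply: gB.
  by rewrite size_rcons.
have B0 := pbound_ge0 gB'.
have gB2 := pbound_lin (ecoef k i) smg.1 (sm_partial i smg).1
  (pboundW (leqnSn _) gB) gB'.
move=> t x tN; apply: le_trans (gB2 t x tN) _.
rewrite exprS [leRHS]mulrCA [leRHS]mulrDl mul1r lerD2r ler_wpM2r//.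
exact: normc_ecoef.
Qed.

Lemma pbound_echarM k N B f : sm f -> pbound N B f ->
  pbound N (B * (2 * pi * weight R k + 1) ^+ N) (fun x => echar x k * f x).
Proof.
move=> smf fB s x sN.
have [g [smg -> gB]] := partials_echarM k s smf.
rewrite Normc.normcM normc_echar mul1r.
have := gB 0%N B; rewrite addn0 => /(_ (pboundW sN fB) [::] x (leqnn 0)) /=.
move=> /le_trans; apply; rewrite ler_wpM2l ?(pbound_ge0 fB)//.
rewrite ler_weXn2l// lerDr.
by rewrite !mulr_ge0 ?pi_ge0// ltW// weight_gt0.
Qed.

Lemma sm_echarM k f : sm f -> sm (fun x => echar x k * f x).
Proof.
move=> smf; split.
  split=> [x i|s i]; first by rewrite echar_periodic smf.1.1.
  have [g [smg -> _]] := partials_echarM k s smf.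
  exact: (partial_echarM k (smg.1.2 [::] i)).1.
move=> N; have [B fB] := smf.2 N.
by exists (B * (2 * pi * weight R k + 1) ^+ N); exact: pbound_echarM.
Qed.

Lemma smZ c f : sm f -> sm (fun x => c * f x).
Proof.
by move=> smf; have := sm_lin c smf sm0; under eq_fun do rewrite addr0.
Qed.

Lemma sm_sum I (r : seq I) (P : pred I) (F : I -> T -> C) :
  (forall i, sm (F i)) -> sm (fun x => \sum_(i <- r | P i) F i x).
Proof.
move=> smF; elim: r => [|i r ih].
  by under eq_fun do rewrite big_nil; exact: sm0.
have [Pi|/negbTE nPi] := boolP (P i); last by under eq_fun do rewrite big_cons nPi.
under eq_fun do rewrite big_cons Pi -[F i _]mul1r; exact: sm_lin.
Qed.

Lemma sm_echar k : sm (fun x => echar x k).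
Proof.
have sm1 : sm (fun=> 1).
  have p1 i : has_partial i (fun=> 1 : C) /\ partial i (fun=> 1 : C) = (fun=> 0) :> (T -> C).
    by apply: partialP => x; exact: cderive_cst.
  have ps s i : partials (rcons s i) (fun=> 1 : C) = (fun=> 0) :> (T -> C).
    by rewrite partials_rcons (p1 i).2 smooth0.2.
  split; first split=> // s i.
    case/lastP: s => [|s j]; first exact: (p1 i).1.
    by rewrite ps -(smooth0.2 [::]); exact: smooth0.1.2.
  move=> N; exists 1 => s x _; case/lastP: s => [|s j]; first by rewrite Normc.normc1.
  by rewrite ps Normc.normc0.
by have := sm_echarM k sm1; under eq_fun do rewrite mulr1.
Qed.

Lemma sm_fejer m f : sm (fejer m f).
Proof.
apply: smZ; apply: sm_sum => a; apply: sm_sum => b; apply: smZ.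
exact: sm_echar.
Qed.

Lemma shift_addT x i t :
  Defs.shift x i t = addT (Defs.shift [tuple 0 | j < n] i t) x.
Proof.
apply: eq_from_tnth => j; rewrite !tnth_mktuple add0r addrC //.
Qed.

(** The difference quotient has integral 0 by translation invariance and differs from the derivative
    by O(t) uniformly, by [cTaylor_le]. *)
Lemma cint_partial i f : sm f -> cint haar (partial i f) = 0.
Proof.
move=> smf; have [sf bf] := smf; have [B fB] := bf 2%N.
have smd := sm_partial i smf.
apply: (@normc_small _ _ (4 * B)) => m; set t : R := m.+1%:R^-1.
have t0 : 0 < t by rewrite invr_gt0.
pose o : T := Defs.shift [tuple 0 | j < n] i t.
have ai := sm_approx smf; have bm := sm_bmeas smf; have bd := sm_bmeas smd.
have bo := approx_bmeas (approx_addT o ai).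
have E : cint haar (fun x => f (addT o x) - f x - t%:C * partial i f x) =
    - (t%:C * cint haar (partial i f)).
  rewrite cintB; last 2 first.
  - by apply: hint; exact: bmeasB.
  - by apply: hint; exact: bmeasZ.
  rewrite cintB; try exact: hint.
  rewrite cintZ; last exact: hint.
  by rewrite haar_addT// subrr sub0r.
have : normc (- (t%:C * cint haar (partial i f))) <= 4 * B * `|t| ^+ 2.
  rewrite -E; apply: normc_cint_bounded.
    by apply: bmeas_meas; apply: bmeasB; [exact: bmeasB|exact: bmeasZ].
  move=> x; have := @cTaylor_le _ (fun s => f (Defs.shift x i s))
    (fun s => partial i f (Defs.shift x i s))
    (fun s => partial i (partial i f) (Defs.shift x i s)) B.
  rewrite shift0 => /(_ _ _ _ t); rewrite -shift_addT; apply => s.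
  - by apply: cderive_partial_at; exact: sf.2 [::] i.
  - by apply: cderive_partial_at; exact: sf.2 [:: i] i.
  - exact: fB [:: i; i] _ isT.
rewrite normcN Normc.normcM normc_real expr2 mulrA [leRHS]mulrC ler_pM2l.
  by rewrite ger0_norm// ltW.
by rewrite normr_gt0 gt_eqF.
Qed.

(** Integration by parts: [cint_partial] for the product of [f] with a conjugate character. *)
Lemma fc_partial i f k : sm f -> fc (partial i f) k = ecoef k i * fc f k.
Proof.
move=> smf; have smd := sm_partial i smf.
have bf := sm_bmeas smf; have bd := sm_bmeas smd.
have sme := sm_echarM (- k) smf.
have := cint_partial i sme.
rewrite (partial_echarM (- k) (smf.1.2 [::] i)).2.
rewrite (eq_cint _ (G := fun x => partial i f x * conjc (echar x k) -
  ecoef k i * (f x * conjc (echar x k)))); last first.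
  move=> x; rewrite -conj_echar.
  have -> : ecoef (- k) i = - ecoef k i.
    by apply: complexP; rewrite /= ?oppr0// mxE intrN mulrN.
  by rewrite /=; ring.
rewrite cintB; last 2 first.
- by apply: hint; exact: bmeas_fc.
- by apply: hint; apply: bmeasZ; exact: bmeas_fc.
rewrite cintZ; last by apply: hint; exact: bmeas_fc.
by move/eqP; rewrite subr_eq0 => /eqP.
Qed.

Lemma cderive_sum I (r : seq I) (P : pred I) (F : I -> R -> C) t (dF : I -> C) :
  (forall i, cderive (F i) t (dF i)) ->
  cderive (fun s => \sum_(i <- r | P i) F i s) t (\sum_(i <- r | P i) dF i).
Proof.
move=> Fd; elim: r => [|i r ih].
  by under eq_fun do rewrite big_nil; rewrite big_nil; exact: cderive_cst.
have [Pi|/negbTE nPi] := boolP (P i); last first.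
  by under eq_fun do rewrite big_cons nPi; rewrite big_cons nPi.
under eq_fun do rewrite big_cons Pi; rewrite big_cons Pi; exact: cderiveD.
Qed.

(** Since [fejer] acts by multipliers it commutes with derivatives, and the rate of [fejer_le]
    extends to all partial derivatives, at the price of one more order ([fejer_sm_le]). *)
Lemma partial_fejer m i f : sm f -> partial i (fejer m f) = fejer m (partial i f).
Proof.
move=> smf; apply: (partialP _).2 => x; apply: cderiveZ.
apply: cderive_sum => a; apply: cderive_sum => b.
set k := vecZ a - vecZ b.
apply: cderive_ext (cderiveZ (fc f k) (cderive_echar k x i)) => //.
by rewrite (fc_partial i k smf) mulrCA mulrA.
Qed.

Lemma partials_fejer m s f : sm f -> partials s (fejer m f) = fejer m (partials s f).
Proof.
by move=> smf; elim: s => //= i s ->; rewrite partial_fejer//; exact: sm_partials.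
Qed.

Lemma fejer_sm_le m N B f s x : sm f -> pbound N.+1 B f -> (size s <= N)%N ->
  normc (partials s (fejer m f) x - partials s f x) <= 2 * B * n%:R * m.+1%:R^-1.
Proof.
move=> smf fB sN; rewrite partials_fejer//; apply: fejer_le.
  by rewrite mulr_ge0// (pbound_ge0 fB).
apply: smooth_lip; first exact: (sm_partials s smf).1.
move=> t y t1; rewrite -partials_cat.
by apply: fB; rewrite size_cat -add1n leq_add.
Qed.

End smooth.

(** * Approximation of test functions by finite combinations of characters *)

Section schwartz_density.
Context (R : realType) (n : nat).
Local Notation T := (Tn R n).
Local Notation Z := (Zn n).
Local Notation ZT := (Z * T)%type.
Local Notation C := R[i].
Implicit Types (F H : ZT -> C) (j k l m : Z) (x y w xi eta : T).
Local Notation haar := (haar R n).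
Local Notation cnt := (@countZ R n).

Definition sec F k : T -> C := fun x => F (k, x).

(** A form of [seminormZT N F <= S] with real numbers in place of a supremum. *)
Definition wbound N (S : R) F := forall k x s, (size s <= N)%N ->
  weight R k ^+ N * normc (partials s (sec F k) x) <= S.

Lemma wbound_seminorm N S F : wbound N S F -> (seminormZT N F <= S%:E)%E.
Proof.
move=> FS; apply: ge_ereal_sup => _ [k [x [s [sN ->]]]].
by rewrite lee_fin; exact: FS.
Qed.

Lemma seminorm_wbound N F : (seminormZT N F < +oo)%E ->
  exists S, wbound N S F.
Proof.
move=> Foo.
have h k x s : (size s <= N)%N ->
    ((weight R k ^+ N * normc (partials s (sec F k) x))%:E <= seminormZT N F)%E.
  by move=> sN; apply: ereal_sup_ubound; exists k, x, s.
exists (fine (seminormZT N F)) => k x s sN.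
rewrite -lee_fin fineK ?h// fin_numElt Foo andbT.
by apply: lt_le_trans (h 0 [tuple 0 | i < n] [::] (leq0n _)); rewrite ltNyr.
Qed.

Lemma schwartzZTP F : schwartzZT F <->
  (forall k, smooth (sec F k)) /\ forall N, exists S, wbound N S F.
Proof.
split=> [[pF hF sF]|[sF bF]].
  split=> [k|N]; last exact: seminorm_wbound (sF N).
  by split; [exact: pF|move=> s i; exact: hF].
split=> [k|k s i|N]; first exact: (sF k).1; first exact: (sF k).2.
by have [S FS] := bF N; apply: le_lt_trans (wbound_seminorm FS) (ltry _).
Qed.

Lemma weightX_ge1 k N : 1 <= weight R k ^+ N.
Proof. by rewrite exprn_ege1// weight_ge1. Qed.

Lemma wbound_ge0 N S F : wbound N S F -> 0 <= S.
Proof.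
move=> FS; apply: le_trans (FS 0 [tuple 0 | i < n] [::] (leq0n _)).
by rewrite mulr_ge0 ?normc_ge0// (le_trans ler01)// weightX_ge1.
Qed.

Lemma wbound_pbound N S F k : wbound N S F ->
  pbound N (S / weight R k ^+ N) (sec F k).
Proof.
move=> FS s x sN; rewrite ler_pdivlMr; last first.
  by rewrite (lt_le_trans ltr01)// weightX_ge1.
by rewrite mulrC FS.
Qed.

Lemma schwartz_sm F k : schwartzZT F -> sm (sec F k).
Proof.
move=> /schwartzZTP[sF bF]; split=> [|N]; first exact: sF.
by have [S FS] := bF N; exists (S / weight R k ^+ N); exact: wbound_pbound.
Qed.

Lemma schwartz_lin (c : C) F H : schwartzZT F -> schwartzZT H ->
  schwartzZT (fun z => c * F z + H z).
Proof.
move=> /schwartzZTP[sF bF] /schwartzZTP[sH bH]; apply/schwartzZTP; split=> [k|N].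
  exact: (smooth_lin c (sF k) (sH k)).
have [S FS] := bF N; have [S' HS] := bH N.
exists (normc c * S + S') => k x s sN.
have -> : partials s (sec (fun z => c * F z + H z) k) x =
    c * partials s (sec F k) x + partials s (sec H k) x.
  by rewrite (partials_lin s c (sF k) (sH k)).
apply: le_trans (ler_wpM2l _ (normcD_le _ _)) _.
  by rewrite (le_trans ler01)// weightX_ge1.
rewrite mulrDr Normc.normcM mulrCA; apply: lerD; last exact: HS.
by rewrite ler_wpM2l ?normc_ge0// FS.
Qed.

Lemma schwartz0 : schwartzZT ((fun=> 0) : ZT -> C).
Proof.
apply/schwartzZTP; split=> [k|N]; first exact: (smooth0 R n).1.
exists 0 => k x s _; rewrite (_ : sec _ k = fun=> 0)// (smooth0 R n).2.
by rewrite Normc.normc0 mulr0.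
Qed.

Lemma schwartz_sum I (r : seq I) (P : pred I) (F : I -> ZT -> C) :
  (forall i, schwartzZT (F i)) -> schwartzZT (fun z => \sum_(i <- r | P i) F i z).
Proof.
move=> sF; elim: r => [|i r ih].
  by under eq_fun do rewrite big_nil; exact: schwartz0.
have [Pi|/negbTE nPi] := boolP (P i); last by under eq_fun do rewrite big_cons nPi.
under eq_fun do rewrite big_cons Pi -[F i _]mul1r; exact: schwartz_lin.
Qed.

Lemma schwartz_scale (c : C) F : schwartzZT F -> schwartzZT (fun z => c * F z).
Proof.
by move=> sF; have := schwartz_lin c sF schwartz0; under eq_fun do rewrite addr0.
Qed.

Lemma schwartzB F H : schwartzZT F -> schwartzZT H ->
  schwartzZT (fun z => F z - H z).
Proof.
move=> sF sH; have := schwartz_lin (-1) sH sF.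
by under eq_fun do rewrite mulN1r addrC.
Qed.

Definition dirac_fun j (f : T -> C) : ZT -> C := fun z => (z.1 == j)%:R * f z.2.

Lemma schwartz_dirac j f : sm f -> schwartzZT (dirac_fun j f).
Proof.
move=> smf.
have secE k : sec (dirac_fun j f) k = fun x => (k == j)%:R * f x by [].
apply/schwartzZTP; split=> [k|N].
  by rewrite secE; exact: (smZ _ smf).1.
have [B fB] := smf.2 N.
exists (weight R j ^+ N * B) => k x s sN; rewrite secE.
have B0 := pbound_ge0 fB.
have w0 : 0 <= weight R j ^+ N by rewrite (le_trans ler01)// weightX_ge1.
case: eqP => [->|_].
  under eq_fun do rewrite mul1r.
  by rewrite ler_wpM2l// fB.
under eq_fun do rewrite mul0r.
by rewrite (smooth0 R n).2 Normc.normc0 mulr0 mulr_ge0.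
Qed.

Definition bchar j l : ZT -> C := dirac_fun j (fun x => echar x l).

Lemma schwartz_bchar j l : schwartzZT (bchar j l).
Proof. by apply: schwartz_dirac; exact: sm_echar. Qed.

(** Truncation to a ball in Z^n combined with a Fejer mean on the torus: a finite combination of the
    functions [bchar j l] ([densE]), on which a linear functional is known through its values
    [dcoef]. *)
Definition dens (M : nat) H : ZT -> C := fun z =>
  if weight R z.1 <= M%:R then fejer M (sec H z.1) z.2 else 0.

Definition box (M : nat) : seq Z := sval (cid (weight_enum R n M)).

Lemma box_uniq M : uniq (box M).
Proof. by rewrite /box; case: cid => s []. Qed.

Lemma mem_box M k : (k \in box M) = (weight R k <= M%:R).
Proof. by rewrite /box; case: cid => s []. Qed.

Lemma sum_box M k (f : Z -> C) :
  \sum_(j <- box M) (k == j)%:R * f j = if weight R k <= M%:R then f k else 0.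
Proof.
rewrite -mem_box; case: ifP => [kb|/negbT kb].
  rewrite (bigD1_seq k)//= ?box_uniq// eqxx mul1r big1 ?addr0// => j jk.
  by rewrite eq_sym (negbTE jk) mul0r.
rewrite big_seq big1// => j jb; case: eqP => [kj|_]; last by rewrite mul0r.
by rewrite kj jb in kb.
Qed.

Lemma densE M H z : dens M H z = \sum_(j <- box M) (fnorm R n M)%:C *
  \sum_(a : {ffun 'I_n -> 'I_(fsize M)}) \sum_(b : {ffun 'I_n -> 'I_(fsize M)})
    fc (sec H j) (vecZ a - vecZ b) * bchar j (vecZ a - vecZ b) z.
Proof.
rewrite /dens -(sum_box M z.1 (fun j => fejer M (sec H j) z.2)).
apply: eq_bigr => j _; rewrite /fejer mulrCA; congr (_ * _).
rewrite mulr_sumr; apply: eq_bigr => a _; rewrite mulr_sumr.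
by apply: eq_bigr => b _; rewrite mulrCA.
Qed.

Lemma schwartz_dens M H : schwartzZT (dens M H).
Proof.
rewrite (_ : dens M H = fun z => \sum_(j <- box M) (fnorm R n M)%:C *
  \sum_(a : {ffun 'I_n -> 'I_(fsize M)}) \sum_(b : {ffun 'I_n -> 'I_(fsize M)})
    fc (sec H j) (vecZ a - vecZ b) * bchar j (vecZ a - vecZ b) z); last first.
  by apply/funext => z; exact: densE.
apply: schwartz_sum => j; apply: schwartz_scale; apply: schwartz_sum => a.
by apply: schwartz_sum => b; apply: schwartz_scale; exact: schwartz_bchar.
Qed.

(** Weights are integers, so exceeding [M] means reaching M + 1, the denominator in the error
    terms. *)
Lemma weight_gtS k (M : nat) : M%:R < weight R k -> M.+1%:R <= weight R k.
Proof.
have -> : weight R k = (1 + \sum_(i < n) `|k ord0 i|)%:~R by rewrite intrD.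
rewrite -[M%:R]/(M%:Z%:~R) -[M.+1%:R]/(M.+1%:Z%:~R) ltr_int ler_int.
by rewrite -lezD1 addrC -PoszD add1n.
Qed.

(** Order N + 1 pays for the rate: inside the ball one more derivative bounds the Fejer error,
    outside it one more power of the weight, which is at least M + 1 there, absorbs the whole
    function. *)
Lemma dens_wbound N S H M : schwartzZT H -> wbound N.+1 S H ->
  wbound N (S * (2 * n%:R + 1) / M.+1%:R) (fun z => H z - dens M H z).
Proof.
move=> sH HS k x s sN.
have S0 := wbound_ge0 HS.
have w0 : 0 < weight R k ^+ N by rewrite (lt_le_trans ltr01)// weightX_ge1.
have smk := schwartz_sm k sH.
have wk := weight_ge1 R k.
have wgt0 := weight_gt0 R k.
case: (leP (weight R k) M%:R) => [kM|kM].
  have -> : sec (fun z => H z - dens M H z) k =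
      (fun y => -1 * fejer M (sec H k) y + sec H k y).
    by apply/funext => y; rewrite /sec /dens /= kM mulN1r addrC.
  rewrite partials_lin; [|exact: (sm_fejer M (sec H k)).1|exact: smk.1].
  rewrite mulN1r addrC normcBC.
  apply: le_trans (ler_wpM2l (ltW w0) (fejer_sm_le M x smk (wbound_pbound k HS) sN)) _.
  rewrite !mulrA ler_wpM2r//; apply: (@le_trans _ _ (S * (2 * n%:R))); last first.
    by rewrite ler_wpM2l// lerDl.
  rewrite exprSr invfM.
  have -> : weight R k ^+ N * 2 * S * (weight R k ^- N * (weight R k)^-1) * n%:R =
     (S * (2 * n%:R)) * (weight R k)^-1.
     by field; rewrite ?expf_neq0 ?gt_eqF.
  by rewrite ler_piMr ?mulr_ge0// invf_le1.
have -> : sec (fun z => H z - dens M H z) k = sec H k.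
  by apply/funext => y; rewrite /sec /dens /= leNgt kM /= subr0.
have h := HS k x s (leqW sN).
rewrite exprS -mulrA in h; set B := weight R k ^+ N * _ in h *.
have B0 : 0 <= B by rewrite mulr_ge0 ?normc_ge0// ltW.
apply: (@le_trans _ _ (S / M.+1%:R)).
  rewrite ler_pdivlMr//; apply: le_trans h.
  by rewrite mulrC ler_wpM2r// weight_gtS.
by rewrite ler_wpM2r// ler_peMr// lerDr mulr_ge0.
Qed.

Section tempered.
Variable u : (ZT -> C) -> C.
Hypothesis tu : temperedZT u.

Lemma temp_lin (c : C) F H : schwartzZT F -> schwartzZT H ->
  u (fun z => c * F z + H z) = c * u F + u H.
Proof. exact: tu.1. Qed.

Lemma temp0 : u (fun=> 0) = 0.
Proof.
have := temp_lin 1 schwartz0 schwartz0.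
under [X in u X]eq_fun do rewrite mulr0 addr0.
by rewrite mul1r => /eqP; rewrite -subr_eq subrr => /eqP.
Qed.

Lemma tempZ (c : C) F : schwartzZT F -> u (fun z => c * F z) = c * u F.
Proof.
move=> sF; have := temp_lin c sF schwartz0.
by under [X in u X]eq_fun do rewrite addr0; rewrite temp0 addr0.
Qed.

Lemma tempB F H : schwartzZT F -> schwartzZT H ->
  u (fun z => F z - H z) = u F - u H.
Proof.
move=> sF sH; have := temp_lin (-1) sH sF.
by under [X in u X]eq_fun do rewrite mulN1r addrC; rewrite mulN1r addrC.
Qed.

Lemma temp_sum I (r : seq I) (P : pred I) (F : I -> ZT -> C) :
  (forall i, schwartzZT (F i)) ->
  u (fun z => \sum_(i <- r | P i) F i z) = \sum_(i <- r | P i) u (F i).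
Proof.
move=> sF; elim: r => [|i r ih].
  by under [X in u X]eq_fun do rewrite big_nil; rewrite big_nil temp0.
rewrite big_cons; have [Pi|/negbTE nPi] := boolP (P i); last first.
  by under [X in u X]eq_fun do rewrite big_cons nPi.
under [X in u X]eq_fun do rewrite big_cons Pi -[F i _]mul1r.
by rewrite temp_lin ?mul1r ?ih//; exact: schwartz_sum.
Qed.

Lemma temp_bound : exists N c, 0 <= c /\
  forall F S, schwartzZT F -> wbound N S F -> normc (u F) <= c * S.
Proof.
have [_ [N [c uc]]] := tu; exists N, `|c|; split => // F S sF FS.
rewrite -lee_fin; apply: le_trans (uc _ sF) _.
have s0 : (0 <= seminormZT N F)%E.
  apply: le_trans (ereal_sup_ubound _); last first.
    by exists 0, [tuple 0 | i < n], [::]; split.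
  by rewrite lee_fin mulr_ge0 ?normc_ge0// (le_trans ler01)// weightX_ge1.
rewrite EFinM; apply: (@le_trans _ _ (`|c|%:E * seminormZT N F)%E).
  by rewrite lee_wpmul2r// lee_fin ler_norm.
by rewrite lee_wpmul2l ?lee_fin// wbound_seminorm.
Qed.

(** [N] and [c] depend on [u] only, and the test function enters through [S]. This uniformity
    permits approximation under an integral over a family of test functions. *)
Lemma temp_dens : exists N c, 0 <= c /\ forall H S, schwartzZT H ->
  wbound N S H -> (normc (u H) <= c * S) /\
  forall M, normc (u H - u (dens M H)) <= c * S * M.+1%:R^-1.
Proof.
have [N [c [c0 uc]]] := temp_bound.
exists N.+1, (c * (2 * n%:R + 1)); split; first by rewrite mulr_ge0// addr_ge0// mulr_ge0.
move=> H S sH HS; have S0 := wbound_ge0 HS.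
have c1 : c <= c * (2 * n%:R + 1) by rewrite ler_peMr// lerDr mulr_ge0.
split.
  have HS' : wbound N S H.
    move=> k x s sN; apply: le_trans (HS k x s (leqW sN)).
    by rewrite ler_wpM2r ?normc_ge0// ler_weXn2l// weight_ge1.
  by apply: le_trans (uc _ _ sH HS') _; rewrite ler_wpM2r.
move=> M; rewrite -tempB//; last exact: schwartz_dens.
apply: le_trans (uc _ _ _ (dens_wbound M sH HS)) _.
  by apply: schwartzB => //; exact: schwartz_dens.
by rewrite !mulrA [c * S * _]mulrAC.
Qed.

(* the Fourier coefficient of index [- l] of the distribution [u] on {j} x T^n *)
Definition dcoef j l : C := u (bchar j l).

Lemma temp_densE M H : u (dens M H) = \sum_(j <- box M) (fnorm R n M)%:C *
  \sum_(a : {ffun 'I_n -> 'I_(fsize M)}) \sum_(b : {ffun 'I_n -> 'I_(fsize M)})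
    fc (sec H j) (vecZ a - vecZ b) * dcoef j (vecZ a - vecZ b).
Proof.
rewrite (_ : dens M H = fun z => \sum_(j <- box M) (fnorm R n M)%:C *
  \sum_(a : {ffun 'I_n -> 'I_(fsize M)}) \sum_(b : {ffun 'I_n -> 'I_(fsize M)})
    fc (sec H j) (vecZ a - vecZ b) * bchar j (vecZ a - vecZ b) z); last first.
  by apply/funext => z; exact: densE.
have s1 j c l : schwartzZT (fun z => c * bchar j l z).
  by apply: schwartz_scale; exact: schwartz_bchar.
have s2 j (a : {ffun 'I_n -> 'I_(fsize M)}) : schwartzZT (fun z =>
    \sum_(b : {ffun 'I_n -> 'I_(fsize M)})
    fc (sec H j) (vecZ a - vecZ b) * bchar j (vecZ a - vecZ b) z).
  by apply: schwartz_sum => b.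
have s3 j : schwartzZT (fun z => \sum_(a : {ffun 'I_n -> 'I_(fsize M)})
    \sum_(b : {ffun 'I_n -> 'I_(fsize M)})
    fc (sec H j) (vecZ a - vecZ b) * bchar j (vecZ a - vecZ b) z).
  by apply: schwartz_sum => a.
rewrite temp_sum; last by move=> j; exact: schwartz_scale.
apply: eq_bigr => j _; rewrite tempZ//; congr (_ * _).
rewrite temp_sum//; apply: eq_bigr => a _.
rewrite temp_sum//; apply: eq_bigr => b _.
by rewrite tempZ//; exact: schwartz_bchar.
Qed.

End tempered.
End schwartz_density.

(** * The symbol *)

Lemma le_nint_Zn (R : realType) n (F : Zn n -> R[i]) (g : Zn n -> \bar R) :
  (forall x, (normc (F x))%:E <= g x)%E ->
  (nint (@countZ R n) F <= \int[@countZ R n]_x g x)%E.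
Proof. by move=> Fg; apply: le_nint => //; exact: cmeasurable_Zn. Qed.

Lemma addl_subl (V : zmodType) (k l l' : V) : l - l' = (k + l) + (- (k + l')).
Proof. by rewrite opprD addrACA subrr add0r. Qed.

(** * Fourier coefficients of the distribution from its short-time Fourier transform *)

Section stft_coefficients.
Context (R : realType) (n : nat).
Local Notation T := (Tn R n).
Local Notation Z := (Zn n).
Local Notation ZT := (Z * T)%type.
Local Notation C := R[i].
Implicit Types (F H : ZT -> C) (j k l m : Z) (x y w xi eta : T).
Local Notation haar := (haar R n).
Local Notation cnt := (@countZ R n).

Variables (Phi : ZT -> C) (u : (ZT -> C) -> C).
Hypothesis sPhi : schwartzZT Phi.
Hypothesis tu : temperedZT u.

Definition tf m w xi k : ZT -> C := fun '(j, eta) =>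
  conjc (echar xi j * echar eta k * Phi (j - m, subT eta w)).

Local Notation V := (stft_distrZT Phi u).

Lemma tf_sec m w xi k j : sec (tf m w xi k) j = fun eta =>
  conjc (echar xi j) * (echar eta (- k) * conjc (sec Phi (j - m) (subT eta w))).
Proof. by apply/funext => eta; rewrite /sec /tf !conjcM !conj_echar mulrA. Qed.

Lemma weight_sub j m : weight R j <= weight R m * weight R (j - m).
Proof.
rewrite /weight mulrDr mulr1 mulrDl mul1r -addrA lerD2l.
apply: (@le_trans _ _ ((\sum_(i < n) `|m ord0 i|)%:~R +
  (\sum_(i < n) `|(j - m) ord0 i|)%:~R)).
  rewrite -intrD ler_int -big_split /=; apply: ler_sum => i _.
  rewrite !mxE; have := ler_normD (m ord0 i) (j ord0 i - m ord0 i).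
  by rewrite [X in `|X| <= _]addrC subrK.
by rewrite lerD2l lerDl mulr_ge0// ler0z sumr_ge0.
Qed.

Lemma sm_Phi_shift w j : sm (fun eta => conjc (sec Phi j (subT eta w))).
Proof. exact: (smJ (sm_subT w (schwartz_sm j sPhi)).1).1. Qed.

(** The bound is independent of [w] and [xi]. Translation by [m] and modulation by [k] cost powers
    of the weights; translation by [w] and the unimodular factor in [xi] cost nothing. *)
Lemma tf_wbound N S m w xi k : wbound N S Phi ->
  wbound N (weight R m ^+ N * S * (2 * pi * weight R (- k) + 1) ^+ N) (tf m w xi k).
Proof.
move=> FS j x s sN; rewrite tf_sec.
have smf := sm_Phi_shift w (j - m).
have fB : pbound N (S / weight R (j - m) ^+ N)
    (fun eta => conjc (sec Phi (j - m) (subT eta w))).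
  move=> t y tN.
  rewrite (smJ (sm_subT w (schwartz_sm (j - m) sPhi)).1).2 normc_conj.
  by rewrite (sm_subT w (schwartz_sm (j - m) sPhi)).2; exact: (wbound_pbound _ FS).
have smg := sm_echarM (- k) smf; have gB := pbound_echarM (- k) smf fB.
have := partials_lin s (conjc (echar xi j)) smg.1 (sm0 R n).1.
under [X in partials s X = _]eq_fun do rewrite addr0.
move=> -> ; rewrite (smooth0 R n).2 addr0 Normc.normcM normc_conj normc_echar mul1r.
have w0 k' : 0 < weight R k' ^+ N by rewrite (lt_le_trans ltr01)// weightX_ge1.
apply: le_trans (ler_wpM2l (ltW (w0 _)) (gB s x sN)) _.
rewrite !mulrA ler_wpM2r//.
  by rewrite exprn_ge0// addr_ge0// !mulr_ge0 ?pi_ge0// ltW// weight_gt0.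
rewrite ler_pdivrMr// mulrAC ler_wpM2r ?(wbound_ge0 FS)// -exprMn.
apply: lerXn2r; last exact: weight_sub.
  by rewrite nnegrE ltW// weight_gt0.
by rewrite nnegrE mulr_ge0// ltW// weight_gt0.
Qed.

Lemma schwartz_tf m w xi k : schwartzZT (tf m w xi k).
Proof.
apply/schwartzZTP; split=> [j|N].
  rewrite tf_sec; apply: (smZ _ _).1; apply: sm_echarM; exact: sm_Phi_shift.
have [_ bF] := (schwartzZTP Phi).1 sPhi; have [S FS] := bF N.
by eexists; exact: (tf_wbound m w xi k FS).
Qed.

Lemma fc_tf m w xi k j l : fc (sec (tf m w xi k) j) l = conjc (echar xi j) *
  (echar w (- (k + l)) * conjc (fc (sec Phi (j - m)) (- (k + l)))).
Proof.
rewrite tf_sec fcZ; last by apply: sm_bmeas; apply: sm_echarM; exact: sm_Phi_shift.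
congr (_ * _).
have := fc_subT w (- (k + l)) (sm_approx (schwartz_sm (j - m) sPhi)).
move=> /(congr1 conjc); rewrite conjcM conjcK => <-.
rewrite /fc -cintJ; last first.
  apply: hint; apply: bmeas_fc; apply: sm_bmeas.
  exact: (sm_subT w (schwartz_sm (j - m) sPhi)).1.
apply: eq_cint => x; rewrite conjcM conjcK -!conj_echar echarD !conjcM; ring.
Qed.

(** For fixed [m] and [k], V is thus a uniform limit in (w, xi) of trigonometric polynomials, with
    an explicit rate. *)
Lemma stft_bound : exists c, forall m k, exists S, [/\ 0 <= S, 0 <= c,
  forall w xi, normc (V ((m, w), (xi, k))) <= c * S &
  forall w xi M, normc (V ((m, w), (xi, k)) - u (dens M (tf m w xi k))) <=
    c * S * M.+1%:R^-1].
Proof.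
have [N [c [c0 uc]]] := temp_dens tu; exists c => m k.
have [_ bF] := (schwartzZTP Phi).1 sPhi; have [S FS] := bF N.
pose S' := weight R m ^+ N * S * (2 * pi * weight R (- k) + 1) ^+ N.
exists S'; split => //.
- exact: wbound_ge0 (tf_wbound m [tuple 0 | i < n] [tuple 0 | i < n] k FS).
- by move=> w xi; exact: (uc _ _ (schwartz_tf m w xi k) (tf_wbound m w xi k FS)).1.
- by move=> w xi M; exact: (uc _ _ (schwartz_tf m w xi k) (tf_wbound m w xi k FS)).2.
Qed.

Local Notation haar2 := (haar \x haar)%E.

Lemma bmeas_haar2 (k l : Z) : bmeas (fun z : T * T => echar z.2 k * echar z.1 l).
Proof.
split.
  apply: cmeasurableM.
    refine (cmeasurable_comp (h := fun z : T * T => z.2)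
      (F := fun w : T => echar w k) _ _); last exact: cmeasurable_echar.
    exact: measurable_snd.
  refine (cmeasurable_comp (h := fun z : T * T => z.1)
    (F := fun w : T => echar w l) _ _); last exact: cmeasurable_echar.
  exact: measurable_fst.
by exists 1 => z; rewrite Normc.normcM !normc_echar mulr1.
Qed.

Lemma hint2 (f : T * T -> C) : bmeas f -> cintegrable haar2 f.
Proof. exact: (@bmeas_integrable _ _ _ haar2). Qed.

Lemma cint2_echar k l :
  cint haar2 (fun z : T * T => echar z.2 k * echar z.1 l) = (k == 0)%:R * (l == 0)%:R.
Proof.
rewrite -(cfubini1 (hint2 (bmeas_haar2 k l))).2.
rewrite (eq_cint _ (G := fun w => (k == 0)%:R * echar w l)); last first.
  move=> w; rewrite /= cintZr ?haar_echar//.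
  by apply: hint; exact: bmeas_echar.
by rewrite cintZ ?haar_echar//; apply: hint; exact: bmeas_echar.
Qed.

Hypothesis mV : cmeasurable V.

Lemma bmeas_stft m k : bmeas (fun z : T * T => V ((m, z.1), (z.2, k))).
Proof.
split.
  refine (cmeasurable_comp (h := fun z : T * T => ((m, z.1), (z.2, k))) _ mV).
  by apply: measurable_fun_pair; apply: measurable_fun_pair.
have [c /(_ m k)[S [_ _ h _]]] := stft_bound.
by exists (c * S) => z; exact: h.
Qed.

Definition stft_mass m k : \bar R :=
  nint haar2 (fun z : T * T => V ((m, z.1), (z.2, k))).

(** A character is an eigenfunction of [fejer M] with eigenvalue [fcoef M l], so the rate follows
    from [fejer_le] and [lip_echar]. *)
Lemma fcoef_cvg M l : normc ((fcoef R M l)%:C - 1) <= 2 * weight R l * n%:R * M.+1%:R^-1.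
Proof.
pose o : T := [tuple 0 | i < n].
have h := fejer_le M o (mulr_ge0 (ler0n _ 2) (ltW (weight_gt0 R l))) (@lip_echar R n l).
rewrite [X in normc X <= _](_ : _ = ((fcoef R M l)%:C - 1) * echar o l) in h.
  by rewrite Normc.normcM normc_echar mulr1 in h.
by rewrite fejer_echar mulrBl mul1r.
Qed.

(** The approximant of V is a finite sum of products of characters in [z.1] and [z.2]; orthogonality
    keeps the terms of index [j] and frequency [l], whose total weight in the Fejer mean is
    [fcoef M l]. *)
Lemma cint_stft_dens m k j l M :
  cint haar2 (fun z : T * T => u (dens M (tf m z.1 z.2 k)) *
    (echar z.2 j * echar z.1 (k + l))) =
  (if weight R j <= M%:R then (fcoef R M l)%:C else 0) *
  (conjc (fc (sec Phi (j - m)) (- (k + l))) * dcoef u j l).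
Proof.
pose c j' l' : C := conjc (fc (sec Phi (j' - m)) (- (k + l'))) * dcoef u j' l'.
rewrite (eq_cint _ (G := fun z : T * T => \sum_(j' <- box R n M) (fnorm R n M)%:C *
  \sum_(a : {ffun 'I_n -> 'I_(fsize M)}) \sum_(b : {ffun 'I_n -> 'I_(fsize M)})
    c j' (vecZ a - vecZ b) *
    (echar z.2 (j - j') * echar z.1 (l - (vecZ a - vecZ b))))); last first.
  move=> z; rewrite (temp_densE tu) mulr_suml; apply: eq_bigr => j' _.
  rewrite -mulrA; congr (_ * _); rewrite mulr_suml; apply: eq_bigr => a _.
  rewrite mulr_suml; apply: eq_bigr => b _; rewrite fc_tf.
  set l' := vecZ a - vecZ b; rewrite /c.
  rewrite (_ : l - l' = (k + l) + (- (k + l'))); last exact: addl_subl.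
  rewrite [echar z.1 (k + l + _)]echarD echarB.
  by ring.
have b1 j' l' : bmeas (fun z : T * T =>
    c j' l' * (echar z.2 (j - j') * echar z.1 (l - l'))).
  by apply: bmeasZ; exact: bmeas_haar2.
rewrite cint_sum; last first.
  move=> j' _; apply: hint2; apply: bmeasZ; apply: bmeas_sum => a.
  by apply: bmeas_sum => b.
rewrite (eq_bigr (fun j' => (j == j')%:R * ((fcoef R M l)%:C * c j' l))); last first.
  move=> j' _; rewrite cintZ; last first.
    by apply: hint2; apply: bmeas_sum => a; apply: bmeas_sum => b.
  rewrite cint_sum; last by move=> a _; apply: hint2; apply: bmeas_sum => b.
  rewrite /fcoef rcM rc_sum mulrCA -[in RHS]mulrA; congr (_ * _).
  rewrite mulr_suml; apply: eq_bigr => a _.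
  rewrite cint_sum; last by move=> b _; exact: hint2.
  rewrite rc_sum mulr_suml; apply: eq_bigr => b _.
  rewrite cintZ; last by apply: hint2; exact: bmeas_haar2.
  rewrite cint2_echar !subr_eq0 [_ - _ == l]eq_sym (rmorph_nat (real_complex R)).
  case: (eqVneq l _) => [<-|_]; last by rewrite !mulr0 mul0r.
  by rewrite mulr1 mul1r mulrC.
by rewrite sum_box /c; case: ifP => //; rewrite mul0r.
Qed.

(* Integrating V against characters isolates one Fourier coefficient of the
   distribution times one Fourier coefficient of the window. *)
Lemma coef_le m k j l :
  ((normc (fc (sec Phi (j - m)) (- (k + l))) * normc (dcoef u j l))%:E <=
   stft_mass m k)%E.
Proof.
pose t := conjc (fc (sec Phi (j - m)) (- (k + l))) * dcoef u j l.
have bV := bmeas_stft m k; have be := bmeas_haar2 j (k + l).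
have tE : cint haar2 (fun z : T * T => V ((m, z.1), (z.2, k)) *
    (echar z.2 j * echar z.1 (k + l))) = t.
  apply/eqP; rewrite -subr_eq0; apply/eqP.
  have [c /(_ m k)[S [S0 c0 _ h]]] := stft_bound.
  apply: (@normc_small _ _ (c * S + normc t * (2 * weight R l * n%:R + weight R j))).
  move=> M.
  have bW : bmeas (fun z : T * T => u (dens M (tf m z.1 z.2 k))).
    rewrite (_ : (fun z : T * T => _) = fun z : T * T =>
      \sum_(j' <- box R n M) (fnorm R n M)%:C *
      \sum_(a : {ffun 'I_n -> 'I_(fsize M)}) \sum_(b : {ffun 'I_n -> 'I_(fsize M)})
      (conjc (fc (sec Phi (j' - m)) (- (k + (vecZ a - vecZ b)))) *
       dcoef u j' (vecZ a - vecZ b)) *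
      (echar z.2 (- j') * echar z.1 (- (k + (vecZ a - vecZ b))))); last first.
      apply/funext => z; rewrite (temp_densE tu); apply: eq_bigr => j' _.
      congr (_ * _); apply: eq_bigr => a _; apply: eq_bigr => b _.
      by rewrite fc_tf conj_echar; ring.
    apply: bmeas_sum => j'; apply: bmeasZ; apply: bmeas_sum => a.
    apply: bmeas_sum => b; apply: bmeasZ; exact: bmeas_haar2.
  have -> : cint haar2 (fun z : T * T => V ((m, z.1), (z.2, k)) *
      (echar z.2 j * echar z.1 (k + l))) - t =
    cint haar2 (fun z : T * T => (V ((m, z.1), (z.2, k)) - u (dens M (tf m z.1 z.2 k))) *
      (echar z.2 j * echar z.1 (k + l))) +
    (cint haar2 (fun z : T * T => u (dens M (tf m z.1 z.2 k)) *
      (echar z.2 j * echar z.1 (k + l))) - t).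
    rewrite addrA; congr (_ - _); rewrite -cintD; last 2 first.
    - by apply: hint2; apply: bmeasM => //; exact: bmeasB.
    - by apply: hint2; exact: bmeasM.
    by apply: eq_cint => z; rewrite -mulrDl subrK.
  apply: le_trans (normcD_le _ _) _; rewrite mulrDl; apply: lerD.
    apply: (@normc_cint_bounded _ _ _ haar2).
      by apply: bmeas_meas; apply: bmeasM => //; exact: bmeasB.
    by move=> z; rewrite !Normc.normcM !normc_echar !mulr1; exact: h.
  rewrite cint_stft_dens -/t -[X in _ - X]mul1r -mulrBl Normc.normcM mulrC.
  rewrite -[leRHS]mulrA ler_wpM2l ?normc_ge0//.
  (* If [j] lies in the ball the defect is 1 - fcoef. Otherwise the whole term [t] is lost, but then
     weight j / (M + 1) is at least 1 and accounts for it. *)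
  case: ifPn => [_|]; last rewrite -ltNge => jM.
    apply: le_trans (fcoef_cvg M l) _; rewrite ler_wpM2r// lerDl ltW//.
    exact: weight_gt0.
  rewrite sub0r normcN Normc.normc1 ler_pdivlMr// mul1r.
  apply: le_trans (weight_gtS jM) _; rewrite lerDr !mulr_ge0// ltW//.
  exact: weight_gt0.
have -> : normc (fc (sec Phi (j - m)) (- (k + l))) * normc (dcoef u j l) = normc t.
  by rewrite Normc.normcM normc_conj.
rewrite -tE; apply: le_trans (normc_cint _) _.
  by apply: hint2; exact: bmeasM.
rewrite /stft_mass /nint le_eqVlt; apply/orP; left; apply/eqP.
by apply: eq_integral => z _; rewrite !Normc.normcM !normc_echar !mulr1.
Qed.

Lemma stft_mass_ge0 m k : (0 <= stft_mass m k)%E.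
Proof. exact: nint_ge0. Qed.

(** A second grouping of the variables of V: [stft_mass] keeps the two discrete indices and serves
    the coefficient bound, [stft_slice] keeps the point (m, w) and serves the L^1 bound of the
    symbol. *)
Definition stft_slice (z : ZT) : \bar R :=
  nint (@muTZ R n) (fun y : T * Z => V (z, y)).

Lemma stft_slice_ge0 z : (0 <= stft_slice z)%E.
Proof. exact: nint_ge0. Qed.

Lemma measurable_stft_slice m :
  measurable_fun setT (fun w : T => stft_slice (m, w)).
Proof.
exact: (measurable_fun_pair2 _ (@measurable_nint1 _ _ _ _ _ (@muTZ R n) _ mV)).
Qed.

Lemma modnorm_slice :
  (modnormZT Phi 1%:E u = \int[cnt]_m \int[haar]_w stft_slice (m, w))%E.
Proof.
rewrite /modnormZT /cLnorm Lnorm1.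
under eq_integral do rewrite gee0_abs ?lee_fin ?normc_ge0//.
rewrite -[LHS]/(nint (@muZT R n \x @muTZ R n)%E V).
rewrite (@nint_prod1 _ _ _ _ _ (@muZT R n) (@muTZ R n))//.
have mg := @measurable_nint1 _ _ _ _ _ (@muTZ R n) _ mV.
exact: (@fubini_tonelli1 _ _ _ _ _ cnt haar stft_slice mg stft_slice_ge0).
Qed.

Lemma stft_sliceE m w : (stft_slice (m, w) =
  \int[cnt]_k nint haar (fun xi : T => V ((m, w), (xi, k))))%E.
Proof.
have ms : cmeasurable (fun z : T * Z => V ((m, w), (z.1, z.2))).
  refine (cmeasurable_comp (h := fun z : T * Z => ((m, w), (z.1, z.2))) _ mV).
  by apply: measurable_fun_pair; apply: measurable_fun_pair.
rewrite -(@nint_prod2 _ _ _ _ _ haar cnt _ ms).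
rewrite -[LHS]/(nint (haar \x cnt)%E (fun y : T * Z => V ((m, w), y))).
by congr (nint _ _); apply/funext => -[].
Qed.

Lemma modnorm_mass :
  (modnormZT Phi 1%:E u = \int[cnt]_m \int[cnt]_k stft_mass m k)%E.
Proof.
rewrite modnorm_slice; apply: eq_integral => m _.
under eq_integral do rewrite stft_sliceE.
have mh : cmeasurable (fun z : (T * Z) * T => V ((m, z.1.1), (z.2, z.1.2))).
  refine (cmeasurable_comp (h := fun z : (T * Z) * T =>
    ((m, z.1.1), (z.2, z.1.2))) _ mV).
  apply: measurable_fun_pair; apply: measurable_fun_pair => //.
    exact: (measurableT_comp measurable_fst measurable_fst).
  exact: (measurableT_comp measurable_snd measurable_fst).
rewrite (@fubini_tonelli _ _ _ _ _ haar cnt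
  (fun z : T * Z => nint haar (fun xi => V ((m, z.1), (xi, z.2))))); last 2 first.
- exact: (@measurable_nint1 _ _ _ _ _ haar _ mh).
- by move=> z; exact: nint_ge0.
apply: eq_integral => k _; rewrite /stft_mass.
by rewrite (@nint_prod1 _ _ _ _ _ haar haar _ (bmeas_meas (bmeas_stft m k))).
Qed.

(** If all coefficients on the slice [j] vanished, so would every [dens M Phi] there, and these
    converge to [Phi]. *)
Lemma fc_Phi_neq0 : (exists z, Phi z <> 0) -> exists j l, fc (sec Phi j) l != 0.
Proof.
move=> [[j x] Phi0]; apply/not_existsP => h.
have fc0 l : fc (sec Phi j) l = 0.
  apply/eqP/negPn/negP => fl; apply: (h j); by exists l.
apply: Phi0; have [_ bF] := (schwartzZTP Phi).1 sPhi; have [S FS] := bF 1%N.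
apply: (@normc_small _ _ (S * (2 * n%:R + 1))) => M.
have := @dens_wbound R n 0 S Phi M sPhi FS j x [::] isT.
rewrite expr0 mul1r /= /sec /dens /=.
rewrite [X in normc (_ - X)](_ : _ = 0) ?subr0//.
case: ifP => // _; rewrite /fejer big1 ?mulr0// => a _; rewrite big1// => b _.
by rewrite [X in X * _]fc0 mul0r.
Qed.

(** In [coef_le] the choice m = j - j0, k = - l0 - l keeps the coefficient of the window fixed while
    [j] and [l] vary. Both substitutions are bijections, so the masses add up to the full norm. *)
Lemma dcoef_l1 j0 l0 : ((normc (fc (sec Phi j0) l0))%:E *
  \int[cnt]_j \int[cnt]_l (normc (dcoef u j l))%:E <= modnormZT Phi 1%:E u)%E.
Proof.
rewrite modnorm_mass.
rewrite -(ge0_reindex_Zn (f := fun m => (\int[cnt]_k stft_mass m k)%E)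
  (bij_sub j0)); last first.
  by move=> m; apply: integral_ge0 => k _; exact: stft_mass_ge0.
rewrite -ge0_integralZl_EFin ?normc_ge0//; last first.
  by move=> j _; apply: integral_ge0 => l _; rewrite lee_fin normc_ge0.
apply: ge0_le_integral => //.
- move=> j _; rewrite mule_ge0 ?lee_fin ?normc_ge0//.
  by apply: integral_ge0 => l _; rewrite lee_fin normc_ge0.
move=> j _; rewrite -ge0_integralZl_EFin ?normc_ge0//; last first.
  by move=> l _; rewrite lee_fin normc_ge0.
rewrite -(ge0_reindex_Zn (f := stft_mass (j - j0)) (bij_rsub (- l0))); last first.
  by move=> k; exact: stft_mass_ge0.
apply: ge0_le_integral => //.
- by move=> l _; rewrite mule_ge0 ?lee_fin ?normc_ge0.
move=> l _; have := coef_le (j - j0) (- l0 - l) j l.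
by rewrite subKr subrK opprK EFinM.
Qed.

End stft_coefficients.

(** * Absolutely convergent Fourier series *)

Section absolutely_convergent.
Context (R : realType) (n : nat).
Local Notation T := (Tn R n).
Local Notation Z := (Zn n).
Local Notation C := R[i].
Implicit Types (c : Z -> C) (j k l m : Z) (x y w xi eta : T).
Local Notation haar := (haar R n).
Local Notation cnt := (@countZ R n).

(** Conjugate characters, because [dcoef u j l] is the Fourier coefficient of index [- l]. *)
Definition wser c (eta : T) : C := cint cnt (fun l => c l * conjc (echar eta l)).

Lemma nint_char c eta : nint cnt (fun l => c l * conjc (echar eta l)) = nint cnt c.
Proof.
by apply: eq_integral => l _; rewrite Normc.normcM normc_conj normc_echar mulr1.
Qed.

Variable c : Z -> C.
Hypothesis coo : (nint cnt c < +oo)%E.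

Lemma wser_integrable eta : cintegrable cnt (fun l => c l * conjc (echar eta l)).
Proof. by apply: cintegrable_Zn; rewrite nint_char. Qed.

Lemma wser_le eta : ((normc (wser c eta))%:E <= nint cnt c)%E.
Proof. by rewrite -(nint_char c eta); exact: normc_cint (wser_integrable eta). Qed.

Lemma nint_fineK : (fine (nint cnt c))%:E = nint cnt c.
Proof.
by rewrite fineK// fin_numElt coo andbT (lt_le_trans (ltNyr 0))// nint_ge0.
Qed.

Lemma wser_leR eta : normc (wser c eta) <= fine (nint cnt c).
Proof. by rewrite -lee_fin nint_fineK wser_le. Qed.

Lemma cmeasurable_wser_prod (f : T -> C) : cmeasurable f ->
  cmeasurable (fun z : T * Z => c z.2 * conjc (echar z.1 z.2) * f z.1).
Proof.
move=> mf; apply: cmeasurable_XZn => l /=; apply: cmeasurableM => //.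
apply: cmeasurableM; first exact: cmeasurable_cst.
by apply: cmeasurableJ; exact: cmeasurable_echar.
Qed.

Lemma cmeasurable_wser : cmeasurable (wser c).
Proof.
have := @cmeasurable_cint1 _ _ _ _ _ cnt _
  (cmeasurable_wser_prod (cmeasurable_cst T 1)).
by apply: eq_cmeasurable => eta; apply: eq_cint => l /=; rewrite mulr1.
Qed.

Lemma wser_bmeas : bmeas (wser c).
Proof.
by split; [exact: cmeasurable_wser|exists (fine (nint cnt c)); exact: wser_leR].
Qed.

Lemma wser_coef l : cint haar (fun eta => wser c eta * echar eta l) = c l.
Proof.
pose F (z : T * Z) := c z.2 * conjc (echar z.1 z.2) * echar z.1 l.
have mF : cmeasurable F := cmeasurable_wser_prod (cmeasurable_echar R l).
have iF : cintegrable (haar \x cnt)%E F.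
  apply: cintegrable_prod => //.
  rewrite (eq_integral (cst (nint cnt c))).
    by rewrite integral_cst// measure_prob_setT mule1.
  move=> eta _; apply: eq_integral => k _.
  by rewrite !Normc.normcM normc_conj !normc_echar !mulr1.
transitivity (cint haar (fun eta => cint cnt (fun l' => F (eta, l')))).
  apply: eq_cint => eta; rewrite -cintZr//; exact: wser_integrable.
rewrite (cfubini iF) (@cint_Zn_supp1 _ _ _ l).
  rewrite -[RHS]mulr1 -[in RHS](cint_cst_prob haar 1) -cintZ; last first.
    by apply: hint; exact: bmeas_cst.
  apply: eq_cint => eta; rewrite /F /= -mulrA [_^*%C * _]mulrC mulcJ normc_echar.
  by rewrite expr1n.
move=> l' l'l; rewrite /F /=.
transitivity (c l' * cint haar (fun eta => echar eta (l - l'))).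
  rewrite -cintZ; last by apply: hint; exact: bmeas_echar.
  by apply: eq_cint => eta; rewrite echarB -mulrA [_^*%C * _]mulrC.
by rewrite haar_echar subr_eq0 eq_sym (negbTE l'l) mulr0.
Qed.

(** The part of the series over the ball of radius [M] is Lipschitz, as its characters have constant
    at most 2 M, and the tail is small uniformly in [eta]. *)
Lemma wser_approx : approx (wser c).
Proof.
move=> e e0.
have [M hM] := integral_tail (f := fun k => normc (c k))
  (fun k => normc_ge0 (c k)) coo e0.
pose cM l := if weight R l <= M%:R then c l else 0.
have cMle l : normc (cM l) <= normc (c l).
  by rewrite /cM; case: ifP => // _; rewrite Normc.normc0 normc_ge0.
have iM eta : cintegrable cnt (fun l => cM l * conjc (echar eta l)).
  apply: (cintegrable_dom _ (wser_integrable eta)); first exact: cmeasurable_Zn.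
  by move=> l; rewrite !Normc.normcM ler_wpM2r// normc_ge0.
pose q eta := wser cM eta.
pose S := fine (nint cnt c).
have S0 : 0 <= S by rewrite fine_ge0// nint_ge0.
exists (2 * M%:R * S), q; split; first by rewrite !mulr_ge0.
- move=> x i t; rewrite /q /wser -cintB//.
  rewrite -lee_fin; apply: le_trans (normc_cint _) _; first exact: cintegrableB.
  apply: (@le_trans _ _
     (\int[cnt]_l ((2 * M%:R * `|sin (pi * t)|)%:E * (normc (c l))%:E))%E).
    apply: le_nint_Zn.
    move=> l; rewrite -mulrBr -conjcB Normc.normcM normc_conj -EFinM lee_fin.
    rewrite mulrC /cM; case: ifP => lM; last first.
      by rewrite Normc.normc0 mulr0 mulr_ge0 ?normc_ge0// !mulr_ge0.
    rewrite ler_wpM2r ?normc_ge0//; apply: le_trans (lip_echar l x i t) _.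
    by rewrite ler_wpM2r// ler_wpM2l.
  rewrite ge0_integralZl_EFin// ?mulr_ge0//; last first.
    by move=> l _; rewrite lee_fin normc_ge0.
  by rewrite -[X in (_ * X)%E]/(nint cnt c) -nint_fineK -EFinM lee_fin mulrAC.
move=> eta; rewrite /q /wser -cintB//; last exact: wser_integrable.
rewrite -lee_fin; apply: le_trans (normc_cint _) _.
  by apply: cintegrableB => //; exact: wser_integrable.
apply: le_trans (ltW hM); apply: le_nint_Zn.
move=> l; rewrite -mulrBl Normc.normcM normc_conj normc_echar mulr1 lee_fin /cM.
by case: ifP => _; rewrite ?subr0// subrr Normc.normc0.
Qed.

Lemma wser_periodic : Defs.periodic (wser c).
Proof.
move=> x i; apply: eq_cint => l; congr (_ * conjc _).
exact: echar_periodic.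
Qed.

End absolutely_convergent.

(** * The symbol as a function and its L^1 norm *)

Section symbol.
Context (R : realType) (n : nat).
Local Notation T := (Tn R n).
Local Notation Z := (Zn n).
Local Notation ZT := (Z * T)%type.
Local Notation C := R[i].
Implicit Types (F H : ZT -> C) (j k l m : Z) (x y w xi eta : T).
Local Notation haar := (haar R n).
Local Notation cnt := (@countZ R n).
Local Notation muZT := (@muZT R n).

Variables (Phi : ZT -> C) (u : (ZT -> C) -> C).
Hypothesis sPhi : schwartzZT Phi.
Hypothesis Phi0 : exists z, Phi z <> 0.
Hypothesis mu : modZT Phi 1%:E u.

Let tu : temperedZT u. Proof. exact: mu.1. Qed.
Let mV : cmeasurable (stft_distrZT Phi u). Proof. exact: mu.2.1. Qed.
Let moo : (modnormZT Phi 1%:E u < +oo)%E. Proof. exact: mu.2.2. Qed.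

Definition symbol : ZT -> C := fun z => wser (dcoef u z.1) z.2.

Lemma dcoef_sum_lty : (\int[cnt]_j nint cnt (dcoef u j) < +oo)%E.
Proof.
have [j0 [l0 h]] := fc_Phi_neq0 sPhi Phi0.
have p0 : 0 < normc (fc (sec Phi j0) l0) by rewrite normc_gt0.
have := le_lt_trans (dcoef_l1 sPhi tu mV j0 l0) moo.
rewrite -[X in (_ * X)%E]/(\int[cnt]_j nint cnt (dcoef u j))%E.
have : (0 <= \int[cnt]_j nint cnt (dcoef u j))%E.
  by apply: integral_ge0 => j _; exact: nint_ge0.
case: (\int[cnt]_j _)%E => //.
  by move=> r _ _; rewrite ltry.
by rewrite mulry gtr0_sg// mul1e.
Qed.

Lemma dcoef_lty j : (nint cnt (dcoef u j) < +oo)%E.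
Proof.
apply: le_lt_trans dcoef_sum_lty.
by apply: (integral_Zn_ge (f := fun j => nint cnt (dcoef u j))) => k; exact: nint_ge0.
Qed.

Lemma cmeasurable_symbol : cmeasurable symbol.
Proof.
apply: cmeasurable_ZnX => j; rewrite /symbol /=.
have := cmeasurable_wser (dcoef u j).
exact.
Qed.

Lemma nint_symbol_prod : nint muZT symbol = (\int[cnt]_j nint haar (wser (dcoef u j)))%E.
Proof. exact: (@nint_prod1 _ _ _ _ _ cnt haar symbol cmeasurable_symbol). Qed.

Lemma symbol_integrable : cintegrable muZT symbol.
Proof.
apply/cintegrableP; split; first exact: cmeasurable_symbol.
rewrite nint_symbol_prod; apply: le_lt_trans dcoef_sum_lty.
apply: ge0_le_integral => //; first by move=> j _; exact: nint_ge0.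
move=> j _; rewrite -(nint_fineK (dcoef_lty j)); apply: nint_bounded.
  exact: cmeasurable_wser.
exact: (wser_leR (dcoef_lty j)).
Qed.

Lemma symbolM_integrable F (B : R) : cmeasurable F ->
  (forall z, normc (F z) <= B) -> cintegrable muZT (fun z => symbol z * F z).
Proof.
move=> mF FB; have B0 : 0 <= B.
  by apply: le_trans (FB (0, [tuple 0 | i < n])); exact: normc_ge0.
apply: (cintegrable_dom _ (cintegrableZ B%:C symbol_integrable)).
  by apply: cmeasurableM => //; exact: cmeasurable_symbol.
move=> z; rewrite !Normc.normcM (ge0_normc_real B0) mulrC.
by rewrite ler_wpM2r// normc_ge0.
Qed.

Lemma schwartz_meas H : schwartzZT H -> cmeasurable H.
Proof.
by move=> sH; apply: cmeasurable_ZnX => k; exact: (bmeas_meas (sm_bmeas (schwartz_sm k sH))).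
Qed.

Lemma wbound0_le S H : wbound 0 S H -> forall z, normc (H z) <= S.
Proof. by move=> HS [k x]; have := @HS k x [::] isT; rewrite expr0 mul1r. Qed.

Lemma schwartz_bounded H : schwartzZT H -> exists B, forall z, normc (H z) <= B.
Proof.
by move=> /schwartzZTP[_ /(_ 0%N)[S HS]]; exists S; exact: wbound0_le.
Qed.

Lemma symbolS_integrable H : schwartzZT H ->
  cintegrable muZT (fun z => symbol z * H z).
Proof.
move=> sH; have [B HB] := schwartz_bounded sH.
exact: symbolM_integrable (schwartz_meas sH) HB.
Qed.

Lemma cint_muZT F : cintegrable muZT F ->
  cintegrable cnt (fun j => cint haar (fun x => F (j, x))) /\
  cint muZT F = cint cnt (fun j => cint haar (fun x => F (j, x))).
Proof.
move=> iF; have [h1 h2] := @cfubini1 _ _ _ _ _ cnt haar F iF.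
by split => //; rewrite -h2.
Qed.

Lemma symbol_bchar j l : cint muZT (fun z => symbol z * bchar j l z) = dcoef u j l.
Proof.
rewrite (cint_muZT (symbolS_integrable (schwartz_bchar R j l))).2.
rewrite (@cint_Zn_supp1 _ _ _ j).
  rewrite -[RHS](wser_coef (dcoef_lty j)); apply: eq_cint => x.
  by rewrite /bchar /dirac_fun /= eqxx mul1r.
move=> k /negbTE kj; rewrite -[RHS](cint0 haar); apply: eq_cint => x.
by rewrite /bchar /dirac_fun /= kj mul0r mulr0.
Qed.

Lemma symbol_dens M H : cint muZT (fun z => symbol z * dens M H z) = u (dens M H).
Proof.
rewrite (temp_densE tu).
rewrite (eq_cint _ (G := fun z => \sum_(j <- box R n M) (fnorm R n M)%:C *
  \sum_(a : {ffun 'I_n -> 'I_(fsize M)}) \sum_(b : {ffun 'I_n -> 'I_(fsize M)})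
    fc (sec H j) (vecZ a - vecZ b) * (symbol z * bchar j (vecZ a - vecZ b) z))); last first.
  move=> z; rewrite densE mulr_sumr; apply: eq_bigr => j _.
  rewrite mulrCA; congr (_ * _); rewrite mulr_sumr; apply: eq_bigr => a _.
  by rewrite mulr_sumr; apply: eq_bigr => b _; rewrite mulrCA.
have i1 j l : cintegrable muZT (fun z => fc (sec H j) l * (symbol z * bchar j l z)).
  by apply: cintegrableZ; apply: symbolS_integrable; exact: schwartz_bchar.
rewrite cint_sum; last first.
  move=> j _; apply: cintegrableZ; apply: cintegrable_sum => a _.
  by apply: cintegrable_sum.
apply: eq_bigr => j _; rewrite cintZ; last first.
  by apply: cintegrable_sum => a _; apply: cintegrable_sum.
congr (_ * _); rewrite cint_sum; last by move=> a _; apply: cintegrable_sum.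
apply: eq_bigr => a _; rewrite cint_sum; last by move=> b _.
apply: eq_bigr => b _; rewrite cintZ ?symbol_bchar//.
by apply: symbolS_integrable; exact: schwartz_bchar.
Qed.

(** Both sides agree on [dens M H] by [symbol_dens], and both change little when it is replaced by
    [H]: [u] by temperedness, the integral because [symbol] is integrable and the error is small in
    sup norm. *)
Lemma represents_symbol : represents u symbol.
Proof.
split.
- exact: cmeasurable_symbol.
- by move=> k; have := wser_periodic (dcoef u k); exact.
move=> H sH; split; first exact: symbolS_integrable.
have [N [c [c0 uc]]] := temp_dens tu.
have [_ bH] := (schwartzZTP H).1 sH.
have [S HS] := bH N; have [S1 HS1] := bH 1%N.
pose I := fine (nint muZT symbol).
have IE : I%:E = nint muZT symbol.
  rewrite fineK// fin_numElt (cintegrable_nint symbol_integrable) andbT.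
  by rewrite (lt_le_trans (ltNyr 0))// nint_ge0.
apply/eqP; rewrite -subr_eq0; apply/eqP.
apply: (@normc_small _ _ (c * S + S1 * (2 * n%:R + 1) * I)) => M.
rewrite -[_ - _](subrKA (u (dens M H))).
apply: le_trans (normcD_le _ _) _; rewrite mulrDl; apply: lerD.
  exact: (uc _ _ sH HS).2.
rewrite -symbol_dens -cintB; [|exact: symbolS_integrable (schwartz_dens M H)|
  exact: symbolS_integrable].
have hb := wbound0_le (dens_wbound M sH HS1).
set e := S1 * (2 * n%:R + 1) / M.+1%:R in hb.
have -> : S1 * (2 * n%:R + 1) * I / M.+1%:R = e * I by rewrite /e mulrAC.
rewrite -lee_fin EFinM IE; apply: le_trans (normc_cint _) _.
  apply: cintegrableB; [exact: symbolS_integrable (schwartz_dens M H)|].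
  exact: symbolS_integrable.
rewrite -ge0_integralZl_EFin//; last 3 first.
- by move=> z _; rewrite lee_fin normc_ge0.
- exact: (measurable_enormc cmeasurable_symbol).
- by apply: le_trans (hb (0, [tuple 0 | i < n])); exact: normc_ge0.
apply: le_nint.
- apply: cmeasurableB.
    exact: (cintegrable_meas (symbolS_integrable (schwartz_dens M H))).
  exact: (cintegrable_meas (symbolS_integrable sH)).
- apply: measurable_funeM; exact: (measurable_enormc cmeasurable_symbol).
move=> z; rewrite -mulrBr Normc.normcM -EFinM lee_fin mulrC.
by rewrite ler_wpM2r ?normc_ge0// normcBC hb.
Qed.

(** In the variable [xi] alone, V is the absolutely convergent series [wser b], where [b j] is the
    right-hand side; the integral recovers its coefficient. *)
Lemma symbol_coef m w k j : cint haar (fun xi =>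
    stft_distrZT Phi u ((m, w), (xi, k)) * echar xi j) =
  fc (fun eta => symbol (j, eta) * conjc (sec Phi (j - m) (subT eta w))) k.
Proof.
have [_ _ ru] := represents_symbol.
pose b j' := fc (fun eta => symbol (j', eta) * conjc (sec Phi (j' - m) (subT eta w))) k.
have tfE xi j' eta : symbol (j', eta) * tf Phi m w xi k (j', eta) =
    (symbol (j', eta) * conjc (sec Phi (j' - m) (subT eta w)) * conjc (echar eta k)) *
    conjc (echar xi j').
  by rewrite /tf /sec !conjcM; ring.
have bi j' : bmeas (fun eta => symbol (j', eta) *
    conjc (sec Phi (j' - m) (subT eta w)) * conjc (echar eta k)).
  apply: bmeas_fc; apply: bmeasM; first exact: (wser_bmeas (dcoef_lty j')).
  exact: sm_bmeas (sm_Phi_shift sPhi w (j' - m)).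
have VE xi : stft_distrZT Phi u ((m, w), (xi, k)) = wser b xi.
  have [h1 h2] := ru _ (schwartz_tf sPhi m w xi k).
  rewrite [LHS]h2 (cint_muZT h1).2; apply: eq_cint => j'.
  rewrite /b /fc -cintZr; last exact: hint.
  by apply: eq_cint => eta; rewrite tfE.
(* A change of [xi] multiplies each term by a unimodular number, so summability at the one point
   [o], given by Fubini, is enough. *)
have boo : (nint cnt b < +oo)%E.
  pose o : T := [tuple 0 | i < n].
  have [h1 _] := ru _ (schwartz_tf sPhi m w o k).
  have := cintegrable_nint (cint_muZT h1).1.
  rewrite -(nint_char b o); congr (_ < _)%E; apply: eq_integral => j' _.
  congr (normc _)%:E; rewrite /b /fc -cintZr; last exact: hint.
  by apply: eq_cint => eta; rewrite tfE.
rewrite -[RHS](wser_coef boo); apply: eq_cint => xi.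
by rewrite VE.
Qed.

(** The product [p] of symbol and translated window is bounded by the sum of its Fourier
    coefficients, which [symbol_coef] turns into integrals of V. Evaluation at [addT x w] undoes the
    translation, so the window factor no longer depends on [w]. *)
Lemma symbol_slice_le j0 x j w : ((normc (Phi (j0, x)) *
  normc (symbol (j, addT x w)))%:E <= stft_slice Phi u ((j - j0)%R, w))%E.
Proof.
pose p eta := symbol (j, eta) * conjc (sec Phi j0 (subT eta w)).
have ap : approx p.
  apply: approxM; first exact: (wser_approx (dcoef_lty j)).
  exact: sm_approx (sm_Phi_shift sPhi w j0).
have -> : normc (Phi (j0, x)) * normc (symbol (j, addT x w)) = normc (p (addT x w)).
  by rewrite /p Normc.normcM normc_conj subT_addT mulrC.
apply: le_trans (approx_le_fc (addT x w) ap) _.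
rewrite (stft_sliceE mV).
apply: ge0_le_integral => //; first by move=> k _; rewrite lee_fin normc_ge0.
move=> k _; have := symbol_coef (j - j0) w k j.
rewrite subKr => <-.
have bV : bmeas (fun xi => stft_distrZT Phi u ((j - j0, w), (xi, k))).
  have [bm [B hB]] := bmeas_stft sPhi tu mV (j - j0) k.
  split; last by exists B => xi; exact: (hB (w, xi)).
  exact: (cmeasurable_sec1 w bm).
apply: le_trans (normc_cint _) _.
  by apply: hint; apply: bmeasM => //; exact: bmeas_echar.
rewrite le_eqVlt; apply/orP; left; apply/eqP; apply: eq_integral => xi _.
by rewrite Normc.normcM normc_echar mulr1.
Qed.

(** [symbol_slice_le] is integrated over [w] and summed over [j]; the translations by [x] and [j0]
    disappear by invariance. *)
Lemma symbol_L1 z : ((normc (Phi z))%:E * nint muZT symbol <= modnormZT Phi 1%:E u)%E.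
Proof.
case: z => j0 x; rewrite nint_symbol_prod (modnorm_slice mV).
rewrite -(ge0_reindex_Zn (f := fun m => (\int[haar]_w stft_slice Phi u (m, w))%E)
  (bij_sub j0)); last first.
  by move=> m; apply: integral_ge0 => w _; exact: stft_slice_ge0.
rewrite -ge0_integralZl_EFin ?normc_ge0//; last by move=> j _; exact: nint_ge0.
apply: ge0_le_integral => //.
  by move=> j _; rewrite mule_ge0 ?lee_fin ?normc_ge0// nint_ge0.
move=> j _; have aj := wser_approx (dcoef_lty j).
rewrite -(nint_addT x aj).
have mj : cmeasurable (fun w => wser (dcoef u j) (addT x w)).
  exact: (bmeas_meas (approx_bmeas (approx_addT x aj))).
rewrite -ge0_integralZl_EFin ?normc_ge0//; last 2 first.
- by move=> w _; rewrite lee_fin normc_ge0.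
- exact: measurable_enormc.
apply: ge0_le_integral => //.
- by move=> w _; rewrite mule_ge0 ?lee_fin ?normc_ge0.
- by apply: measurable_funeM; exact: measurable_enormc.
- exact: measurable_stft_slice.
- by move=> w _; rewrite -EFinM; exact: symbol_slice_le.
Qed.

End symbol.

(** * Square-summable functions and the window *)

Section l2_theory.
Context (R : realType) (n : nat).
Local Notation Z := (Zn n).
Local Notation C := R[i].
Local Notation cnt := (@countZ R n).
Implicit Types (f h : Z -> C) (k : Z).

Definition sq f : \bar R := (\int[cnt]_k (normc (f k) ^+ 2)%:E)%E.

Definition nrm f : R := Num.sqrt (fine (sq f)).

Lemma sq_ge0 f : (0 <= sq f)%E.
Proof. by apply: integral_ge0 => k _; rewrite lee_fin sqr_ge0. Qed.

Lemma nrm_ge0 f : 0 <= nrm f. Proof. exact: sqrtr_ge0. Qed.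

Lemma l2normE f : l2norm f = (sq f `^ 2^-1)%E.
Proof.
rewrite /l2norm /cLnorm unlock; congr (_ `^ _)%E; apply: eq_integral => k _.
by rewrite gee0_abs ?lee_fin ?normc_ge0// poweR_EFin powR_mulrn ?normc_ge0.
Qed.

Lemma l2P f : l2 f <-> (sq f < +oo)%E.
Proof.
split=> [[_]|sf].
  rewrite -[X in (X < _)%E]/(l2norm f) l2normE.
  by apply: lty_poweRy; rewrite invr_neq0.
split; first exact: cmeasurable_Zn.
by rewrite -[X in (X < _)%E]/(l2norm f) l2normE poweR_lty.
Qed.

Lemma sqE f : l2 f -> sq f = (nrm f ^+ 2)%:E.
Proof.
move=> /l2P sf; rewrite sqr_sqrtr ?fine_ge0 ?sq_ge0// fineK//.
by rewrite fin_numElt sf (lt_le_trans (ltNyr 0))// sq_ge0.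
Qed.

Lemma l2norm_nrm f : l2 f -> l2norm f = (nrm f)%:E.
Proof.
move=> lf; rewrite l2normE sqE// poweR_EFin powR12_sqrt ?sqr_ge0//.
by rewrite sqrtr_sqr ger0_norm ?nrm_ge0.
Qed.

Lemma le_sq_nrm f (B : R) : 0 <= B -> (sq f <= (B ^+ 2)%:E)%E -> l2 f /\ nrm f <= B.
Proof.
move=> B0 sB; have lf : l2 f by apply/l2P/(le_lt_trans sB); rewrite ltry.
split=> //; move: sB; rewrite sqE// lee_fin.
by rewrite ler_sqr ?nnegrE ?nrm_ge0.
Qed.

Lemma le_sq f h : (forall k, normc (f k) <= normc (h k)) -> (sq f <= sq h)%E.
Proof.
move=> fh; apply: ge0_le_integral => //; first by move=> k _; rewrite lee_fin sqr_ge0.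
by move=> k _; rewrite lee_fin ler_sqr ?nnegrE ?normc_ge0.
Qed.

Lemma le_nrm f h : l2 h -> (forall k, normc (f k) <= normc (h k)) ->
  l2 f /\ nrm f <= nrm h.
Proof.
move=> lh fh; apply: le_sq_nrm; first exact: nrm_ge0.
by rewrite -sqE//; exact: le_sq.
Qed.

Lemma normc_le_nrm f k : l2 f -> normc (f k) <= nrm f.
Proof.
move=> lf; rewrite -(@ler_sqr R) ?nnegrE ?nrm_ge0 ?normc_ge0// -lee_fin -sqE//.
apply: (integral_Zn_ge (f := fun k => (normc (f k) ^+ 2)%:E)) => l.
by rewrite lee_fin sqr_ge0.
Qed.

Lemma l2_0 : l2 (fun _ : Z => 0 : C) /\ nrm (fun _ => 0) = 0.
Proof.
have s0 : sq (fun _ => 0) = 0%E.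
  by rewrite /sq; under eq_integral do rewrite Normc.normc0 expr0n/=; rewrite integral0.
by split; [apply/l2P; rewrite s0 ltry|rewrite /nrm s0 sqrtr0].
Qed.

Lemma l2Z (a : C) f : l2 f -> l2 (fun k => a * f k) /\
  nrm (fun k => a * f k) = normc a * nrm f.
Proof.
move=> lf; have e : sq (fun k => a * f k) = ((normc a * nrm f) ^+ 2)%:E.
  rewrite exprMn EFinM -sqE// -ge0_integralZl_EFin ?sqr_ge0//.
    by apply: eq_integral => k _; rewrite Normc.normcM exprMn EFinM.
  by move=> k _; rewrite lee_fin sqr_ge0.
have la : l2 (fun k => a * f k) by apply/l2P; rewrite e ltry.
split => //; move: e; rewrite sqE// => -[] /eqP.
by rewrite eqrXn2 ?mulr_ge0 ?nrm_ge0 ?normc_ge0// => /eqP.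
Qed.

Lemma l2D f h : l2 f -> l2 h -> l2 (fun k => f k + h k).
Proof.
move=> lf lh; apply/l2P.
apply: (@le_lt_trans _ _ (\int[cnt]_k
    (2%:E * ((normc (f k) ^+ 2)%:E + (normc (h k) ^+ 2)%:E)))%E).
  apply: ge0_le_integral => //; first by move=> k _; rewrite lee_fin sqr_ge0.
  move=> k _; rewrite -EFinD -EFinM lee_fin.
  apply: (@le_trans _ _ ((normc (f k) + normc (h k)) ^+ 2)).
    by rewrite ler_sqr ?nnegrE ?addr_ge0 ?normc_ge0// normcD_le.
  rewrite -subr_ge0 (_ : _ - _ = (normc (f k) - normc (h k)) ^+ 2) ?sqr_ge0//.
  by ring.
rewrite ge0_integralZl_EFin//; last first.
  by move=> k _; rewrite -EFinD lee_fin addr_ge0 ?sqr_ge0.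
rewrite ge0_integralD//; last 2 first.
- by move=> k _; rewrite lee_fin sqr_ge0.
- by move=> k _; rewrite lee_fin sqr_ge0.
by rewrite -/(sq f) -/(sq h) !sqE// -EFinD -EFinM ltry.
Qed.

Lemma l2_lin (a : C) f h : l2 f -> l2 h -> l2 (fun k => a * f k + h k).
Proof. by move=> lf lh; apply: l2D => //; exact: (l2Z a lf).1. Qed.

Lemma l2N f : l2 f -> l2 (fun k => - f k).
Proof.
by move=> lf; apply: (le_nrm (h := f) _ _).1 => // k; rewrite normcN.
Qed.

Lemma l2B f h : l2 f -> l2 h -> l2 (fun k => f k - h k).
Proof. by move=> lf lh; apply: l2D => //; exact: l2N. Qed.

(** Cauchy-Schwarz: a b <= (t a^2 + b^2 / t) / 2 is summed, then optimized at t = ||h|| / ||f||.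
    Vanishing norms are treated apart since [t] has to be positive. *)
Lemma nint_mul f h : l2 f -> l2 h ->
  (nint cnt (fun k => (f k * conjc (h k))%R) <= (nrm f * nrm h)%:E)%E.
Proof.
move=> lf lh.
have key (t : R) : 0 < t -> (nint cnt (fun k => (f k * conjc (h k))%R) <=
    (2^-1 * (t * nrm f ^+ 2 + t^-1 * nrm h ^+ 2))%:E)%E.
  move=> t0.
  apply: (@le_trans _ _ (\int[cnt]_k ((2^-1 * t)%:E * (normc (f k) ^+ 2)%:E +
      (2^-1 * t^-1)%:E * (normc (h k) ^+ 2)%:E))%E).
    apply: le_nint_Zn.
    move=> k; rewrite -!EFinM -EFinD lee_fin Normc.normcM normc_conj.
    move: (normc (f k)) (normc (h k)) => a b; rewrite -subr_ge0.
    rewrite (_ : _ - _ = (t * a - b) ^+ 2 / (2 * t)); last by field; rewrite gt_eqF.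
    by rewrite divr_ge0 ?sqr_ge0// mulr_ge0// ltW.
  have t2 : 0 <= 2^-1 * t by rewrite mulr_ge0// ltW.
  have t2' : 0 <= 2^-1 * t^-1 by rewrite mulr_ge0// invr_ge0 ltW.
  rewrite ge0_integralD//; last 2 first.
  - by move=> k _; rewrite -EFinM lee_fin mulr_ge0 ?sqr_ge0.
  - by move=> k _; rewrite -EFinM lee_fin mulr_ge0 ?sqr_ge0.
  rewrite !ge0_integralZl_EFin//; try by move=> k _; rewrite lee_fin sqr_ge0.
  by rewrite -/(sq f) -/(sq h) !sqE// -!EFinM -EFinD lee_fin mulrDr !mulrA.
have nint0 : (forall k, f k = 0 \/ h k = 0) ->
    nint cnt (fun k => f k * conjc (h k)) = 0%E.
  move=> fh0; rewrite /nint; apply: integral0_eq => k _.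
  by rewrite Normc.normcM normc_conj; case: (fh0 k) => ->; rewrite Normc.normc0 ?mulr0 ?mul0r.
have nrm0 f' : l2 f' -> nrm f' = 0 -> forall k, f' k = 0.
  move=> lf' f0 k; apply/eqP; rewrite -normc_eq0 eq_le normc_ge0 andbT -f0.
  exact: normc_le_nrm.
have := nrm_ge0 f; rewrite le_eqVlt => /predU1P[/esym f0|f0].
  by rewrite nint0 ?f0 ?mul0r// => k; left; exact: nrm0.
have := nrm_ge0 h; rewrite le_eqVlt => /predU1P[/esym h0|h0].
  by rewrite nint0 ?h0 ?mulr0// => k; right; exact: nrm0.
apply: le_trans (key (nrm h / nrm f) _) _; first by rewrite divr_gt0.
rewrite lee_fin le_eqVlt; apply/orP; left; apply/eqP; field.
by rewrite !gt_eqF.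
Qed.

Lemma inner_integrable f h : l2 f -> l2 h ->
  cintegrable cnt (fun k => f k * conjc (h k)).
Proof.
by move=> lf lh; apply/cintegrable_Zn/(le_lt_trans (nint_mul lf lh)); rewrite ltry.
Qed.

Lemma normc_inner f h : l2 f -> l2 h -> normc (inner f h) <= nrm f * nrm h.
Proof.
move=> lf lh; rewrite -lee_fin; apply: le_trans (nint_mul lf lh).
exact: normc_cint (inner_integrable lf lh).
Qed.

Lemma innerC f h : l2 f -> l2 h -> conjc (inner f h) = inner h f.
Proof.
move=> lf lh; rewrite /inner -cintJ; last exact: inner_integrable.
by apply: eq_cint => k; rewrite conjcM conjcK mulrC.
Qed.

Lemma innerZl (a : C) f h : l2 f -> l2 h ->
  inner (fun k => a * f k) h = a * inner f h.
Proof.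
move=> lf lh; rewrite /inner -cintZ; last exact: inner_integrable.
by apply: eq_cint => k; rewrite mulrA.
Qed.

Lemma innerZr (a : C) f h : l2 f -> l2 h ->
  inner f (fun k => a * h k) = conjc a * inner f h.
Proof.
move=> lf lh; rewrite /inner -cintZ; last exact: inner_integrable.
by apply: eq_cint => k; rewrite conjcM mulrCA.
Qed.

Lemma innerDl f f' h : l2 f -> l2 f' -> l2 h ->
  inner (fun k => f k + f' k) h = inner f h + inner f' h.
Proof.
move=> lf lf' lh; rewrite /inner -cintD; try exact: inner_integrable.
by apply: eq_cint => k; rewrite mulrDl.
Qed.

Lemma innerDr f h h' : l2 f -> l2 h -> l2 h' ->
  inner f (fun k => h k + h' k) = inner f h + inner f h'.
Proof.
move=> lf lh lh'; rewrite /inner -cintD; try exact: inner_integrable.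
by apply: eq_cint => k; rewrite conjcD mulrDr.
Qed.

Lemma innerBl f f' h : l2 f -> l2 f' -> l2 h ->
  inner (fun k => f k - f' k) h = inner f h - inner f' h.
Proof.
move=> lf lf' lh; rewrite /inner -cintB; try exact: inner_integrable.
by apply: eq_cint => k; rewrite mulrBl.
Qed.

Lemma innerBr f h h' : l2 f -> l2 h -> l2 h' ->
  inner f (fun k => h k - h' k) = inner f h - inner f h'.
Proof.
move=> lf lh lh'; rewrite /inner -cintB; try exact: inner_integrable.
by apply: eq_cint => k; rewrite conjcB mulrBr.
Qed.

Lemma inner_self f : l2 f -> inner f f = (nrm f ^+ 2)%:C.
Proof.
move=> lf; rewrite /inner (eq_cint _ (G := fun k => (normc (f k) ^+ 2)%:C)); last first.
  by move=> k; exact: mulcJ.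
by rewrite cint_real /Rintegral -/(sq f) sqE.
Qed.

Lemma nrmD_sqr f h : l2 f -> l2 h ->
  nrm (fun k => f k + h k) ^+ 2 = nrm f ^+ 2 + 2 * Re (inner f h) + nrm h ^+ 2.
Proof.
move=> lf lh; have lfh := l2D lf lh.
have e : (nrm (fun k => f k + h k) ^+ 2)%:C =
    inner f f + inner f h + (conjc (inner f h) + inner h h).
  by rewrite -inner_self// innerDl// !innerDr// innerC.
have := congr1 (@Re R) e; rewrite !inner_self// !ReD Re_conj /= => ->.
by ring.
Qed.

Lemma nrmD f h : l2 f -> l2 h -> nrm (fun k => f k + h k) <= nrm f + nrm h.
Proof.
move=> lf lh; rewrite -(@ler_sqr R) ?nnegrE ?addr_ge0 ?nrm_ge0// nrmD_sqr//.
have : Re (inner f h) <= nrm f * nrm h.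
  apply: le_trans (normc_inner lf lh); apply: le_trans (normRe_le _).
  exact: ler_norm.
move: (nrm f) (nrm h) (Re _) => a b c cab.
have -> : (a + b) ^+ 2 = a ^+ 2 + 2 * (a * b) + b ^+ 2 by ring.
by rewrite lerD2r lerD2l ler_wpM2l.
Qed.

Lemma nrmN f : nrm (fun k => - f k) = nrm f.
Proof.
by congr (Num.sqrt (fine _)); apply: eq_integral => k _; rewrite normcN.
Qed.

Lemma nrmB f h : l2 f -> l2 h -> nrm (fun k => f k - h k) <= nrm f + nrm h.
Proof. by move=> lf lh; rewrite -(nrmN h); apply: nrmD => //; exact: l2N. Qed.

(** Each value is at most [B], so the sum of the squares is at most [B] times the l^1 norm. *)
Lemma nrm_le_nint f (B : R) : (nint cnt f <= B%:E)%E -> l2 f /\ nrm f <= B.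
Proof.
move=> fB.
have fkB k : normc (f k) <= B.
  rewrite -lee_fin; apply: le_trans fB.
  by apply: (integral_Zn_ge (f := fun k => (normc (f k))%:E)) => l; rewrite lee_fin normc_ge0.
have B0 : 0 <= B := le_trans (normc_ge0 _) (fkB 0).
apply: le_sq_nrm => //.
apply: (@le_trans _ _ (\int[cnt]_k (B%:E * (normc (f k))%:E))%E).
  apply: ge0_le_integral => //; first by move=> k _; rewrite lee_fin sqr_ge0.
  by move=> k _; rewrite -EFinM lee_fin expr2 ler_wpM2r ?normc_ge0.
rewrite ge0_integralZl_EFin//; last by move=> k _; rewrite lee_fin normc_ge0.
by rewrite expr2 EFinM lee_wpmul2l ?lee_fin.
Qed.

Lemma fatou_l2 (F_ : nat -> Z -> C) f (B : R) : 0 <= B ->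
  (forall m, l2 (F_ m)) -> (\forall m \near \oo, nrm (F_ m) <= B) ->
  (forall k, (fun m => normc (F_ m k - f k)) @ \oo --> (0 : R)) ->
  l2 f /\ nrm f <= B.
Proof.
move=> B0 lF FB F0; apply: le_sq_nrm => //.
have Ff k : (fun m => normc (F_ m k)) @ \oo --> normc (f k).
  apply/cvgrPdist_le => e e0; move/cvgrPdist_le : (F0 k) => /(_ e e0).
  apply: filterS => m; rewrite sub0r normrN ger0_norm ?normc_ge0//.
  by apply: le_trans; rewrite distrC normc_dist.
have h := @fatou _ _ _ cnt setT measurableT
  (fun m k => (normc (F_ m k) ^+ 2)%:E) (fun m => measurable_fun_Zn _)
  (fun m k _ => _).
apply: (@le_trans _ _ (\int[cnt]_k limn_einf (fun m => (normc (F_ m k) ^+ 2)%:E))%E).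
  rewrite le_eqVlt; apply/orP; left; apply/eqP; apply: eq_integral => k _.
  apply/esym; apply: (cvg_limn_einf_sup _).1; apply: cvg_EFin.
    by apply: nearW.
  by rewrite expr2; apply: cvgM.
apply: le_trans (h _) _; first by move=> m k; rewrite lee_fin sqr_ge0.
rewrite limn_einf_lim; apply: lime_le; first exact: is_cvg_einfs.
near=> m; apply: (@le_trans _ _ (sq (F_ m))).
  by apply: ereal_inf_lbound; exists m => /=.
rewrite sqE// lee_fin ler_sqr ?nnegrE ?nrm_ge0//.
by near: m.
Unshelve. all: by end_near.
Qed.

(** Completeness in the form that the square root iteration supplies: increments dominated by those
    of a bounded real sequence, which also measures the distance to the limit. *)
Lemma l2_complete (F_ : nat -> Z -> C) (y : nat -> R) (b : R) :
  (forall m, l2 (F_ m)) -> (forall i, y i <= b) ->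
  (forall i j, (i <= j)%N -> nrm (fun k => F_ j k - F_ i k) <= y j - y i) ->
  exists2 f, l2 f & forall i, nrm (fun k => f k - F_ i k) <= b - y i.
Proof.
move=> lF yb Fy.
have ymono i j : (i <= j)%N -> y i <= y j.
  by move=> ij; rewrite -subr_ge0; exact: le_trans (nrm_ge0 _) (Fy _ _ ij).
have ly : cvgn y.
  by apply: nondecreasing_is_cvgn => //; exists b => _ [i _ <-].
have cv (p : C -> R) (k : Z) : (forall x z, `|p x - p z| <= normc (x - z)) ->
    cvgn (fun m => p (F_ m k)).
  move=> pl; have pF i j : (i <= j)%N -> `|p (F_ i k) - p (F_ j k)| <= y j - y i.
    move=> ij; rewrite distrC; apply: le_trans (pl _ _) _.
    apply: le_trans (Fy _ _ ij).
    exact: (normc_le_nrm k (l2B (lF j) (lF i))).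
  (* Adding [y] makes the sequence nondecreasing and bounded, so that it converges. *)
  have -> : (fun m => p (F_ m k)) = (fun m => (p (F_ m k) + y m) - y m).
    by apply/funext => m; rewrite addrK.
  apply: is_cvgB => //; apply: nondecreasing_is_cvgn.
    by move=> i j /pF/ler_normlP[_]; lra.
  exists (p (F_ 0 k) + 2 * b - y 0) => _ [m _ <-].
  have /ler_normlP[] := pF 0 m (leq0n m); have := yb m; lra.
pose f k : C := lim ((fun m => Re (F_ m k)) @ \oo) +i* lim ((fun m => Im (F_ m k)) @ \oo).
have Ff k : (fun m => normc (F_ m k - f k)) @ \oo --> (0 : R).
  have cr : cvgn (fun m => Re (F_ m k)).
    by apply: cv => x z; rewrite -ReN -ReD normRe_le.
  have ci : cvgn (fun m => Im (F_ m k)).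
    by apply: cv => x z; rewrite -ImN -ImD normIm_le.
  apply: (@squeeze_cvgr _ _ _ _ (fun=> 0)
      (fun m => `|Re (F_ m k) - Re (f k)| + `|Im (F_ m k) - Im (f k)|)).
  - apply: nearW => m; rewrite normc_ge0 /=.
    by apply: le_trans (normc_le _) _; rewrite ReD ImD ReN ImN.
  - exact: cvg_cst.
  - rewrite -[X in _ --> X](addr0 0); apply: cvgD.
      by rewrite -(normr0 R); apply: cvg_norm; rewrite -(subrr (Re (f k))); apply: cvgB => //; exact: cvg_cst.
    by rewrite -(normr0 R); apply: cvg_norm; rewrite -(subrr (Im (f k))); apply: cvgB => //; exact: cvg_cst.
have fF i : l2 (fun k => f k - F_ i k) /\ nrm (fun k => f k - F_ i k) <= b - y i.
  apply: (@fatou_l2 (fun m k => F_ m k - F_ i k)).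
  - by rewrite subr_ge0.
  - by move=> m; exact: l2B.
  - exists i => // m /= im; apply: le_trans (Fy _ _ im) _.
    by rewrite lerD2r.
  - move=> k; under eq_fun do rewrite opprB addrA subrK; exact: Ff.
exists f; last by move=> i; exact: (fF i).2.
have := l2D (fF 0).1 (lF 0).
by congr l2; apply/funext => k; rewrite subrK.
Qed.

End l2_theory.

(** Parseval between a bounded function and an absolutely convergent series, by Fubini. *)
Lemma wser_pair (R : realType) n (c : Zn n -> R[i]) (p : Tn R n -> R[i]) :
  (nint (@countZ R n) c < +oo)%E -> bmeas p ->
  cint (haar R n) (fun w => p w * conjc (wser c w)) =
  cint (@countZ R n) (fun l => conjc (c l) *
    cint (haar R n) (fun w => p w * echar w l)).
Proof.
move=> coo bp; have [mp [B pB]] := bp.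
have B0 : 0 <= B := le_trans (normc_ge0 _) (pB [tuple 0 | i < n]).
pose F (z : Tn R n * Zn n) := conjc (c z.2) * (p z.1 * echar z.1 z.2).
have mF : cmeasurable F.
  apply: cmeasurable_XZn => l /=; apply: cmeasurableM; first exact: (cmeasurable_cst _ (conjc (c l))).
  by apply: cmeasurableM => //; exact: cmeasurable_echar.
have iF : cintegrable (haar R n \x @countZ R n)%E F.
  apply: cintegrable_prod => //.
  apply: (@le_lt_trans _ _ (\int[haar R n]_w (B%:E * nint (@countZ R n) c))%E).
    apply: ge0_le_integral => //; first by move=> w _; exact: nint_ge0.
    - exact: measurable_nint1.
    - move=> w _; rewrite /nint -ge0_integralZl_EFin//; last first.
        by move=> k _; rewrite lee_fin normc_ge0.
      apply: ge0_le_integral => //; first by move=> k _; rewrite lee_fin normc_ge0.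
      move=> k _; rewrite -EFinM lee_fin !Normc.normcM normc_conj normc_echar mulr1.
      by rewrite mulrC ler_wpM2r ?normc_ge0.
  by rewrite integral_cst// measure_prob_setT mule1 -(nint_fineK coo) -EFinM ltry.
transitivity (cint (haar R n) (fun w => cint (@countZ R n) (fun l => F (w, l)))).
  apply: eq_cint => w; rewrite /wser -cintJ; last exact: wser_integrable.
  rewrite -cintZ; last by apply: cintegrableJ; exact: wser_integrable.
  by apply: eq_cint => l; rewrite /F /= conjcM conjcK mulrCA.
rewrite (cfubini iF); apply: eq_cint => l; rewrite /F /= cintZ//.
by apply: hint; apply: bmeasM => //; exact: bmeas_echar.
Qed.

(** * The window as a function and its l^2 norm *)

Section window.
Context (R : realType) (n : nat).
Local Notation T := (Tn R n).
Local Notation Z := (Zn n).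
Local Notation C := R[i].
Implicit Types (f h : Z -> C) (j k l m : Z) (w : T).
Local Notation haar := (haar R n).
Local Notation cnt := (@countZ R n).
Local Notation muZT := (@muZT R n).

Lemma weightX_ge0 N k : 0 <= weight R k ^+ N.
Proof. by rewrite exprn_ge0// ltW// weight_gt0. Qed.

Definition zbound (N : nat) (S : R) f :=
  forall k, weight R k ^+ N * normc (f k) <= S.

Lemma zbound_seminorm N S f : zbound N S f -> (seminormZ N f <= S%:E)%E.
Proof. by move=> h; apply: ge_ereal_sup => _ [k _ <-]; rewrite lee_fin. Qed.

Lemma schwartzZP f : schwartzZ f <-> forall N, exists S, zbound N S f.
Proof.
split=> [sf N|sf N]; last first.
  by have [S /zbound_seminorm] := sf N; move/le_lt_trans; apply; rewrite ltry.
have ub k : ((weight R k ^+ N * normc (f k))%:E <= seminormZ N f)%E.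
  by apply: ereal_sup_ubound; exists k.
exists (fine (seminormZ N f)) => k; rewrite -lee_fin fineK//.
rewrite fin_numElt sf andbT; apply: lt_le_trans (ub k).
exact: ltNyr.
Qed.

Lemma schwartzZ_lin (a : C) f h : schwartzZ f -> schwartzZ h ->
  schwartzZ (fun k => a * f k + h k).
Proof.
move=> /schwartzZP sf /schwartzZP sh; apply/schwartzZP => N.
have [S fS] := sf N; have [S' hS'] := sh N.
exists (normc a * S + S') => k; apply: (@le_trans _ _
    (normc a * (weight R k ^+ N * normc (f k)) + weight R k ^+ N * normc (h k))).
  rewrite mulrCA -mulrDr ler_wpM2l ?weightX_ge0//.
  by rewrite -Normc.normcM normcD_le.
by rewrite lerD// ler_wpM2l ?normc_ge0.
Qed.

Lemma schwartzZ_delta k : schwartzZ (fun j => (j == k)%:R : C).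
Proof.
apply/schwartzZP => N; exists (weight R k ^+ N) => j.
case: eqP => [->|_]; first by rewrite Normc.normc1 mulr1.
by rewrite Normc.normc0 mulr0 weightX_ge0.
Qed.

Lemma schwartzZ0 : schwartzZ (fun _ : Z => 0 : C).
Proof.
by apply/schwartzZP => N; exists 0 => k; rewrite Normc.normc0 mulr0.
Qed.

Variable u : (Z -> C) -> C.
Hypothesis tu : temperedZ u.
Local Notation G := (funZ u).

Lemma temperedZ_sum (r : seq Z) f :
  schwartzZ (fun k => \sum_(j <- r) (k == j)%:R * f j) /\
  u (fun k => \sum_(j <- r) (k == j)%:R * f j) = \sum_(j <- r) f j * G j.
Proof.
elim: r => [|j r [sr ur]].
  have -> : (fun k => \sum_(j <- [::]) (k == j)%:R * f j) = (fun=> 0).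
    by apply/funext => k; rewrite big_nil.
  split; first exact: schwartzZ0.
  have := tu.1 1 _ _ schwartzZ0 schwartzZ0.
  under [X in u X]eq_fun do rewrite mulr0 addr0.
  by rewrite mul1r big_nil => /eqP; rewrite -subr_eq subrr => /eqP.
have -> : (fun k => \sum_(i <- j :: r) (k == i)%:R * f i) =
    (fun k => f j * (k == j)%:R + \sum_(i <- r) (k == i)%:R * f i).
  by apply/funext => k; rewrite big_cons [f j * _]mulrC.
split; first by apply: schwartzZ_lin => //; exact: schwartzZ_delta.
by rewrite tu.1// ?ur ?big_cons//; exact: schwartzZ_delta.
Qed.

(** One more power of the weight gives the rate. The radius may exceed [M], so that the ball can be
    made to contain a prescribed point for every [M], as in [stftZ_coef]. *)
Lemma temperedZ_trunc : exists (N : nat) (c : R), 0 <= c /\ forall f S,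
  schwartzZ f -> zbound N S f -> normc (u f) <= c * S /\
  forall M M' : nat, (M <= M')%N ->
    normc (u f - \sum_(j <- box R n M'.+1) f j * G j) <= c * S / M.+1%:R.
Proof.
have [N [c uc]] := tu.2; exists N.+1, (Num.max c 0).
have c0 : 0 <= Num.max c 0 by rewrite le_max lexx orbT.
have key f S : schwartzZ f -> zbound N S f -> normc (u f) <= Num.max c 0 * S.
  move=> sf fS; rewrite -lee_fin; apply: le_trans (uc _ sf) _.
  have s0 : (0 <= seminormZ N f)%E.
    apply: (@le_trans _ _ (weight R (0 : Z) ^+ N * normc (f 0))%:E).
      by rewrite lee_fin mulr_ge0 ?normc_ge0// weightX_ge0.
    by apply: ereal_sup_ubound; exists 0.
  apply: (@le_trans _ _ ((Num.max c 0)%:E * seminormZ N f)%E).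
    by rewrite lee_wpmul2r// lee_fin le_max lexx.
  by rewrite EFinM lee_wpmul2l// zbound_seminorm.
split=> // f S sf fS.
have fNS : zbound N S f.
  move=> k; apply: le_trans (fS k); rewrite ler_wpM2r ?normc_ge0//.
  by rewrite exprS ler_peMl ?weight_ge1// weightX_ge0.
split; first exact: key.
move=> M M' MM'; have [st ut] := temperedZ_sum (box R n M'.+1) f.
have -> : u f - \sum_(j <- box R n M'.+1) f j * G j =
    u (fun k => -1 * (\sum_(j <- box R n M'.+1) (k == j)%:R * f j) + f k).
  by rewrite tu.1// ut mulN1r addrC.
rewrite -mulrA; apply: key; first exact: schwartzZ_lin.
have M0 : (0 : R) < M.+1%:R by rewrite ltr0n.
move=> k; rewrite sum_box; have [kM|kM] := leP (weight R k) M'.+1%:R.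
  rewrite mulN1r addNr Normc.normc0 mulr0 divr_ge0// ?(ltW M0)//.
  apply: le_trans (fS k).
  by rewrite mulr_ge0 ?normc_ge0// weightX_ge0.
rewrite mulr0 add0r ler_pdivlMr//; apply: le_trans (fS k).
rewrite exprS -mulrA [leRHS]mulrC ler_wpM2l//.
  by rewrite mulr_ge0 ?normc_ge0// weightX_ge0.
apply: le_trans (ltW kM); rewrite ler_nat.
exact: leq_trans MM' _.
Qed.

Variable phi : Z -> C.
Hypothesis sphi : schwartzZ phi.

Local Notation V := (stft_distrZ phi u).

Definition tfZ m w k : C := conjc (echar w k * phi (k - m)).

Lemma tfZ_zbound N m : exists S, forall w, zbound N S (tfZ m w).
Proof.
have [S hS] := (schwartzZP phi).1 sphi N; exists (weight R m ^+ N * S) => w k.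
rewrite /tfZ normc_conj Normc.normcM normc_echar mul1r.
apply: (@le_trans _ _ (weight R m ^+ N * (weight R (k - m) ^+ N * normc (phi (k - m))))).
  rewrite mulrA -exprMn ler_wpM2r ?normc_ge0//.
  by rewrite lerXn2r ?nnegrE ?mulr_ge0 ?weight_sub// ltW// weight_gt0.
by rewrite ler_wpM2l// weightX_ge0.
Qed.

Lemma schwartz_tfZ m w : schwartzZ (tfZ m w).
Proof.
by apply/schwartzZP => N; have [S h] := tfZ_zbound N m; exists S; exact: h.
Qed.

Hypothesis mV : cmeasurable V.

Lemma bmeas_stftZ m : bmeas (fun w => V (m, w)).
Proof.
split; first exact: (cmeasurable_sec1 m mV).
have [N [c [c0 uc]]] := temperedZ_trunc; have [S hS] := tfZ_zbound N m.
by exists (c * S) => w; exact: (uc _ _ (schwartz_tfZ m w) (hS w)).1.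
Qed.

(** When the test function is truncated to a ball, V becomes a trigonometric polynomial in [w] and
    the identity is orthogonality of characters; the error is uniform in [w]. *)
Lemma stftZ_coef m l :
  cint haar (fun w => V (m, w) * echar w l) = G l * conjc (phi (l - m)).
Proof.
have [N [c [c0 uc]]] := temperedZ_trunc; have [S hS] := tfZ_zbound N m.
apply/eqP; rewrite -subr_eq0; apply/eqP.
apply: (@normc_small _ _ (c * S)) => M.
have [M0 lM0] : exists M0 : nat, weight R l <= M0%:R.
  exists (Num.truncn (weight R l)).+1; apply: ltW; exact: truncnS_gt.
pose M' := (M + M0)%N.
pose q w := \sum_(j <- box R n M'.+1) tfZ m w j * G j.
have bterm j : bmeas (fun w : T => conjc (echar w j) * echar w l).
  by apply: bmeasM; [apply: bmeasJ|]; exact: bmeas_echar.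
have bq : bmeas q.
  apply: bmeas_sum => j; apply: bmeasM; last exact: bmeas_cst.
  apply: bmeasJ; apply: bmeasM; [exact: bmeas_echar|exact: bmeas_cst].
have qE : cint haar (fun w => q w * echar w l) = G l * conjc (phi (l - m)).
  transitivity (cint haar (fun w => \sum_(j <- box R n M'.+1)
      G j * conjc (phi (j - m)) * (conjc (echar w j) * echar w l))).
    apply: eq_cint => w; rewrite /q mulr_suml; apply: eq_bigr => j _.
    by rewrite /tfZ conjcM; ring.
  rewrite cint_sum; last by move=> j _; apply: cintegrableZ; apply: hint.
  under eq_bigr => j _.
    rewrite cintZ; last exact: hint.
    rewrite (eq_cint _ (G := fun w => echar w (l - j))); last first.
      by move=> w; rewrite echarB mulrC.
    rewrite haar_echar subr_eq0 mulrC.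
    over.
  rewrite (sum_box M'.+1 l (fun j => G j * conjc (phi (j - m)))).
  rewrite ifT//; apply: le_trans lM0 _; rewrite ler_nat.
  by rewrite /M' ltnW// ltnS leq_addl.
rewrite -qE -cintB; [|apply: hint; apply: bmeasM; [exact: bmeas_stftZ|exact: bmeas_echar]
  |apply: hint; apply: bmeasM => //; exact: bmeas_echar].
apply: normc_cint_bounded.
  apply: cmeasurableB; apply: cmeasurableM; try exact: cmeasurable_echar.
    exact: (bmeas_meas (bmeas_stftZ m)).
  exact: (bmeas_meas bq).
move=> w; rewrite -mulrBl Normc.normcM normc_echar mulr1.
exact: ((uc _ _ (schwartz_tfZ m w) (hS w)).2 _ _ (leq_addr _ _)).
Qed.

Lemma stftZ_coef_le m l :
  ((normc (G l) * normc (phi (l - m)))%:E <= nint haar (fun w => V (m, w)))%E.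
Proof.
rewrite -(normc_conj (phi _)) -Normc.normcM -stftZ_coef.
apply: le_trans (normc_cint _) _.
  by apply: hint; apply: bmeasM; [exact: bmeas_stftZ|exact: bmeas_echar].
rewrite le_eqVlt; apply/orP; left; apply/eqP; apply: eq_integral => w _.
by rewrite Normc.normcM normc_echar mulr1.
Qed.

Lemma modnormZ_prod :
  modnormZ phi 1%:E u = (\int[cnt]_m nint haar (fun w => V (m, w)))%E.
Proof.
rewrite -[RHS](@nint_prod1 _ _ _ _ _ cnt haar V mV) /modnormZ /cLnorm Lnorm1.
by apply: eq_integral => z _; rewrite gee0_abs ?lee_fin ?normc_ge0.
Qed.

Lemma window_l1 j :
  ((normc (phi j))%:E * nint cnt G <= modnormZ phi 1%:E u)%E.
Proof.
rewrite modnormZ_prod.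
rewrite -(ge0_reindex_Zn (f := fun m => nint haar (fun w => V (m, w))) (bij_sub j)); last first.
  by move=> m; exact: nint_ge0.
rewrite -ge0_integralZl_EFin ?normc_ge0//; last by move=> l _; rewrite lee_fin normc_ge0.
apply: ge0_le_integral => //.
  by move=> l _; rewrite mule_ge0 ?lee_fin ?normc_ge0.
move=> l _; have := stftZ_coef_le (l - j) l.
by rewrite subKr -EFinM mulrC.
Qed.

(** Dual to [window_l1]: a nonzero value of G yields summability of [phi], as used in
    [window_nrm]. *)
Lemma phi_l1 k : ((normc (G k))%:E * nint cnt phi <= modnormZ phi 1%:E u)%E.
Proof.
rewrite modnormZ_prod -(nint_reindex phi (bij_rsub k)).
rewrite -ge0_integralZl_EFin ?normc_ge0//; last by move=> l _; rewrite lee_fin normc_ge0.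
apply: ge0_le_integral => //.
  by move=> l _; rewrite mule_ge0 ?lee_fin ?normc_ge0.
by move=> m _; rewrite -EFinM; exact: stftZ_coef_le.
Qed.

Hypothesis moo : (modnormZ phi 1%:E u < +oo)%E.
Hypothesis phi0 : exists k, phi k <> 0.

Lemma nint_lty_of_mul (c : R) f : 0 < c ->
  (c%:E * nint cnt f <= modnormZ phi 1%:E u)%E -> (nint cnt f < +oo)%E.
Proof.
move=> c0 /le_lt_trans/(_ moo); have := nint_ge0 cnt f.
case: (nint cnt f) => //; first by move=> r _ _; rewrite ltry.
by rewrite mulry gtr0_sg// mul1e.
Qed.

Lemma window_lty : (nint cnt G < +oo)%E.
Proof.
have [j /eqP pj] := phi0; apply: nint_lty_of_mul (window_l1 j).
by rewrite normc_gt0.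
Qed.

Lemma l2_of_l1 f : (nint cnt f < +oo)%E -> l2 f.
Proof.
move=> foo; apply: (@nrm_le_nint _ _ _ (fine (nint cnt f)) _).1.
by rewrite nint_fineK.
Qed.

Lemma nrm_shift m f : nrm (fun k => f (k - m)) = nrm f.
Proof.
congr (Num.sqrt (fine _)).
apply: (ge0_reindex_Zn (f := fun k => (normc (f k) ^+ 2)%:E) (bij_sub m)) => k.
by rewrite lee_fin sqr_ge0.
Qed.

(** Let K = ||G||_2 ||phi||_2. Summing |b m k|^2 over [k] and [m] gives K^2, while Parseval on each
    slice bounds the sum over [k] by K times the integral of |V(m, .)|; one factor K cancels. Here
    [wser (b m)], which has the same Fourier coefficients as V(m, .) and is bounded by K, stands in
    for one of the two copies of V(m, .). *)
Lemma window_nrm : (1 <= l2norm phi)%E -> ((nrm G)%:E <= modnormZ phi 1%:E u)%E.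
Proof.
have [G0|] := pselect (forall k, G k = 0).
  move=> _; have -> : G = (fun=> 0) by apply/funext.
  by rewrite (l2_0 R n).2 modnormZ_prod integral_ge0// => m _; exact: nint_ge0.
move/existsNP => [k0 /eqP Gk0] phi1.
have lG := l2_of_l1 window_lty.
have phioo : (nint cnt phi < +oo)%E.
  by apply: nint_lty_of_mul (phi_l1 k0); rewrite normc_gt0.
have lp := l2_of_l1 phioo.
have G_gt0 : 0 < nrm G.
  by apply: lt_le_trans (normc_le_nrm k0 lG); rewrite normc_gt0.
rewrite l2norm_nrm// lee_fin in phi1.
pose K := nrm G * nrm phi.
have K0 : 0 < K by rewrite mulr_gt0// (lt_le_trans ltr01).
suff : (K%:E <= modnormZ phi 1%:E u)%E.
  by apply: le_trans; rewrite lee_fin ler_peMr// ltW.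
pose b m k := G k * conjc (phi (k - m)).
have lpm m : l2 (fun k => phi (k - m)).
  by apply/l2_of_l1; rewrite (nint_reindex phi (bij_sub m)).
have boo m : (nint cnt (b m) < +oo)%E.
  apply: le_lt_trans (nint_mul lG (lpm m)) _; exact: ltry.
have lb m : l2 (b m) by exact: l2_of_l1.
have wb m w : normc (wser (b m) w) <= K.
  rewrite -lee_fin; apply: le_trans (wser_le (boo m) w) _.
  by apply: le_trans (nint_mul lG (lpm m)) _; rewrite nrm_shift.
have sqb m : (sq (b m) <= K%:E * nint haar (fun w => V (m, w)))%E.
  have bV := bmeas_stftZ m.
  have bw := bmeasJ (wser_bmeas (boo m)).
  have : cint haar (fun w => V (m, w) * conjc (wser (b m) w)) = (nrm (b m) ^+ 2)%:C.
    rewrite (wser_pair (boo m) bV) -inner_self//; apply: eq_cint => l.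
    by rewrite stftZ_coef mulrC.
  move=> /(congr1 (@Normc.normc R)); rewrite ge0_normc_real ?sqr_ge0// => e.
  rewrite sqE// -e; apply: le_trans (normc_cint _) _; first by apply: hint; exact: bmeasM.
  rewrite -ge0_integralZl_EFin//; last 3 first.
  - by move=> w _; rewrite lee_fin normc_ge0.
  - exact: measurable_enormc (bmeas_meas bV).
  - exact: ltW.
  apply: le_nint; first exact: bmeas_meas (bmeasM bV bw).
    by apply: measurable_funeM; exact: measurable_enormc (bmeas_meas bV).
  move=> w; rewrite Normc.normcM normc_conj -EFinM lee_fin mulrC.
  by rewrite ler_wpM2r ?normc_ge0.
pose F (z : Z * Z) : C := (normc (b z.1 z.2) ^+ 2)%:C.
have mF : cmeasurable F by apply: cmeasurable_ZnX => m; exact: cmeasurable_Zn.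
have FE (m k : Z) : normc (F (m, k)) = normc (b m k) ^+ 2.
  by rewrite /F ge0_normc_real// sqr_ge0.
have e1 : (\int[cnt]_m sq (b m) = (K ^+ 2)%:E)%E.
  transitivity (\int[cnt]_m nint cnt (fun k => F (m, k)))%E.
    by apply: eq_integral => m _; apply: eq_integral => k _; rewrite FE.
  rewrite -(nint_prod1 cnt cnt mF) (nint_prod2 cnt cnt mF).
  transitivity (\int[cnt]_k ((nrm phi ^+ 2)%:E * (normc (G k) ^+ 2)%:E))%E.
    apply: eq_integral => k _; rewrite -sqE//.
    rewrite /sq -(ge0_reindex_Zn (f := fun k => (normc (phi k) ^+ 2)%:E) (bij_rsub k)); last first.
      by move=> l; rewrite lee_fin sqr_ge0.
    rewrite muleC -ge0_integralZl_EFin ?sqr_ge0//; last first.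
      by move=> l _; rewrite lee_fin sqr_ge0.
    apply: eq_integral => m _.
    by rewrite FE /b Normc.normcM normc_conj exprMn EFinM.
  rewrite ge0_integralZl_EFin ?sqr_ge0//; last by move=> k _; rewrite lee_fin sqr_ge0.
  by rewrite -/(sq G) sqE// -EFinM -exprMn mulrC.
have : ((K ^+ 2)%:E <= K%:E * modnormZ phi 1%:E u)%E.
  rewrite -e1 modnormZ_prod -ge0_integralZl_EFin//; last 2 first.
  - by move=> m _; exact: nint_ge0.
  - exact: ltW.
  apply: ge0_le_integral => //.
  by move=> m _; exact: sq_ge0.
by rewrite expr2 EFinM lee_pmul2l// lte_fin.
Qed.

End window.

(** * The localization operator *)

Lemma cintegrableMb d (T : measurableType d) (R : realType)
    (mu : {measure set T -> \bar R}) (s F : T -> R[i]) (B : R) :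
  cintegrable mu s -> cmeasurable F -> (forall z, normc (F z) <= B) ->
  cintegrable mu (fun z => s z * F z).
Proof.
move=> si mF FB; apply: (cintegrable_dom _ (cintegrableZ B%:C si)).
  by apply: cmeasurableM => //; exact: cintegrable_meas si.
move=> z; rewrite !Normc.normcM mulrC.
rewrite ge0_normc_real ?ler_wpM2r ?normc_ge0//.
exact: le_trans (normc_ge0 _) (FB z).
Qed.

(** * Subsequences of dominated sequences *)

Section dominated_sequences.
Context (R : realType) (n : nat).
Local Notation Z := (Zn n).
Local Notation C := R[i].
Local Notation cnt := (@countZ R n).

(** The segment is compact, so the image filter has a cluster point, and an ultrafilter converges to
    its cluster points. *)
Lemma ultra_cvg_bounded (U : set_system nat) (p : nat -> R) (B : R) :
  UltraFilter U -> (forall m, `|p m| <= B) ->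
  exists r, forall e, 0 < e -> U [set m | `|p m - r| <= e].
Proof.
move=> UU pB; have PF := @ultra_proper _ _ UU.
have FF : ProperFilter (p @ U) by exact: fmap_proper_filter.
have := @segment_compact R (- B) B (p @ U) FF.
case.
  change (U [set m | p m \in `[- B, B]]); apply: filterE => m /=; rewrite in_itv/=.
  by have := pB m; rewrite ler_norml.
move=> r [_ cr]; exists r => e e0.
have [//|Un] := in_ultra_setVsetC [set m | `|p m - r| <= e] UU.
have [x [xn xr]] := cr (~` [set x | `|x - r| <= e]) (ball r e) Un (nbhsx_ballx r e e0).
exfalso; apply: xn => /=.
by move: xr; rewrite /ball /= distrC => /ltW.
Qed.

(* An ultrafilter selects the pointwise limits at all points at once, which
   replaces a diagonal extraction. *)
Lemma dominated_subseq (h_ : nat -> Z -> C) (al : Z -> R) :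
  (\int[cnt]_k (al k)%:E < +oo)%E -> (forall m k, normc (h_ m k) <= al k) ->
  exists (e : nat -> nat) (h : Z -> C), [/\ {homo e : i j / (i < j)%N},
    (nint cnt h < +oo)%E &
    forall m, (nint cnt (fun k => (h_ (e m) k - h k)%R) <= (m.+1%:R^-1)%:E)%E].
Proof.
move=> aloo hal; have al0 k : 0 <= al k := le_trans (normc_ge0 _) (hal 0 k).
have [U [UU ooU]] := ultraFilterLemma (@eventually_filter).
have PF := @ultra_proper _ _ UU.
have lim1 k : exists z : C, forall e, 0 < e -> U [set m | normc (h_ m k - z) <= e].
  have [x hx] := ultra_cvg_bounded UU (fun m => le_trans (normRe_le (h_ m k)) (hal m k)).
  have [y hy] := ultra_cvg_bounded UU (fun m => le_trans (normIm_le (h_ m k)) (hal m k)).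
  exists (x +i* y) => e e0; have e2 : 0 < e / 2 by rewrite divr_gt0.
  apply: filterS (filterI (hx _ e2) (hy _ e2)) => m /= [mx my].
  apply: le_trans (normc_le _) _; rewrite ReD ImD ReN ImN /= [leRHS]splitr.
  exact: lerD.
have [h hh] := choice lim1.
have hle k : normc (h k) <= al k.
  apply/ler_addgt0Pr => e e0; have [m /= hm] := filter_ex (hh k _ e0).
  rewrite -[h k](subKr (h_ m k)); apply: le_trans (normcB_le _ _) _.
  by apply: lerD.
have hb e : 0 < e -> U [set m | (nint cnt (fun k => (h_ m k - h k)%R) <= e%:E)%E].
  move=> e0; have e2 : 0 < e / 2 by rewrite divr_gt0.
  have aloo2 : (\int[cnt]_k (2 * al k)%:E < +oo)%E.
    under eq_integral do rewrite EFinM.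
    rewrite ge0_integralZl_EFin//; last by move=> k _; rewrite lee_fin.
    move: aloo; have : (0 <= \int[cnt]_k (al k)%:E)%E.
      by apply: integral_ge0 => k _; rewrite lee_fin.
    by case: (\int[cnt]_k _)%E => // r _ _; rewrite -EFinM ltry.
  have [M hM] := integral_tail (f := fun k => 2 * al k)
    (fun k => mulr_ge0 (ler0n R 2) (al0 k)) aloo2 e2.
  (* Half of [e] is for the tail, the other half is shared among the points of the ball; the
     successor keeps the denominator nonzero. *)
  pose d := e / 2 / (size (box R n M)).+1%:R.
  have d0 : 0 < d by rewrite divr_gt0.
  have : U [set m | forall k, k \in box R n M -> normc (h_ m k - h k) <= d].
    elim: (box R n M) => [|j s ih]; first by apply: filterE.
    apply: filterS (filterI (hh j _ d0) ih) => m /= [mj ms] k.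
    by rewrite inE => /predU1P[->//|]; exact: ms.
  apply: filterS => m /= mb.
  apply: (@le_trans _ _ (\int[cnt]_k
      ((\sum_(j <- box R n M) (if k == j then d%:E else 0)) +
       (if weight R k <= M%:R then 0 else 2 * al k)%:E))%E).
    apply: le_nint_Zn => k; rewrite -mem_box; case: ifP => [kb|/negbT kb].
      rewrite adde0 (bigD1_seq k)//= ?box_uniq// eqxx big1 ?adde0 ?lee_fin ?mb//.
      by move=> j jk; rewrite eq_sym (negbTE jk).
    rewrite big_seq big1 ?add0e; last first.
      by move=> j jb; case: eqP => // kj; rewrite kj jb in kb.
    rewrite lee_fin; apply: le_trans (normcB_le _ _) _.
    by rewrite mulr_natl mulr2n lerD.
  have s0 k : (0 <= \sum_(j <- box R n M) (if k == j then d%:E else 0))%E.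
    by apply: sume_ge0 => j _; case: ifP => // _; rewrite lee_fin ltW.
  rewrite ge0_integralD//; last first.
    by move=> k _; rewrite lee_fin; case: ifP => // _; rewrite mulr_ge0.
  rewrite (splitr e) EFinD leeD ?(ltW hM)//.
  rewrite ge0_integral_sum//; last first.
    by move=> j k _; case: ifP => // _; rewrite lee_fin ltW.
  rewrite (eq_bigr (fun=> d%:E)); last first.
    move=> j _; rewrite (@integral_Zn_supp1 _ _ _ j) ?eqxx//.
    by move=> k /negbTE ->.
  rewrite sumEFin lee_fin big_const_seq count_predT iter_addr_0 -[leLHS]mulr_natr.
  by rewrite /d mulrAC ler_pdivrMr ?ltr0n// ler_pM2l// ler_nat.
have sel (N j : nat) : exists m : nat, (N <= m)%N /\
    (nint cnt (fun k => (h_ m k - h k)%R) <= (j.+1%:R^-1)%:E)%E.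
  have j0 : (0 : R) < j.+1%:R^-1 by rewrite invr_gt0.
  have : U [set m : nat | (N <= m)%N] by apply: ooU; exists N.
  by move=> /(filterI (hb _ j0))/filter_ex[m [/= h1 h2]]; exists m.
pose s N j := sval (cid (sel N j)).
have sP N j : (N <= s N j)%N /\
    (nint cnt (fun k => (h_ (s N j) k - h k)%R) <= (j.+1%:R^-1)%:E)%E.
  by rewrite /s; case: cid.
(* Each index is chosen beyond the previous one, with tolerance 1 / (j + 1) at step [j]. *)
pose e := fix e j := if j is i.+1 then s (e i).+1 i.+1 else s 0 0.
exists e, h; split.
- apply: homo_ltn; first exact: ltn_trans.
  by move=> i /=; exact: (sP (e i).+1 i.+1).1.
- apply: le_lt_trans aloo; apply: le_nint_Zn => k.
  by rewrite lee_fin.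
- by case=> [|m]; [exact: (sP _ _).2|exact: (sP (e m).+1 m.+1).2].
Qed.

End dominated_sequences.

Section localization.
Context (R : realType) (n : nat).
Local Notation T := (Tn R n).
Local Notation Z := (Zn n).
Local Notation ZT := (Z * T)%type.
Local Notation C := R[i].
Implicit Types (f h : Z -> C) (k : Z) (z : ZT) (s : ZT -> C).
Local Notation haar := (haar R n).
Local Notation cnt := (@countZ R n).
Local Notation muZT := (@muZT R n).

Variable G : Z -> C.
Hypothesis Goo : (nint cnt G < +oo)%E.

Let lG : l2 G. Proof. exact: l2_of_l1. Qed.

(* [atom z] is M_w T_m G at z = (m, w) *)
Definition atom z k : C := echar z.2 k * G (k - z.1).

(** The strong form of the operator, a scalar integral for each [k]; [locop_weak] recovers the weak
    form by Fubini. *)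
Definition locop s f k : C := cint muZT (fun z => s z * stft G f z * atom z k).

Lemma nint_atom z : nint cnt (atom z) = nint cnt G.
Proof.
rewrite -(nint_reindex G (bij_sub z.1)); apply: eq_integral => k _.
by rewrite Normc.normcM normc_echar mul1r.
Qed.

Lemma l2_atom z : l2 (atom z).
Proof. by apply: l2_of_l1; rewrite nint_atom. Qed.

Lemma nrm_atom z : nrm (atom z) = nrm G.
Proof.
rewrite -(nrm_shift z.1 G); congr (Num.sqrt (fine _)); apply: eq_integral => k _.
by rewrite Normc.normcM normc_echar mul1r.
Qed.

Lemma cmeasurable_atom k : cmeasurable (fun z => atom z k).
Proof.
apply: cmeasurable_ZnX => m; apply: cmeasurableM; first exact: cmeasurable_echar.
exact: (cmeasurable_cst _ (G (k - m))).
Qed.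

Lemma stft_inner f z : stft G f z = inner f (atom z).
Proof.
by case: z => m w; apply: eq_cint => k; rewrite /atom conjcM mulrA mulrAC.
Qed.

Lemma normc_stft f z : l2 f -> normc (stft G f z) <= nrm f * nrm G.
Proof.
by move=> lf; rewrite stft_inner -(nrm_atom z) normc_inner//; exact: l2_atom.
Qed.

Lemma cmeasurable_stft f : cmeasurable (stft G f).
Proof.
apply: cmeasurable_ZnX => m.
exact: (cmeasurable_wser (fun k => f k * conjc (G (k - m)))).
Qed.

Section symbol_integrable.
Variable s : ZT -> C.
Hypothesis si : cintegrable muZT s.

Lemma locop_dom_integrable :
  cintegrable (muZT \x cnt)%E (fun x : ZT * Z => s x.1 * atom x.1 x.2).
Proof.
apply: cintegrable_prod.
  apply: cmeasurable_XZn => k; apply: cmeasurableM; last exact: cmeasurable_atom.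
  exact: cintegrable_meas si.
rewrite (eq_integral (fun z => (fine (nint cnt G))%:E * (normc (s z))%:E)%E); last first.
  move=> z _; rewrite nint_fineK// -(nint_atom z) muleC -ge0_integralZl_EFin ?normc_ge0//; last first.
    by move=> k _; rewrite lee_fin normc_ge0.
  by apply: eq_integral => k _; rewrite Normc.normcM EFinM.
rewrite ge0_integralZl_EFin ?fine_ge0 ?nint_ge0//; last 2 first.
- by move=> z _; rewrite lee_fin normc_ge0.
- exact: measurable_enormc (cintegrable_meas si).
move: (cintegrable_nint si) (nint_ge0 muZT s); rewrite -/(nint muZT s).
by case: (nint muZT s) => // r _ _; rewrite -EFinM ltry.
Qed.

(** Up to the factor ||f|| ||G||, one summable majorant of [locop s f] for all [f] in l^2; both
    boundedness and compactness come from it. *)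
Definition locop_dom k : R := fine (nint muZT (fun z => s z * atom z k)).

Lemma locop_dom_ge0 k : 0 <= locop_dom k.
Proof. by rewrite fine_ge0// nint_ge0. Qed.

Lemma atomM_integrable k : cintegrable muZT (fun z => s z * atom z k).
Proof.
apply: (cintegrableMb (B := nrm G) si (cmeasurable_atom k)) => z.
by rewrite -(nrm_atom z); exact: normc_le_nrm (l2_atom z).
Qed.

Lemma locop_domE k : (locop_dom k)%:E = nint muZT (fun z => s z * atom z k).
Proof.
rewrite fineK// fin_numElt (cintegrable_nint (atomM_integrable k)) andbT.
exact: lt_le_trans (ltNyr 0) (nint_ge0 _ _).
Qed.

Lemma locop_dom_lty : (\int[cnt]_k (locop_dom k)%:E < +oo)%E.
Proof.
have := cintegrable_nint locop_dom_integrable.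
rewrite nint_prod2; last exact: cintegrable_meas locop_dom_integrable.
by congr (_ < _)%E; apply: eq_integral => k _; rewrite locop_domE.
Qed.

Lemma locop_integrable f k : l2 f ->
  cintegrable muZT (fun z => s z * stft G f z * atom z k).
Proof.
move=> lf; have := cintegrableMb (atomM_integrable k) (cmeasurable_stft f)
  (fun z => normc_stft z lf).
by congr cintegrable; apply/funext => z; rewrite mulrAC.
Qed.

Lemma normc_locop f k : l2 f -> normc (locop s f k) <= nrm f * nrm G * locop_dom k.
Proof.
move=> lf; rewrite -lee_fin EFinM locop_domE.
apply: le_trans (normc_cint (locop_integrable k lf)) _.
rewrite -ge0_integralZl_EFin ?mulr_ge0 ?nrm_ge0//; last 2 first.
- by move=> z _; rewrite lee_fin normc_ge0.
- exact: measurable_enormc (cintegrable_meas (atomM_integrable k)).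
apply: le_nint; first exact: cintegrable_meas (locop_integrable k lf).
  by apply: measurable_funeM; exact: measurable_enormc (cintegrable_meas (atomM_integrable k)).
move=> z; rewrite -EFinM lee_fin mulrAC Normc.normcM mulrC.
by rewrite ler_wpM2r ?normc_ge0// normc_stft.
Qed.

Definition locop_bound : R := nrm G * fine (\int[cnt]_k (locop_dom k)%:E)%E.

Lemma nint_locop f : l2 f -> (nint cnt (locop s f) <= (nrm f * locop_bound)%:E)%E.
Proof.
move=> lf; have I0 : (0 <= \int[cnt]_k (locop_dom k)%:E)%E.
  by apply: integral_ge0 => k _; rewrite lee_fin locop_dom_ge0.
rewrite /locop_bound mulrA EFinM fineK; last first.
  by rewrite fin_numElt locop_dom_lty (lt_le_trans (ltNyr 0)).
rewrite -ge0_integralZl_EFin ?mulr_ge0 ?nrm_ge0//; last first.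
  by move=> k _; rewrite lee_fin locop_dom_ge0.
by apply: le_nint_Zn => k; rewrite -EFinM lee_fin normc_locop.
Qed.

Lemma l2_locop f : l2 f -> l2 (locop s f) /\ nrm (locop s f) <= nrm f * locop_bound.
Proof. by move=> lf; apply: nrm_le_nint; exact: nint_locop. Qed.

Lemma locop_linear (a : C) f h : l2 f -> l2 h ->
  locop s (fun k => a * f k + h k) = (fun k => a * locop s f k + locop s h k).
Proof.
move=> lf lh; apply/funext => k.
rewrite /locop -cintZ; last exact: locop_integrable.
rewrite -cintD; [|by apply: cintegrableZ; exact: locop_integrable|exact: locop_integrable].
apply: eq_cint => z; rewrite !stft_inner innerDl//; try exact: l2_atom; last exact: (l2Z a lf).1.
by rewrite innerZl//; [ring|exact: l2_atom].
Qed.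

Lemma bounded_locop : bounded_op (locop s).
Proof.
split; [by move=> f /l2_locop[]|exact: locop_linear|].
exists locop_bound => f lf; have [ll nl] := l2_locop lf.
by rewrite !l2norm_nrm// -EFinM lee_fin mulrC.
Qed.

Lemma locop_weak f h : l2 f -> l2 h ->
  cintegrable muZT (fun z => s z * stft G f z * conjc (stft G h z)) /\
  inner (locop s f) h = cint muZT (fun z => s z * stft G f z * conjc (stft G h z)).
Proof.
move=> lf lh; split.
  have := cintegrableMb (F := fun z => stft G f z * conjc (stft G h z))
    (B := nrm f * nrm G * (nrm h * nrm G)) si.
  under [X in _ -> _ -> cintegrable _ X]eq_fun do rewrite mulrA.
  apply; first by apply: cmeasurableM; [|apply: cmeasurableJ]; exact: cmeasurable_stft.
  by move=> z; rewrite Normc.normcM normc_conj ler_pM ?normc_ge0 ?normc_stft.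
pose F (x : ZT * Z) := s x.1 * stft G f x.1 * atom x.1 x.2 * conjc (h x.2).
have iF : cintegrable (muZT \x cnt)%E F.
  have mF : cmeasurable (fun x : ZT * Z => stft G f x.1 * conjc (h x.2)).
    apply: cmeasurable_XZn => k; apply: cmeasurableM; first exact: cmeasurable_stft.
    exact: (cmeasurable_cst _ (conjc (h k))).
  have bF x : normc (stft G f x.1 * conjc (h x.2)) <= nrm f * nrm G * nrm h.
    rewrite Normc.normcM normc_conj ler_pM ?normc_ge0 ?normc_stft//.
    exact: normc_le_nrm.
  have := cintegrableMb locop_dom_integrable mF bF.
  by congr (cintegrable _ _); apply/funext => x; rewrite /F; ring.
transitivity (cint cnt (fun k => cint muZT (fun z => F (z, k)))).
  apply: eq_cint => k; rewrite -cintZr//; exact: locop_integrable.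
rewrite -(cfubini iF); apply: eq_cint => z; rewrite /F /=.
transitivity (s z * stft G f z * inner (atom z) h).
  rewrite -cintZ; last exact: inner_integrable (l2_atom z) lh.
  by apply: eq_cint => k; rewrite !mulrA.
by rewrite (stft_inner h) innerC//; exact: l2_atom.
Qed.

Lemma compact_locop : compact_op (locop s).
Proof.
split; first exact: bounded_locop.
move=> f_ lf [c fc]; have fcn m : nrm (f_ m) <= c.
  by have := fc m; rewrite l2norm_nrm// lee_fin.
pose al k := c * nrm G * locop_dom k.
have c0 : 0 <= c := le_trans (nrm_ge0 _) (fcn 0).
have [||e [h [me hoo eh]]] := @dominated_subseq _ _ (fun m => locop s (f_ m)) al.
- under eq_integral do rewrite EFinM.
  rewrite ge0_integralZl_EFin ?mulr_ge0 ?nrm_ge0//; last first.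
    by move=> k _; rewrite lee_fin locop_dom_ge0.
  have : (0 <= \int[cnt]_k (locop_dom k)%:E)%E.
    by apply: integral_ge0 => k _; rewrite lee_fin locop_dom_ge0.
  by move: locop_dom_lty; case: (\int[cnt]_k _)%E => // r _ _; rewrite -EFinM ltry.
- move=> m k; apply: le_trans (normc_locop k (lf m)) _.
  by rewrite ler_wpM2r ?locop_dom_ge0// ler_wpM2r ?nrm_ge0.
exists e; split => //; exists h; first exact: l2_of_l1.
have hl m := nrm_le_nint (eh m).
apply: (@squeeze_cvge _ _ _ _ (fun=> 0%E) _ (fun m => (m.+1%:R^-1)%:E)).
- apply: nearW => m; rewrite l2norm_nrm; last exact: (hl m).1.
  by apply/andP; rewrite !lee_fin; split; [exact: nrm_ge0|exact: (hl m).2].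
- exact: cvg_cst.
- by apply: cvg_EFin; [exact: nearW|exact: cvg_harmonic].
Qed.

End symbol_integrable.

Lemma adjoint_locop s : cintegrable muZT s ->
  adjoint_op (locop s) (locop (fun z => conjc (s z))).
Proof.
move=> si; have siJ := cintegrableJ si.
split; first exact: bounded_locop.
move=> f h lf lh; rewrite -(innerC (l2_locop siJ lh).1 lf).
rewrite (locop_weak si lf lh).2 (locop_weak siJ lh lf).2 -cintJ.
  by apply: eq_cint => z; rewrite !conjcM !conjcK mulrAC.
exact: (locop_weak siJ lh lf).1.
Qed.

End localization.

(** * The absolute value and the trace norm *)

Section square_root.
Context (R : realType) (n : nat).
Local Notation Z := (Zn n).
Local Notation C := R[i].
Implicit Types (f h : Z -> C) (k : Z) (A B P X T : (Z -> C) -> Z -> C).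

Definition l2map T := forall f, l2 f -> l2 (T f).

Definition l2linear T := forall (a : C) f h, l2 f -> l2 h ->
  T (fun k => a * f k + h k) = (fun k => a * T f k + T h k).

Definition l2sym T := forall f h, l2 f -> l2 h -> inner (T f) h = inner f (T h).

Lemma bounded_opP T : bounded_op T <->
  [/\ l2map T, l2linear T & exists2 c : R, 0 < c &
    forall f, l2 f -> nrm (T f) <= c * nrm f].
Proof.
split=> [[lT linT [c Tc]]|[lT linT [c c0 Tc]]]; split => //.
  exists (`|c| + 1); first by rewrite ltr_wpDl.
  move=> f lf; have := Tc _ lf; rewrite !l2norm_nrm//; last exact: lT.
  rewrite -EFinM lee_fin => /le_trans; apply; rewrite ler_wpM2r ?nrm_ge0//.
  by rewrite (le_trans (ler_norm c))// lerDl.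
exists c => f lf; rewrite !l2norm_nrm//; last exact: lT.
by rewrite -EFinM lee_fin Tc.
Qed.

Lemma linearB_l2 T f h : l2linear T -> l2 f -> l2 h ->
  T (fun k => f k - h k) = (fun k => T f k - T h k).
Proof.
move=> lT lf lh; rewrite (_ : (fun k => _) = (fun k => -1 * h k + f k)); last first.
  by apply/funext => k; rewrite mulN1r addrC.
by rewrite lT//; apply/funext => k; rewrite mulN1r addrC.
Qed.

Lemma linear0_l2 T : l2linear T -> T (fun _ => 0) = (fun _ => 0).
Proof.
move=> lT; have := linearB_l2 lT (l2_0 R n).1 (l2_0 R n).1.
under [X in T X = _]eq_fun do rewrite subrr.
by move=> ->; apply/funext => k; rewrite subrr.
Qed.

Lemma linearZ_l2 T (a : C) f : l2linear T -> l2 f ->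
  T (fun k => a * f k) = (fun k => a * T f k).
Proof.
move=> lT lf; have := lT a _ _ lf (l2_0 R n).1; rewrite linear0_l2//.
under [X in T X = _]eq_fun do rewrite addr0.
by move=> ->; apply/funext => k; rewrite addr0.
Qed.

Lemma fun_small f (c : R) : l2 f -> (forall m : nat, nrm f <= c * m.+1%:R^-1) ->
  forall k, f k = 0.
Proof.
move=> lf fc k; apply: (@normc_small R _ c) => m.
exact: le_trans (normc_le_nrm k lf) (fc m).
Qed.

(** The iteration of [iterX] with X replaced by the number 1. It dominates the operator iteration in
    norm ([iterX_le]) and in increments ([iterX_step]). *)
Fixpoint scal (m : nat) : R := if m is i.+1 then (1 + scal i ^+ 2) / 2 else 0.

Lemma scal_bound m : 0 <= scal m <= 1.
Proof.
elim: m => [|m /andP[h0 h1]] /=; first by rewrite lexx ler01.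
by move: (scal m) h0 h1 => y h0 h1; apply/andP; split; nra.
Qed.

(** 1 is a double root of y = (1 + y^2) / 2, so convergence is only harmonic. The induction runs on
    the bound 2 / (m + 2), an equality at m = 0. *)
Lemma scal_cvg m : 1 - scal m <= 2 * m.+1%:R^-1.
Proof.
suff h : 1 - scal m <= 2 / m.+2%:R.
  by apply: le_trans h _; rewrite ler_wpM2l// lef_pV2 ?posrE// ler_nat.
elim: m => [|m ih]; first by rewrite /= subr0 divff.
have /andP[] := scal_bound m; rewrite [scal m.+1]/=.
have -> : m.+3%:R = m.+2%:R + 1 :> R by rewrite -[m.+3]addn1 natrD.
have : 2 <= m.+2%:R :> R by rewrite ler_nat.
move: (m.+2%:R) (scal m) ih => t y ih t2 y0 y1.
have t0 : 0 < t by lra.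
rewrite ler_pdivlMr in ih => //; rewrite ler_pdivlMr; last lra.
have : 0 <= (2 - (1 - y) * t) by lra.
nra.
Qed.

Variable X : (Z -> C) -> Z -> C.
Hypothesis lX : l2map X.
Hypothesis linX : l2linear X.
Hypothesis symX : l2sym X.
Hypothesis Xle : forall f, l2 f -> nrm (X f) <= nrm f.

(* The iterates converge to Y = 1 - sqrt (1 - X). *)
Fixpoint iterX (m : nat) f : Z -> C :=
  if m is i.+1 then fun k => 2^-1 * (X f k + iterX i (iterX i f) k) else fun _ => 0.

Lemma l2_iterX m : l2map (iterX m).
Proof.
elim: m => [|m ih] f lf; first exact: (l2_0 R n).1.
by apply: (l2Z _ _).1; apply: l2D; [exact: lX|apply/ih/ih].
Qed.

Lemma linear_iterX m : l2linear (iterX m).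
Proof.
elim: m => [|m ih] a f h lf lh; apply/funext => k /=; first by rewrite mulr0 addr0.
by rewrite linX// ih// ih//; [ring|exact: l2_iterX|exact: l2_iterX].
Qed.

Lemma half_conj : conjc (2^-1 : C) = 2^-1.
Proof.
have -> : (2^-1 : C) = (2^-1 : R)%:C by rewrite rmorphV ?unitfE// rmorph_nat.
exact: conjc_real.
Qed.

Lemma half_norm : normc (2^-1 : C) = 2^-1 :> R.
Proof.
have -> : (2^-1 : C) = (2^-1 : R)%:C by rewrite rmorphV ?unitfE// rmorph_nat.
by rewrite ge0_normc_real// invr_ge0.
Qed.

Lemma sym_iterX m : l2sym (iterX m).
Proof.
elim: m => [|m ih] f h lf lh /=.
  rewrite /inner (eq_cint _ (G := fun=> 0)); last by move=> k; rewrite mul0r.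
  rewrite cint0 (eq_cint _ (G := fun=> 0)) ?cint0// => k.
  by rewrite (_ : conjc 0 = 0) ?mulr0// /conjc/= oppr0.
have lfm := l2_iterX m lf; have lhm := l2_iterX m lh.
have lfmm := l2_iterX m lfm; have lhmm := l2_iterX m lhm.
have lXf := lX lf; have lXh := lX lh.
rewrite innerZl ?innerDl ?innerZr ?innerDr//; try exact: l2D.
by rewrite half_conj symX// !ih.
Qed.

Lemma iterX_le m f : l2 f -> nrm (iterX m f) <= scal m * nrm f.
Proof.
elim: m f => [|m ih] f lf /=; first by rewrite (l2_0 R n).2 mul0r.
have lfm := l2_iterX m lf; have lfmm := l2_iterX m lfm; have lXf := lX lf.
rewrite (l2Z _ (l2D lXf lfmm)).2 half_norm mulrC mulrAC ler_wpM2r ?invr_ge0//.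
apply: le_trans (nrmD lXf lfmm) _; rewrite mulrDl mul1r lerD ?Xle//.
apply: le_trans (ih _ lfm) _; rewrite expr2 -mulrA ler_wpM2l ?ih//.
by case/andP: (scal_bound m).
Qed.

(** For consecutive iterates, Y1^2 - Y0^2 = Y1 (Y1 - Y0) + (Y1 - Y0) Y0. Bounding norms and
    increments by [scal] turns the right side into y1^2 - y0^2, twice the next scalar increment. *)
Lemma iterX_step m f : l2 f ->
  nrm (fun k => iterX m.+1 f k - iterX m f k) <= (scal m.+1 - scal m) * nrm f.
Proof.
elim: m f => [|m ih] f lf.
  rewrite (_ : (fun k => _) = iterX 1 f); last by apply/funext => k /=; rewrite subr0.
  by apply: le_trans (iterX_le 1 lf) _; rewrite /= subr0.
have lm := l2_iterX m lf; have lm1 := l2_iterX m.+1 lf.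
have lmm := l2_iterX m lm; have lm1m1 := l2_iterX m.+1 lm1.
have lm1m := l2_iterX m.+1 lm.
have ld := l2B lm1 lm.
rewrite (_ : (fun k => _) = (fun k => 2^-1 *
    (iterX m.+1 (fun k => iterX m.+1 f k - iterX m f k) k +
     (iterX m.+1 (iterX m f) k - iterX m (iterX m f) k)))); last first.
  rewrite linearB_l2//; last exact: linear_iterX.
  apply/funext => k; rewrite subrKA.
  rewrite (_ : iterX m.+2 f k = 2^-1 * (X f k + iterX m.+1 (iterX m.+1 f) k))//.
  rewrite (_ : iterX m.+1 f k = 2^-1 * (X f k + iterX m (iterX m f) k))//.
  by ring.
have l1 := l2_iterX m.+1 ld; have l2' := l2B lm1m lmm.
rewrite (l2Z _ (l2D l1 l2')).2 half_norm.
have b1 := le_trans (iterX_le m.+1 ld)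
  (ler_wpM2l (proj1 (andP (scal_bound m.+1))) (ih _ lf)).
have d0 : 0 <= scal m.+1 - scal m.
  have /andP[h0 h1] := scal_bound m; rewrite /=; move: (scal m) h0 h1 => y h0 h1; nra.
have b2 := le_trans (ih _ lm) (ler_wpM2l d0 (iterX_le m lf)).
have := le_trans (nrmD l1 l2') (lerD b1 b2).
have -> : scal m.+2 - scal m.+1 = (scal m.+1 ^+ 2 - scal m ^+ 2) / 2.
  rewrite (_ : scal m.+2 = (1 + scal m.+1 ^+ 2) / 2)//.
  by rewrite (_ : scal m.+1 = (1 + scal m ^+ 2) / 2)//; field.
move: (nrm _) (scal m.+1) (scal m) (nrm f) => a y' y b.
by move=> h; lra.
Qed.

Lemma iterX_dist i j f : l2 f -> (i <= j)%N ->
  nrm (fun k => iterX j f k - iterX i f k) <= scal j * nrm f - scal i * nrm f.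
Proof.
move=> lf; elim: j => [|j ih].
  rewrite leqn0 => /eqP ->; rewrite subrr.
  by under eq_fun do rewrite subrr; rewrite (l2_0 R n).2.
rewrite leq_eqVlt => /predU1P[->|].
  by rewrite subrr; under eq_fun do rewrite subrr; rewrite (l2_0 R n).2.
rewrite ltnS => /ih h.
rewrite (_ : (fun k => _) = (fun k => (iterX j.+1 f k - iterX j f k) +
    (iterX j f k - iterX i f k))); last by apply/funext => k; rewrite subrKA.
apply: le_trans (nrmD _ _) _; try by apply: l2B; exact: l2_iterX.
by have := iterX_step j lf; move: h; rewrite mulrBl; lra.
Qed.

Lemma iterX_cvg f : l2 f -> exists h, l2 h /\
  forall m, nrm (fun k => h k - iterX m f k) <= (1 - scal m) * nrm f.
Proof.
move=> lf; have [|||h lh hm] := @l2_complete _ _ (fun m => iterX m f)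
    (fun m => scal m * nrm f) (nrm f).
- by move=> m; exact: l2_iterX.
- by move=> i; rewrite ler_piMl ?nrm_ge0//; case/andP: (scal_bound i).
- by move=> i j ij; exact: iterX_dist.
by exists h; split => // m; rewrite mulrBl mul1r.
Qed.

(** In the limit X + Y^2 = 2 Y, that is (1 - Y)^2 = 1 - X. Linearity, symmetry and this equation
    pass from the iterates with errors of order 1 / (m + 1). *)
Lemma sqrt_iteration : exists Y : (Z -> C) -> Z -> C,
  [/\ l2map Y, l2linear Y, l2sym Y,
    forall f, l2 f -> nrm (Y f) <= nrm f &
    forall f, l2 f -> (fun k => X f k + Y (Y f) k) = (fun k => 2 * Y f k)].
Proof.
have [Y0 YP] : exists Y : (Z -> C) -> Z -> C, forall f, l2 f -> l2 (Y f) /\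
    forall m, nrm (fun k => Y f k - iterX m f k) <= (1 - scal m) * nrm f.
  have : forall f, exists h, l2 f -> l2 h /\
      forall m, nrm (fun k => h k - iterX m f k) <= (1 - scal m) * nrm f.
    move=> f; have [lf|nlf] := pselect (l2 f); last by exists f.
    by have [h hP] := iterX_cvg lf; exists h.
  by move=> /choice[Y YP]; exists Y.
have lY f : l2 f -> l2 (Y0 f) by move=> /YP[].
have Yd f m : l2 f -> nrm (fun k => Y0 f k - iterX m f k) <= 2 * m.+1%:R^-1 * nrm f.
  move=> lf; apply: le_trans ((YP f lf).2 m) _.
  by rewrite ler_wpM2r ?nrm_ge0 ?scal_cvg.
have Yle f : l2 f -> nrm (Y0 f) <= nrm f.
  move=> lf; have := (YP f lf).2 0%N; rewrite /= subr0 mul1r.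
  by under eq_fun do rewrite subr0.
have lYd f m : l2 f -> l2 (fun k => Y0 f k - iterX m f k).
  by move=> lf; apply: l2B; [exact: lY|exact: l2_iterX].
have linY : l2linear Y0.
  move=> a f h lf lh; apply/funext => k; apply/eqP; rewrite -subr_eq0; apply/eqP.
  have lafh := l2_lin a lf lh; have lYafh := l2_lin a (lY _ lf) (lY _ lh).
  apply: (@fun_small (fun k => Y0 (fun k => a * f k + h k) k - (a * Y0 f k + Y0 h k))
    (2 * (nrm (fun k => a * f k + h k) + (normc a * nrm f + nrm h)))).
    by apply: l2B => //; exact: lY.
  move=> m; rewrite (_ : (fun k => _) = (fun k =>
     (Y0 (fun k => a * f k + h k) k - iterX m (fun k => a * f k + h k) k) -
     (a * (Y0 f k - iterX m f k) + (Y0 h k - iterX m h k)))); last first.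
    by rewrite linear_iterX//; apply/funext => l; ring.
  have l1 := l2_lin a (lYd _ m lf) (lYd _ m lh).
  apply: le_trans (nrmB (lYd _ m lafh) l1) _.
  have la := l2Z a (lYd _ m lf).
  have h1 := nrmD la.1 (lYd _ m lh); rewrite la.2 in h1.
  have h2 := ler_wpM2l (normc_ge0 a) (Yd f m lf).
  have := Yd _ m lafh; have := Yd _ m lh.
  move: h1 h2; move: (m.+1%:R^-1) (nrm _) (nrm _) (nrm _) (nrm _) => e x1 x2 x3 x4.
  by lra.
exists Y0; split => //.
- move=> f h lf lh; apply/eqP; rewrite -subr_eq0; apply/eqP.
  apply: (@normc_small R _ (4 * (nrm f * nrm h))) => m.
  have l1 := l2_iterX m lf; have l2' := l2_iterX m lh.
  rewrite (_ : _ - _ = inner (fun k => Y0 f k - iterX m f k) h -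
    inner f (fun k => Y0 h k - iterX m h k)); last first.
    rewrite innerBl ?innerBr//; try exact: lY.
    by rewrite sym_iterX// opprB subrKA.
  apply: le_trans (normcB_le _ _) _.
  have h1 := normc_inner (lYd _ m lf) lh.
  have h2 := normc_inner lf (lYd _ m lh).
  have h3 := ler_wpM2r (nrm_ge0 h) (Yd f m lf).
  have h4 := ler_wpM2l (nrm_ge0 f) (Yd h m lh).
  apply: le_trans (lerD (le_trans h1 h3) (le_trans h2 h4)) _.
  by rewrite le_eqVlt; apply/orP; left; apply/eqP; ring.
- move=> f lf; apply/funext => k; apply/eqP; rewrite -subr_eq0; apply/eqP.
  have lYf := lY _ lf; have lYYf := lY _ lYf.
  apply: (@fun_small (fun k => X f k + Y0 (Y0 f) k - 2 * Y0 f k) (8 * nrm f)).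
    by apply: l2B; [apply: l2D => //; exact: lX|exact: (l2Z _ lYf).1].
  move=> m; rewrite (_ : (fun k => _) = (fun k =>
      (iterX m (fun k => Y0 f k - iterX m f k) k + (Y0 (Y0 f) k - iterX m (Y0 f) k)) -
      2 * (Y0 f k - iterX m.+1 f k))); last first.
    rewrite linearB_l2//; [|exact: linear_iterX|exact: l2_iterX].
    by apply/funext => l /=; field.
  have l1 := l2_iterX m (lYd _ m lf).
  have l2 := l2Z 2 (lYd _ m.+1 lf).
  apply: le_trans (nrmB (l2D l1 (lYd _ m lYf)) l2.1) _.
  have h1 := nrmD l1 (lYd _ m lYf).
  have h2 := iterX_le m (lYd _ m lf).
  have h3 : scal m * nrm (fun k => Y0 f k - iterX m f k) <= 1 * nrm (fun k => Y0 f k - iterX m f k).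
    by rewrite ler_wpM2r ?nrm_ge0//; case/andP: (scal_bound m).
  have h4 := Yd _ m lf; have h5 := Yd _ m lYf; have h6 := Yd _ m.+1 lf.
  have h7 : 2 * m.+1%:R^-1 * nrm (Y0 f) <= 2 * m.+1%:R^-1 * nrm f.
    by rewrite ler_wpM2l ?Yle// mulr_ge0// invr_ge0.
  have h8 : m.+2%:R^-1 * nrm f <= m.+1%:R^-1 * nrm f.
    by rewrite ler_wpM2r ?nrm_ge0// lef_pV2 ?posrE// ler_nat.
  rewrite l2.2 (_ : normc 2 = 2); last first.
    by rewrite (_ : 2 = (2 : R)%:C) ?ge0_normc_real// rmorph_nat.
  move: h1 h2 h3 h4 h5 h6 h7 h8; move: (m.+1%:R^-1) (m.+2%:R^-1) => e e'.
  move: (nrm _) (nrm _) (nrm _) (nrm _) (nrm _) => x1 x2 x3 x4 x5.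
  by move: (scal _ * _) => x6; lra.
Qed.

End square_root.

Section absolute_value.
Context (R : realType) (n : nat).
Local Notation Z := (Zn n).
Local Notation C := R[i].
Implicit Types (f h u v : Z -> C) (k : Z) (A B P : (Z -> C) -> Z -> C).

Lemma conjc_fixed (z : C) : conjc z = z -> z = (Re z)%:C.
Proof.
move=> /(congr1 (@Im R)); rewrite Im_conj => e.
apply: complexP => //=; apply/eqP; rewrite -[_ == 0](mulrn_eq0 _ 2) mulr2n.
by rewrite -{1}e addNr.
Qed.

Lemma ge0_conjc (z : C) : 0 <= z -> conjc z = z.
Proof.
by rewrite lecE => /andP[/eqP z0 _]; apply: complexP; rewrite ?Re_conj ?Im_conj// z0 oppr0.
Qed.

Lemma ler0c_real (r : R) : 0 <= r -> 0 <= r%:C.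
Proof. by move=> r0; rewrite lecE /= eqxx r0. Qed.

Lemma adjoint_nrm A B (c : R) : l2map A -> adjoint_op A B -> 0 <= c ->
  (forall f, l2 f -> nrm (A f) <= c * nrm f) ->
  forall h, l2 h -> nrm (B h) <= c * nrm h.
Proof.
move=> lA [/bounded_opP[lB _ _] adj] c0 Ac h lh; have lBh := lB _ lh.
have := nrm_ge0 (B h); rewrite le_eqVlt => /predU1P[<-|B0].
  by rewrite mulr_ge0 ?nrm_ge0.
rewrite -(ler_pM2l B0) -expr2.
have := normc_inner (lA _ lBh) lh; rewrite adj// inner_self//.
rewrite ge0_normc_real ?sqr_ge0// => /le_trans; apply.
by rewrite mulrA [nrm (B h) * c]mulrC ler_wpM2r ?nrm_ge0// Ac.
Qed.

(** If [c] bounds the norm of [A], then X = 1 - c^-2 B A is a symmetric contraction. With (1 - Y)^2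
    = 1 - X, the operator P = c (1 - Y) satisfies P^2 = B A, and ||Y|| <= 1 makes it positive. *)
Lemma abs_op_exists A B : bounded_op A -> adjoint_op A B ->
  exists P, is_abs_op A P.
Proof.
move=> bA adjAB; have [/bounded_opP[lB linB _] adj] := adjAB.
have /bounded_opP[lA linA [c c0 Ac]] := bA.
have Bc := adjoint_nrm lA adjAB (ltW c0) Ac.
have lBA f : l2 f -> l2 (B (A f)) by move=> lf; exact/lB/lA.
have adj' f h : l2 f -> l2 h -> inner (B f) h = inner f (A h).
  move=> lf lh; rewrite -(innerC lh (lB _ lf)) -adj// innerC//.
  exact: lA.
pose s : C := (c^-1 ^+ 2)%:C.
have sJ : conjc s = s by exact: conjc_real.
have sn : normc s = c^-1 ^+ 2 by rewrite ge0_normc_real// sqr_ge0.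
pose X f k := f k - s * B (A f) k.
have lsBA f : l2 f -> l2 (fun k => s * B (A f) k).
  by move=> lf; exact: (l2Z s (lBA _ lf)).1.
have lX : l2map X by move=> f lf; apply: l2B => //; exact: lsBA.
have linX : l2linear X.
  move=> a f h lf lh; apply/funext => k; rewrite /X linA// linB; try exact: lA.
  by ring.
have symX : l2sym X.
  move=> f h lf lh; rewrite /X innerBl ?innerBr//; try exact: lsBA.
  rewrite innerZl ?innerZr//; try exact: lBA.
  by rewrite sJ adj'// ?adj//; exact: lA.
have Xle f : l2 f -> nrm (X f) <= nrm f.
  move=> lf; have lBAf := lBA _ lf; have lAf := lA _ lf.
  rewrite -(@ler_sqr R) ?nnegrE ?nrm_ge0//.
  have -> : X f = (fun k => f k + - s * B (A f) k).
    by apply/funext => k; rewrite /X mulNr.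
  have lmB := l2Z (- s) lBAf.
  rewrite nrmD_sqr ?lmB.2; [|exact: lf|exact: lmB.1].
  rewrite innerZr// -adj// inner_self// normcN sn.
  have -> : conjc (- s) * (nrm (A f) ^+ 2)%:C = (- (c^-1 ^+ 2 * nrm (A f) ^+ 2))%:C.
    by rewrite /s -rmorphN conjc_real -rmorphM mulNr.
  have h := Bc _ lAf.
  (* As ||B|| <= c, the quadratic term of ||X f||^2 is at most c^-2 ||A f||^2, which the cross term
     -2 c^-2 ||A f||^2 absorbs. *)
  have h2 : (c^-1 ^+ 2 * nrm (B (A f))) ^+ 2 <= c^-1 ^+ 2 * nrm (A f) ^+ 2.
    rewrite -exprMn ler_sqr ?nnegrE ?mulr_ge0 ?sqr_ge0 ?nrm_ge0 ?invr_ge0 ?(ltW c0)//.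
    rewrite expr2 -mulrA ler_wpM2l ?invr_ge0 ?(ltW c0)//.
    by rewrite ler_pdivrMl.
  have h3 : 0 <= c^-1 ^+ 2 * nrm (A f) ^+ 2 by rewrite mulr_ge0 ?sqr_ge0.
  rewrite [Re _]/=; move: h2 h3; move: (_ ^+ 2 * nrm (A f) ^+ 2) (_ ^+ 2) => x y.
  by move: (nrm f ^+ 2) => z; lra.
have [Y [lY linY symY Yle YE]] := sqrt_iteration lX linX symX Xle.
pose P f k := c%:C * (f k - Y f k).
have lQ f : l2 f -> l2 (fun k => f k - Y f k) by move=> lf; apply: l2B => //; exact: lY.
have lP : l2map P by move=> f lf; exact: (l2Z _ (lQ _ lf)).1.
exists P; split.
  split.
    apply/bounded_opP; split => //.
    - move=> a f h lf lh; apply/funext => k; rewrite /P linY//.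
      by ring.
    - exists (c * 2); first by rewrite mulr_gt0.
      move=> f lf; rewrite (l2Z _ (lQ _ lf)).2 ge0_normc_real ?(ltW c0)//.
      rewrite -mulrA ler_wpM2l ?(ltW c0)//; apply: le_trans (nrmB lf (lY _ lf)) _.
      by rewrite mulr_natl mulr2n lerD2l Yle.
  move=> f lf; have lYf := lY _ lf.
  rewrite innerZl ?innerBl//; last exact: lQ.
  rewrite inner_self// (conjc_fixed (z := inner (Y f) f)); last first.
    by rewrite innerC// -symY.
  rewrite -rmorphB -rmorphM; apply: ler0c_real; rewrite mulr_ge0 ?(ltW c0)// subr_ge0.
  apply: le_trans (ler_norm _) _; apply: le_trans (normRe_le _) _.
  apply: le_trans (normc_inner lYf lf) _.
  by rewrite expr2 ler_wpM2r ?nrm_ge0// Yle.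
exists B => // f lf; have lYf := lY _ lf; have lYYf := lY _ lYf.
apply/funext => k.
have YP : Y (P f) = fun k => c%:C * (Y f k - Y (Y f) k).
  by rewrite linearZ_l2// ?linearB_l2//; exact: lQ.
rewrite [LHS]/P YP /P.
have := congr1 (fun F => F k) (YE f lf); rewrite /X /= => e.
have cs : c%:C * c%:C * s = 1.
  by rewrite /s -!rmorphM -expr2 -exprMn divff ?gt_eqF// expr1n.
rewrite -[RHS]mul1r -cs.
have e' : s * B (A f) k = f k + Y (Y f) k - 2 * Y f k by rewrite -e; ring.
by rewrite -mulrA e'; ring.
Qed.

(** Positivity makes <P f, f> real, so the sesquilinear form [D] vanishes on the diagonal;
    polarization with a = 1 and a = i shows that D f h + D h f and D f h - D h f are both 0. *)
Lemma positive_sym P : positive_op P -> l2sym P.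
Proof.
move=> [/bounded_opP[lP linP _] P0] f h lf lh.
pose D f h := inner (P f) h - inner f (P h).
have D0 f' : l2 f' -> D f' f' = 0.
  move=> lf'; have := ge0_conjc (P0 _ lf'); rewrite innerC//; last exact: lP.
  by move=> e; rewrite /D e subrr.
have key (a : C) : a * D f h + conjc a * D h f = 0.
  have laf := (l2Z a lf).1; have lPf := lP _ lf; have lPh := lP _ lh.
  have laPf := (l2Z a lPf).1.
  have := D0 _ (l2_lin a lf lh); rewrite /D linP//.
  rewrite !innerDl ?innerDr//; try exact: l2D.
  rewrite !innerZl ?innerZr// => e0.
  have := D0 _ lf; have := D0 _ lh; rewrite /D => eh ef.
  rewrite -[RHS]e0; apply/eqP; rewrite -subr_eq0; apply/eqP.
  transitivity (- (a * conjc a * (inner (P f) f - inner f (P f)) +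
    (inner (P h) h - inner h (P h)))); first by ring.
  by rewrite ef eh mulr0 addr0 oppr0.
have h1 := key 1; have h2 := key 'i%C.
have i1 : conjc (1 : C) = 1 by rewrite /conjc /= oppr0.
have i2 : conjc ('i%C : C) = - 'i%C.
  by apply: complexP; rewrite ?Re_conj ?Im_conj ?ReN ?ImN //= oppr0.
rewrite i1 !mul1r in h1; rewrite i2 mulNr -mulrBr in h2.
have i0 : ('i%C : C) != 0.
  by apply/eqP => /(congr1 (@Im R)) /= /eqP; rewrite oner_eq0.
move/eqP: h2; rewrite mulf_eq0 (negbTE i0) /= => /eqP h2.
apply/eqP; rewrite -subr_eq0 -/(D f h).
have -> : D f h = ((D f h + D h f) + (D f h - D h f)) / 2 by field.
by rewrite h1 h2 addr0 mul0r.
Qed.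

Lemma l2_sum I (r : seq I) (u : I -> Z -> C) (c : I -> C) : (forall i, l2 (u i)) ->
  l2 (fun k => \sum_(i <- r) c i * u i k).
Proof.
move=> lu; elim: r => [|i r ih].
  by under eq_fun do rewrite big_nil; exact: (l2_0 R n).1.
by under eq_fun do rewrite big_cons; apply: l2_lin.
Qed.

Lemma inner_sumr I (r : seq I) (u : I -> Z -> C) (c : I -> C) f :
  (forall i, l2 (u i)) -> l2 f ->
  inner f (fun k => \sum_(i <- r) c i * u i k) =
  \sum_(i <- r) conjc (c i) * inner f (u i).
Proof.
move=> lu lf; elim: r => [|i r ih].
  under [X in inner f X]eq_fun do rewrite big_nil.
  rewrite big_nil /inner (eq_cint _ (G := fun=> 0)) ?cint0// => k.
  by rewrite (_ : conjc 0 = 0) ?mulr0// /conjc/= oppr0.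
under [X in inner f X]eq_fun do rewrite big_cons.
rewrite big_cons innerDr ?innerZr// ?ih//; first exact: (l2Z _ (lu i)).1.
exact: l2_sum.
Qed.

Lemma inner_suml I (r : seq I) (u : I -> Z -> C) (c : I -> C) f :
  (forall i, l2 (u i)) -> l2 f ->
  inner (fun k => \sum_(i <- r) c i * u i k) f =
  \sum_(i <- r) c i * inner (u i) f.
Proof.
move=> lu lf; elim: r => [|i r ih].
  under [X in inner X f]eq_fun do rewrite big_nil.
  by rewrite big_nil /inner (eq_cint _ (G := fun=> 0)) ?cint0// => k; rewrite mul0r.
under [X in inner X f]eq_fun do rewrite big_cons.
rewrite big_cons innerDl ?innerZl// ?ih//; first exact: (l2Z _ (lu i)).1.
exact: l2_sum.
Qed.

Lemma linear_sum_l2 I (r : seq I) (u : I -> Z -> C) (c : I -> C) P :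
  l2linear P -> (forall i, l2 (u i)) ->
  P (fun k => \sum_(i <- r) c i * u i k) = (fun k => \sum_(i <- r) c i * P (u i) k).
Proof.
move=> linP lu; elim: r => [|i r ih].
  under eq_fun do rewrite big_nil; rewrite linear0_l2//.
  by apply/funext => k; rewrite big_nil.
under eq_fun do rewrite big_cons.
rewrite linP// ?ih; last exact: l2_sum.
by apply/funext => k; rewrite big_cons.
Qed.

Definition orthonormal (I : eqType) (r : seq I) (u : I -> Z -> C) :=
  [/\ uniq r, forall i, l2 (u i) &
      forall i j, i \in r -> j \in r -> inner (u i) (u j) = (i == j)%:R].

(** For the projection [g] of [f] on the span, <g, f> and ||g||^2 both equal the sum S, and
    Cauchy-Schwarz gives S^2 <= S ||f||^2. *)
Lemma bessel (I : eqType) (r : seq I) (u : I -> Z -> C) f : orthonormal r u -> l2 f ->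
  \sum_(i <- r) normc (inner (u i) f) ^+ 2 <= nrm f ^+ 2.
Proof.
move=> [ur lu ou] lf; set S := \sum_(i <- r) _.
have S0 : 0 <= S by apply: sumr_ge0 => i _; rewrite sqr_ge0.
pose c i := conjc (inner (u i) f).
pose g k := \sum_(i <- r) c i * u i k.
have lg : l2 g by exact: l2_sum.
have gf : inner g f = S%:C.
  rewrite /g inner_suml// rmorph_sum; apply: eq_bigr => i _.
  by rewrite /c mulrC mulcJ.
have gg : inner g g = S%:C.
  rewrite {1}/g inner_suml// rmorph_sum big_seq [RHS]big_seq; apply: eq_bigr => i ir.
  rewrite inner_sumr// (bigD1_seq i)//= ou// eqxx mulr1.
  rewrite big_seq_cond big1 ?addr0; last first.
    by move=> j /andP[jr ji]; rewrite ou// eq_sym (negbTE ji) mulr0.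
  by rewrite mulcJ /c normc_conj.
have gS : nrm g ^+ 2 = S.
  have := gg; rewrite inner_self// => /(congr1 (@Re R)); exact.
have := normc_inner lg lf; rewrite gf ge0_normc_real// => h.
move: S0; rewrite le_eqVlt => /predU1P[<-|S0]; first exact: sqr_ge0.
have : S ^+ 2 <= (nrm g * nrm f) ^+ 2.
  by rewrite ler_sqr ?nnegrE ?mulr_ge0 ?nrm_ge0// ltW.
by rewrite exprMn gS expr2 ler_pM2l.
Qed.

End absolute_value.

(** * Eigenvalue sums of the absolute value *)

Section trace.
Context (R : realType) (n : nat).
Local Notation Z := (Zn n).
Local Notation C := R[i].
Local Notation muZT := (@muZT R n).
Local Notation ZT := (Zn n * Tn R n)%type.
Implicit Types (f h u v : Z -> C) (k : Z) (A B P : (Z -> C) -> Z -> C).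

Definition eigenvec P (lam : R) v := P v = (fun k => lam%:C * v k).

(* In place of Gram-Schmidt: for dimension reasons, some nonzero combination
   of the m vectors is orthogonal to q < m given ones. *)
Lemma eigen_extend P (lam : R) m (v : 'I_m -> Z -> C) : l2linear P ->
  (forall i, l2 (v i) /\ eigenvec P lam (v i)) ->
  (forall c : 'I_m -> C, (forall k, \sum_(i < m) c i * v i k = 0) -> forall i, c i = 0) ->
  forall q, (q <= m)%N -> exists u : nat -> Z -> C,
    orthonormal (iota 0 q) u /\ forall i, eigenvec P lam (u i).
Proof.
move=> linP vP vfree; elim=> [|q ih] qm.
  exists (fun _ _ => 0); split; first by split => // i; exact: (l2_0 R n).1.
  by move=> i; rewrite /eigenvec linear0_l2//; apply/funext => k; rewrite mulr0.
have [u [[uu lu ou] eu]] := ih (ltnW qm).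
(* Having fewer columns than rows, the matrix has a nonzero vector in its left kernel; its entries
   are the coefficients of a combination orthogonal to the [u j]. *)
pose M : 'M[C]_(m, q) := \matrix_(i < m, j < q) inner (v i) (u j).
have [i0 ci0] : exists i, row i (kermx M) != 0.
  apply/existsP; rewrite -negb_forall; apply/negP => /forallP h.
  have : \rank (kermx M) = 0%N.
    apply/eqP; rewrite mxrank_eq0; apply/eqP/row_matrixP => i.
    by rewrite row0; apply/eqP; exact: h.
  rewrite mxrank_ker => /eqP; rewrite subn_eq0 leqNgt.
  by rewrite (leq_ltn_trans (rank_leq_col M) qm).
pose c i := row i0 (kermx M) ord0 i.
have cM j : \sum_i c i * M i j = 0.
  have := mulmx_ker M => /(congr1 (fun N => row i0 N ord0 j)).
  rewrite row_mul => e; transitivity ((row i0 (kermx M) *m M) ord0 j).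
    by rewrite [RHS]mxE.
  by rewrite e !mxE.
pose x k := \sum_(i < m) c i * v i k.
have lv i : l2 (v i) := (vP i).1.
have lx : l2 x by exact: l2_sum.
have xu j : (j < q)%N -> inner x (u j) = 0.
  move=> jq; rewrite inner_suml// -[RHS](cM (Ordinal jq)).
  by apply: eq_bigr => i _; rewrite mxE.
have x0 : 0 < nrm x.
  rewrite lt_neqAle nrm_ge0 andbT eq_sym; apply/eqP => x0.
  case/eqP: ci0; apply/rowP => i; rewrite [RHS]mxE.
  apply: (vfree c) => k; apply/eqP; rewrite -normc_eq0 eq_le normc_ge0 andbT -x0.
  exact: (normc_le_nrm k lx).
have ex : eigenvec P lam x.
  rewrite /eigenvec linear_sum_l2//; apply/funext => k; rewrite mulr_sumr.
  by apply: eq_bigr => i _; rewrite (vP i).2; ring.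
pose y k := ((nrm x)^-1)%:C * x k.
have ly : l2 y := (l2Z _ lx).1.
have yu j : (j < q)%N -> inner y (u j) = 0.
  by move=> jq; rewrite innerZl// xu// mulr0.
exists (fun i => if i == q then y else u i); split; last first.
  move=> i; case: ifP => // _; rewrite /eigenvec linearZ_l2// ex.
  by apply/funext => k; rewrite /y mulrCA.
split; first exact: iota_uniq.
  by move=> i; case: ifP.
move=> i j; rewrite !mem_iota !add0n !ltnS !leq0n /=.
rewrite leq_eqVlt => /predU1P[->|iq]; rewrite leq_eqVlt => /predU1P[->|jq].
- rewrite eqxx innerZl ?innerZr// inner_self// conjc_real -!rmorphM.
  rewrite (_ : (nrm x)^-1 * ((nrm x)^-1 * nrm x ^+ 2) = 1) ?rmorph1//.
  by field; rewrite gt_eqF.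
- by rewrite eqxx (ltn_eqF jq) yu// eq_sym (ltn_eqF jq).
- rewrite eqxx (ltn_eqF iq) -innerC// yu//.
  by rewrite /conjc /= oppr0.
- by rewrite (ltn_eqF iq) (ltn_eqF jq) ou// mem_iota.
Qed.

Variables (G : Z -> C) (s : ZT -> C).
Hypothesis Goo : (nint (@countZ R n) G < +oo)%E.
Hypothesis si : cintegrable muZT s.
Local Notation L := (locop G s).

Definition trace_bound : R := nrm G ^+ 2 * fine (nint muZT s).

Lemma nint_sE : (fine (nint muZT s))%:E = nint muZT s.
Proof.
rewrite fineK// fin_numElt (cintegrable_nint si) andbT.
exact: lt_le_trans (ltNyr 0) (nint_ge0 _ _).
Qed.

Lemma trace_bound_ge0 : 0 <= trace_bound.
Proof. by rewrite mulr_ge0 ?sqr_ge0// fine_ge0// nint_ge0. Qed.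

(** At each [z] the products of transforms are bounded by half sums of squares, and Bessel against
    the single vector [atom z], of norm ||G||, bounds both sums uniformly in [z] and in the length
    of the families. *)
Lemma trace_le (I : eqType) (r : seq I) (v w : I -> Z -> C) :
  orthonormal r v -> orthonormal r w ->
  normc (\sum_(i <- r) inner (L (v i)) (w i)) <= trace_bound.
Proof.
move=> ov ow; have [_ lv _] := ov; have [_ lw _] := ow.
have wk i := locop_weak Goo si (lv i) (lw i).
under eq_bigr do rewrite (wk _).2.
rewrite -cint_sum; last by move=> i _; exact: (wk i).1.
rewrite -lee_fin EFinM nint_sE; apply: le_trans (normc_cint _) _.
  by apply: cintegrable_sum => i _; exact: (wk i).1.
rewrite -ge0_integralZl_EFin ?sqr_ge0//; last 2 first.
- by move=> z _; rewrite lee_fin normc_ge0.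
- exact: measurable_enormc (cintegrable_meas si).
apply: le_nint.
- by apply: cmeasurable_sum => i _; exact: cintegrable_meas (wk i).1.
- by apply: measurable_funeM; exact: measurable_enormc (cintegrable_meas si).
move=> z; rewrite -EFinM lee_fin.
under eq_bigr do rewrite -mulrA.
rewrite -mulr_sumr Normc.normcM mulrC ler_wpM2r ?normc_ge0//.
apply: le_trans (normc_sum _ _ _) _.
have la := l2_atom Goo z.
apply: (@le_trans _ _ (\sum_(i <- r) (2^-1 * normc (inner (v i) (atom G z)) ^+ 2 +
    2^-1 * normc (inner (w i) (atom G z)) ^+ 2))).
  apply: ler_sum => i _; rewrite Normc.normcM normc_conj !stft_inner.
  move: (normc _) (normc _) => b a; rewrite -subr_ge0.
  have -> : 2^-1 * a ^+ 2 + 2^-1 * b ^+ 2 - a * b = (a - b) ^+ 2 / 2 by field.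
  by rewrite divr_ge0 ?sqr_ge0.
rewrite big_split/= -!mulr_sumr.
have := bessel ov la; have := bessel ow la; rewrite nrm_atom.
by move: (\sum_(i <- r) _) (\sum_(i <- r) _) => a b; lra.
Qed.

Variable P : (Z -> C) -> Z -> C.
Hypothesis absP : is_abs_op L P.

(** P^2 = B L gives <L u_i, L u_j> = lam_j^2 <u_i, u_j>, so the vectors L u_i / lam_i are
    orthonormal; they are the images of the u_i under the partial isometry of the polar
    decomposition. *)
Lemma eigensum_le (I : eqType) (r : seq I) (u : I -> Z -> C) (lam : I -> R) :
  orthonormal r u -> (forall i, 0 < lam i) -> (forall i, eigenvec P (lam i) (u i)) ->
  \sum_(i <- r) lam i <= trace_bound.
Proof.
move=> ou lam0 eu; have [uu lu iu] := ou.
have [posP [B [/bounded_opP[lB _ _] adj] PB]] := absP.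
have [/bounded_opP[lP linP _] _] := posP.
have lL f : l2 f -> l2 (L f) by move=> /(l2_locop Goo si)[].
have LL i j : i \in r -> j \in r -> inner (L (u i)) (L (u j)) = (lam j ^+ 2)%:C * (i == j)%:R.
  move=> ir jr; rewrite (adj _ _ (lu i) (lL _ (lu j))) -(PB _ (lu j)) eu linearZ_l2// eu.
  rewrite innerZr ?innerZr// ?conjc_real; last exact: (l2Z _ (lu j)).1.
  by rewrite iu// mulrA -rmorphM -expr2.
pose w i k := ((lam i)^-1)%:C * L (u i) k.
have lw i : l2 (w i) := (l2Z _ (lL _ (lu i))).1.
have ow : orthonormal r w.
  split => // i j ir jr.
  rewrite (innerZl _ (lL _ (lu i)) (lw j)) (innerZr _ (lL _ (lu i)) (lL _ (lu j))).
  rewrite LL// conjc_real; case: eqP => [<-|_]; last by rewrite !mulr0.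
  rewrite mulr1 -!rmorphM (_ : _ * (_ * _) = 1) ?rmorph1//.
  by field; rewrite gt_eqF.
have := trace_le ou ow.
rewrite (_ : \sum_(i <- r) inner _ _ = (\sum_(i <- r) lam i)%:C); last first.
  rewrite rmorph_sum big_seq [RHS]big_seq; apply: eq_bigr => i ir.
  rewrite (innerZr _ (lL _ (lu i)) (lL _ (lu i))) LL// eqxx mulr1 conjc_real.
  rewrite -rmorphM (_ : _ * _ = lam i)//.
  by field; rewrite gt_eqF.
rewrite ge0_normc_real//; apply: sumr_ge0 => i _; exact: ltW.
Qed.

Let linP : l2linear P. Proof. by have [[/bounded_opP[]]] := absP. Qed.

Definition eigendim (lam : R) (m : nat) := exists v : 'I_m -> Z -> C,
  (forall i, l2 (v i) /\ P (v i) = (fun k => lam%:C * v i k)) /\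
  (forall c : 'I_m -> C,
     (forall k, \sum_(i < m) c i * v i k = 0) -> forall i, c i = 0).

Lemma eigendim_ortho lam m : eigendim lam m -> exists u : nat -> Z -> C,
  orthonormal (iota 0 m) u /\ forall i, eigenvec P lam (u i).
Proof. by move=> [v [vP vfree]]; exact: (eigen_extend linP vP vfree (leqnn m)). Qed.

(** An orthonormal family of [m] eigenvectors gives m lam <= [trace_bound], so the supremum defining
    the multiplicity is over finitely many integers and is attained. *)
Lemma eigenmult_max lam : 0 < lam -> exists m, eigendim lam m /\
  eigenmult P lam = m%:R%:E.
Proof.
move=> lam0.
have bd m : eigendim lam m -> (m <= Num.truncn (trace_bound / lam))%N.
  move=> /eigendim_ortho[u [ou eu]].
  have := eigensum_le (lam := fun=> lam) ou (fun=> lam0) eu.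
  rewrite big_const_seq count_predT size_iota iter_addr_0 -mulr_natr => h.
  have t0 : 0 <= trace_bound / lam by rewrite divr_ge0 ?trace_bound_ge0// ltW.
  by rewrite truncn_ge_nat// ler_pdivlMr// mulrC.
have ex0 : exists m, `[< eigendim lam m >].
  by exists 0%N; apply/asboolP; exists (fun _ _ => 0); split => [[]|? ? []].
have ub m : `[< eigendim lam m >] -> (m <= Num.truncn (trace_bound / lam))%N.
  by move=> /asboolP; exact: bd.
case: (ex_maxnP ex0 ub) => m /asboolP dm mmax; exists m; split => //.
apply/eqP; rewrite eq_le; apply/andP; split.
  apply: ge_ereal_sup => _ [j dj <-]; rewrite lee_fin ler_nat.
  by apply: mmax; apply/asboolP.
by apply: ereal_sup_ubound; exists m.
Qed.

(** For a finite set of positive numbers, the maximal orthonormal families of eigenvectors are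
    merged into one family indexed by pairs. Vectors for distinct eigenvalues are orthogonal since
    [P] is symmetric, so [eigensum_le] applies to the whole family. *)
Lemma esum_eigenmult_le : (\esum_(lam in [set lam : R | (0 < lam)%R])
  (lam%:E * eigenmult P lam)%E <= trace_bound%:E)%E.
Proof.
have ex lam : exists p : nat * (nat -> Z -> C), 0 < lam ->
    [/\ orthonormal (iota 0 p.1) p.2, forall i, eigenvec P lam (p.2 i) &
      eigenmult P lam = p.1%:R%:E].
  have [lam0|] := ltP 0 lam; last by exists (0%N, fun _ _ => 0).
  have [m [dm em]] := eigenmult_max lam0; have [u [ou eu]] := eigendim_ortho dm.
  by exists (m, u).
have [p pP] := choice ex.
apply: ge_ereal_sup => _ [F [Ffin Fpos] <-].
rewrite fsbig_finite//=; set t := finmap.enum_fset _.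
have tpos lam : lam \in t -> 0 < lam.
  by rewrite in_fset_set// inE => /Fpos.
have ut : uniq t by exact: finmap.fset_uniq.
rewrite big_seq (eq_bigr (fun lam => (lam * (p lam).1%:R)%:E)); last first.
  by move=> lam /tpos/pP[_ _ ->].
rewrite -big_seq sumEFin lee_fin.
pose r := [seq (lam, i) | lam <- t, i <- iota 0 (p lam).1].
(* [eigensum_le] asks for a positive eigenvalue and an eigenvector at every index, also outside [r];
   the zero vector with eigenvalue 1 serves as default. *)
pose u (x : R * nat) : Z -> C := if 0 < x.1 then (p x.1).2 x.2 else fun _ => 0.
pose l (x : R * nat) : R := if 0 < x.1 then x.1 else 1.
have eu x : eigenvec P (l x) (u x).
  rewrite /u /l; case: ifP => [/pP[_ h _]|_]; first exact: h.
  by rewrite /eigenvec linear0_l2//; apply/funext => k; rewrite mulr0.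
have lu x : l2 (u x).
  rewrite /u; case: ifP => [/pP[[_ h _] _ _]|_]; [exact: h|exact: (l2_0 R n).1].
have ou : orthonormal r u.
  split => //.
    apply: allpairs_uniq_dep => //.
      by move=> lam _; exact: iota_uniq.
    by move=> [? ?] [? ?] _ _ /= [-> ->].
  move=> _ _ /allpairsPdep[a [i [at_ ir ->]]] /allpairsPdep[b [j [bt jr ->]]].
  have a0 := tpos _ at_; have b0 := tpos _ bt.
  have [ab|ab] := eqVneq a b.
    rewrite -{}ab in jr *; rewrite /u /= a0.
    by have [[_ _ h] _ _] := pP _ a0; rewrite h// xpair_eqE eqxx.
  rewrite xpair_eqE (negbTE ab) /=.
  have := positive_sym absP.1 (lu (a, i)) (lu (b, j)).
  rewrite !eu innerZl ?innerZr// conjc_real /l /= a0 b0 => /eqP.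
  rewrite -subr_eq0 -mulrBl mulf_eq0 -rmorphB => /orP[|/eqP//].
  move=> /eqP/(congr1 (@Re R))/eqP /=; rewrite subr_eq0 (negbTE ab).
  by [].
have := eigensum_le ou (lam := l) _ eu.
rewrite big_allpairs_dep /= (eq_big_seq (fun lam => lam * (p lam).1%:R)).
  by apply => x; rewrite /l; case: ifP.
move=> lam /tpos lam0; rewrite /l /= lam0 big_const_seq count_predT size_iota.
by rewrite iter_addr_0 mulr_natr.
Qed.

End trace.

Lemma S1norm_locop_le (R : realType) n (G : Zn n -> R[i]) (s : Zn n * Tn R n -> R[i]) :
  (nint (@countZ R n) G < +oo)%E -> cintegrable (@muZT R n) s ->
  (exists P, is_abs_op (locop G s) P) /\
  (S1norm (locop G s) <= (nrm G ^+ 2)%:E * nint (@muZT R n) s)%E.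
Proof.
move=> Goo si.
have exP := abs_op_exists (bounded_locop Goo si) (adjoint_locop Goo si).
(* [abs_op] is a choice by [xget], which satisfies [is_abs_op] because such an operator exists. *)
split => //; have absP : is_abs_op (locop G s) (abs_op (locop G s)).
  by have [P PP] := exP; exact: (xgetPex _ (ex_intro _ P PP)).
apply: le_trans (esum_eigenmult_le Goo si absP) _.
by rewrite /trace_bound EFinM nint_sE.
Qed.

(** The symbol is given as a distribution while the weak formula integrates a function, hence the
    existential [symb] with [represents]. Membership in S_1 is stated for all nonzero Schwartz
    windows, the numerical bound for normalized ones. *)
Theorem proposition4p7 (R : realType) (n : nat)
  (phi : Zn n -> R[i]) (Phi : Zn n * Tn R n -> R[i])
  (schwartz_phi : schwartzZ phi) (phi_neq0 : exists k, phi k <> 0)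
  (schwartz_Phi : schwartzZT Phi) (Phi_neq0 : exists x, Phi x <> 0)
  (sigma : (Zn n * Tn R n -> R[i]) -> R[i]) (g : (Zn n -> R[i]) -> R[i])
  (sigma_M1 : modZT Phi 1%:E sigma) (g_M1 : modZ phi 1%:E g) :
  exists (symb : Zn n * Tn R n -> R[i]) (L : (Zn n -> R[i]) -> Zn n -> R[i]),
  [/\ represents sigma symb,
      localization_op (funZ g) (funZ g) symb L,
      in_S1 L
    & (1 <= l2norm phi)%E ->
      (1 <= ereal_sup [set (Normc.normc (Phi x))%:E | x in setT])%E ->
      (S1norm L <= 4%:E * modnormZT Phi 1%:E sigma * modnormZ phi 1%:E g ^+ 2)%E].
Proof.
have [tg [mV moo]] := g_M1.
have Goo := window_lty tg schwartz_phi mV moo phi_neq0.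
have si := symbol_integrable schwartz_Phi Phi_neq0 sigma_M1.
have [exP SL] := S1norm_locop_le Goo si.
exists (symbol sigma), (locop (funZ g) (symbol sigma)); split.
- exact: (represents_symbol schwartz_Phi Phi_neq0 sigma_M1).
- split; first exact: bounded_locop.
  by move=> f h lf lh; exact: locop_weak.
- split; [exact: compact_locop|exact: exP|].
  apply: le_lt_trans SL _.
  by rewrite -(nint_sE si) -EFinM ltry.
move=> phi1 Phi1; apply: le_trans SL _.
have Gle := window_nrm tg schwartz_phi mV moo phi_neq0 phi1.
have sle z := symbol_L1 schwartz_Phi Phi_neq0 sigma_M1 z.
have Soo : (modnormZT Phi 1%:E sigma < +oo)%E by case: sigma_M1 => _ [].
have Woo : (modnormZ phi 1%:E g < +oo)%E := moo.
have W0 : (0 <= modnormZ phi 1%:E g)%E := le_trans (nrm_ge0 _ : (0 <= _%:E)%E) Gle.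
have S0 : (0 <= modnormZT Phi 1%:E sigma)%E.
  apply: le_trans (sle (0, [tuple 0 | i < n])).
  by rewrite mule_ge0 ?nint_ge0// lee_fin normc_ge0.
have rE := nint_sE si; set r := fine _ in rE.
have r0 : 0 <= r by rewrite fine_ge0// nint_ge0.
rewrite -{}rE in sle *.
move: Soo Woo W0 S0 Gle sle.
case: (modnormZT Phi 1%:E sigma) => // b; case: (modnormZ phi 1%:E g) => // a.
move=> _ _; rewrite !lee_fin => a0 b0 Ga sle.
(* r |Phi(z)| <= b holds for every z, and dividing by [r] before taking the supremum covers a
   supremum that is not attained. *)
have rb : r <= b.
  move: r0; rewrite le_eqVlt => /predU1P[<-//|r0].
  have : (ereal_sup [set (normc (Phi x))%:E | x in setT] <= (b / r)%:E)%E.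
    apply: ge_ereal_sup => _ [x _ <-]; rewrite lee_fin ler_pdivlMr//.
    by have := sle x; rewrite -EFinM lee_fin.
  by move=> /(le_trans Phi1); rewrite lee_fin ler_pdivlMr// mul1r.
have G2 : nrm (funZ g) ^+ 2 <= a * a.
  by rewrite -expr2 ler_sqr ?nnegrE ?nrm_ge0.
(* The estimate is complete with constant 1; the factor 4 enters only here. *)
apply: (@le_trans _ _ (a * a * b)); first by rewrite ler_pM ?sqr_ge0.
rewrite [leLHS]mulrC -[leRHS]mulrA ler_peMl ?mulr_ge0// ler1n//.
Qed.
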